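(* Every graph $G$ with odd girth at least $11$ that does not contain an odd wheel as a t-minor is $199049$-colourable.
   Context: All graphs are finite and simple. The odd girth of a graph is the length of a shortest odd cycle ($\infty$ if there is none). For $k\ge 3$, the $k$-wheel is the graph consisting of a cycle of length $k$ together with one additional vertex adjacent to every vertex of the cycle; an odd wheel is a $k$-wheel with $k$ odd. A t-contraction of a graph $G$ at a vertex $v$ whose neighbourhood $N_G(v)$ is a stable set is the operation of contracting all edges incident with $v$ (i.e. identifying $N_G[v]=\{v\}\cup N_G(v)$ into a single vertex, keeping the graph simple). A graph $H$ is a t-minor of $G$ if $H$ can be obtained from $G$ by a sequence of vertex deletions and t-contractions. A graph is $k$-colourable if its vertex set is a union of $k$ stable sets. *)

(* Defs.v *)
From mathcomp Require Import all_boot.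

Set Implicit Arguments.
Unset Strict Implicit.
Unset Printing Implicit Defensive.

Record sgraph := SGraph {
  svertex :> finType;
  sedge : rel svertex;
  sedge_sym : symmetric sedge;
  sedge_irr : irreflexive sedge }.

Arguments sedge {s}.

Notation "x -- y" := (sedge x y) (at level 30).

Definition iso (G H : sgraph) : Prop :=
  exists2 f : G -> H, bijective f & forall x y, (f x -- f y) = (x -- y).

Definition nbh (G : sgraph) (v : G) : {set G} := [set x | v -- x].

Definition stable (G : sgraph) (S : {set G}) : bool :=
  [forall x in S, forall y in S, ~~ (x -- y)].

Definition colourable (k : nat) (G : sgraph) : Prop :=
  exists2 S : 'I_k -> {set G},
    forall i, stable (S i) & \bigcup_i S i = [set: G].

Definition odd_cycle (G : sgraph) (s : seq G) : bool :=
  [&& 3 <= size s, odd (size s) & ucycleb sedge s].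

Definition has_odd_cycle (G : sgraph) (n : nat) : bool :=
  [exists s : n.-tuple G, odd_cycle s].

(* [None] stands for infinity.  A cycle has at most #|G| vertices, so it is
   enough to look for lengths in that range; [iota] is increasing. *)
Definition odd_girth (G : sgraph) : option nat :=
  ohead [seq n <- iota 0 #|G|.+1 | has_odd_cycle G n].

Definition geq_ext (g : option nat) (n : nat) : bool :=
  if g is Some m then n <= m else true.

Lemma odd_girth_geqP (G : sgraph) (n : nat) :
  geq_ext (odd_girth G) n <-> (forall s : seq G, odd_cycle s -> n <= size s).
Proof.
rewrite /odd_girth; set r := [seq _ <- _ | _].
have memr m : (m \in r) = has_odd_cycle G m.
  rewrite mem_filter mem_iota add0n ltnS /=.
  apply/andP/idP => [[]|h] //; split=> //.
  have /existsP[s /and3P[_ _ /andP[_ us]]] := h.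
  by rewrite -(size_tuple s) -(card_uniqP us) max_card.
have memc (s : seq G) : odd_cycle s -> size s \in r.
  by move=> hs; rewrite memr; apply/existsP; exists (in_tuple s).
have: sorted leq r.
  by apply: sorted_filter; [exact: leq_trans | exact: iota_sorted].
case: r memr memc => [|m r] memr memc /= srt.
  by split=> // _ s /memc.
split=> [le_nm s /memc | H].
  rewrite inE => /predU1P[-> // | /(allP (order_path_min leq_trans srt))].
  exact: leq_trans.
have := memr m; rewrite mem_head => /esym/existsP[s /H].
by rewrite size_tuple.
Qed.

Section Deletion.
Variables (G : sgraph) (v : G).

Definition del_vertex : finType := {x : G | x != v}.
Definition del_edge : rel del_vertex := [rel x y | val x -- val y].

Fact del_edge_sym : symmetric del_edge.
Proof. by move=> x y; exact: sedge_sym. Qed.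

Fact del_edge_irr : irreflexive del_edge.
Proof. by move=> x; exact: sedge_irr. Qed.

Definition del : sgraph := SGraph del_edge_sym del_edge_irr.

End Deletion.

Section Contraction.
Variables (G : sgraph) (v : G).

(* The vertex obtained by identifying N[v] is represented by v itself, and
   [merge] sends each vertex of G to its representative. *)
Definition merge (x : G) : G := if x \in nbh v then v else x.

Definition contr_vertex : finType := {x : G | x \notin nbh v}.
Definition contr_edge : rel contr_vertex :=
  [rel x y | (x != y) &&
    [exists x', exists y',
      [&& merge x' == val x, merge y' == val y & x' -- y']]].

Fact contr_edge_sym : symmetric contr_edge.
Proof.
have sub x y : contr_edge x y -> contr_edge y x.
  case/andP=> ne_xy /existsP[a /existsP[b /and3P[ha hb ab]]].
  apply/andP; split; first by rewrite eq_sym.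
  by apply/existsP; exists b; apply/existsP; exists a; rewrite ha hb sedge_sym.
by move=> x y; apply/idP/idP; exact: sub.
Qed.

Fact contr_edge_irr : irreflexive contr_edge.
Proof. by move=> x; rewrite /contr_edge /= eqxx. Qed.

Definition tcontract : sgraph := SGraph contr_edge_sym contr_edge_irr.

End Contraction.

(* [tminor H G]: H is a t-minor of G, graphs being taken up to isomorphism. *)
Inductive tminor (H : sgraph) : sgraph -> Prop :=
| tminor_iso (G : sgraph) : iso G H -> tminor H G
| tminor_del (G : sgraph) (v : G) : tminor H (del v) -> tminor H G
| tminor_contract (G : sgraph) (v : G) :
    stable (nbh v) -> tminor H (tcontract v) -> tminor H G.

Section Wheel.
Variable k : nat.

(* [None] is the hub; [ordS] is the successor modulo k.  The test [i != j]
   only matters for the degenerate value k = 1. *)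
Definition wheel_edge : rel (option 'I_k) := fun x y =>
  match x, y with
  | Some i, Some j => (i != j) && ((j == ordS i) || (i == ordS j))
  | None, None => false
  | _, _ => true
  end.

Fact wheel_edge_sym : symmetric wheel_edge.
Proof. by case=> [i|] [j|] //=; rewrite eq_sym orbC. Qed.

Fact wheel_edge_irr : irreflexive wheel_edge.
Proof. by case=> [i|] //=; rewrite eqxx. Qed.

Definition wheel : sgraph := SGraph wheel_edge_sym wheel_edge_irr.

End Wheel.

Definition has_odd_wheel_tminor (G : sgraph) : Prop :=
  exists k, [/\ 3 <= k, odd k & tminor (wheel k) G].

(* Main.v *)
From mathcomp Require Import all_boot zify.
Require Import Defs.

(* Suppose that the chromatic number is large.  In a level of a levelling, take
   a second levelling; in one of its levels grow a rope, that is, vertices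
   pairwise far apart such that consecutive ones are joined by two induced
   paths of different parities.  The inner levelling closes the rope to a
   cycle, which is induced whatever paths are chosen.  In the outer levelling,
   any three vertices of the rope with their parents (the legs) are joined by a
   connected bipartite graph, the hub, whose other vertices do not see the
   cycle.

   Contracting one side of the hub, and the vertices of the cycle at odd
   distance from the last neighbour of the other side, gives a wheel; its number
   of spokes is odd as soon as three vertices touched by the hub cut the cycle
   into paths of even length, which can be reached by choosing the parities of
   the links.  If one of the three legs is on the wrong side of the hub, then
   either another vertex touched by the other two legs replaces its end, or the
   cycle is rerouted through it, or it is contracted together with its end.
   Among seven legs, some three fall in one of these cases. *)

Set Implicit Arguments.
Unset Strict Implicit.
Unset Printing Implicit Defensive.

(** Nothing controls how many vertices of the cycle a leg sees, so spokes are never counted.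
    Whatever vertices are touched, the rule of contraction makes the number of spokes congruent
    modulo 2 to the length of the cycle; three touched vertices with suitable arcs only ensure that
    this length is odd and that there are at least three spokes. What remains is to correct the
    parities of the arcs, hence two links per leg, one on each side of its end.

    All distances are measured up to four: two ends of the rope whose parents have a common parent
    are joined by a walk of four edges. Odd girth 11 makes a ball of radius four bipartite, so
    keeping away from a vertex costs two colours.

    The bound obtained is 636 = 2 * 2 * (5 + 14 * 11): a factor 2 for each levelling, 14 links for
    seven legs, 11 colours for each link, and 5 to start and to close the rope. *)

(** * Models of t-minors *)

Definition fibre_rel (G H : sgraph) (U : {set G}) (f : G -> H) : rel G :=
  [rel x y | [&& x \in U, y \in U, x -- y & f x == f y]].

(* A vertex [a] of [H] stands for the fibre of [f] over [a]; contracting all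
   the vertices of [X] collapses each fibre to a point. *)
Definition tmodel (G H : sgraph) (U X : {set G}) (f : G -> H) : Prop :=
  [/\ X \subset U,
      {in X & U, forall x y, x -- y -> y \notin X /\ f y = f x},
      {in U :\: X &, forall x y, x -- y -> f x -- f y} &
      (forall a b : H, a -- b -> exists x y, [/\ x \in U :\: X, y \in U :\: X,
         x -- y, f x = a & f y = b])
    /\ ((forall a : H, exists2 x, x \in U & f x = a)
    /\ {in U &, forall x y, f x = f y -> connect (fibre_rel U f) x y})].

Lemma connect_map (S T : finType) (r : rel S) (r' : rel T) (g : S -> T) :
  (forall x y, r x y -> connect r' (g x) (g y)) ->
  forall x y, connect r x y -> connect r' (g x) (g y).
Proof.
move=> h x y /connectP[p]; elim: p x => [|z p IH] x /=; first by move=> _ ->.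
by case/andP=> /h xz pz /(IH _ pz); apply: connect_trans.
Qed.

(** In a model each fibre is a connected bipartite graph with sides in [X] and in [U :\: X], and
    within [U] a vertex of [X] sees only its own fibre. So, once the rest is deleted, its
    neighbourhood is stable and can be contracted. When [U] is everything and [X] is empty, the
    fibres are connected and stable, hence points, and [f] is an isomorphism. *)
Lemma tmodel_tminor (G H : sgraph) (U X : {set G}) (f : G -> H) :
  tmodel U X f -> tminor H G.
Proof.
(* Contracting an isolated vertex of [X] does not shrink the graph, whence [#|X|] in the measure: a
   contracted vertex always leaves [X]. *)
have [n] := ubnP (#|G| + #|X|); elim: n G U X f => // n IH G U X f ltn.
move=> [XU XY YY [EE [FF CC]]].
have [/setP UT | nU] := eqVneq U setT; last first.
  have [v vU] : exists v, v \notin U.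
    case: (pickP [pred v | v \notin U]) => [v vU|h]; first by exists v.
    by case/eqP: nU; apply/setP=> v; rewrite inE; have := h v => /= /negbFE.
  apply: (@tminor_del _ _ v).
  have neqv x : x \in U -> x != v by move=> xU; apply: contraNneq vU => <-.
  apply: (IH (del v) [set x : del v | val x \in U] [set x : del v | val x \in X] (fun x =>
    f (val x))).
    apply: leq_trans (_ : #|G| + #|X| <= n) => //.
    rewrite -addSn; apply: leq_add.
      rewrite card_sub -(cardC (pred1 v)) card1 add1n ltnS.
      by apply: subset_leq_card; apply/subsetP=> x; rewrite !inE.
    rewrite -(card_imset _ (@val_inj _ _ _)).
    apply: subset_leq_card; apply/subsetP=> _ /imsetP[x + ->].
    by rewrite inE.
  split.
  - by apply/subsetP=> x; rewrite !inE; apply: (subsetP XU).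
  - move=> x y; rewrite !inE => xX yU xy; exact: XY xX yU xy.
  - move=> x y; rewrite !inE => xX yU xy.
    by apply: YY => //; rewrite inE.
  split; [|split].
  - move=> a b /EE[x [y [xU yU xy fx fy]]].
    have [/andP[xX xu] /andP[yX yu]] : 
      (x \notin X) && (x \in U) /\ (y \notin X) && (y \in U).
      by move: xU yU; rewrite !inE.
    by exists (Sub x (neqv _ xu)), (Sub y (neqv _ yu)); rewrite !inE xX xu yX yu.
  - move=> a; have [x xU fx] := FF a; exists (Sub x (neqv _ xU)) => //.
    by rewrite inE.
  move=> x y; rewrite !inE => xU yU fxy.
  have [p pp ey] := connectP (CC _ _ xU yU fxy).
  elim: p x xU {fxy} pp ey => [|z p IHp] x xU /=.
    by move=> _ /val_inj ->.
  case/andP=> /and4P[_ zU xz fxz] pz ey.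
  pose z' : del v := Sub z (neqv _ zU).
  have st : fibre_rel [set x : del v | val x \in U] (fun x => f (val x)) x z'.
    by rewrite /fibre_rel /= !inE xU zU fxz andbT; exact: xz.
  apply: connect_trans (connect1 st) _.
  exact: (IHp z').
have UT' x : x \in U by rewrite UT.
have [X0 | [x xX]] := set_0Vmem X.
  apply: tminor_iso; exists f; last first.
    move=> x y; apply/idP/idP => [|xy]; last by apply: YY; rewrite // X0 setD0.
    move/EE=> [x' [y' [x'U y'U xy fx fy]]].
    have inj z z' : f z = f z' -> z = z'.
      move=> fz; have [[|w p] /=] := connectP (CC _ _ (UT' z) (UT' z') fz) => //.
      case/andP=> /and4P[_ _ zw /eqP fzw] _ _.
      have := YY _ _ _ _ zw; rewrite X0 setD0 fzw sedge_irr => /(_ (UT' _) (UT' _)).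
      by [].
    by rewrite -(inj _ _ fx) -(inj _ _ fy).
  have inj : injective f.
    move=> z z' fz; have [[|w p] /=] := connectP (CC _ _ (UT' z) (UT' z') fz) => //.
    case/andP=> /and4P[_ _ zw /eqP fzw] _ _.
    have := YY _ _ _ _ zw; rewrite X0 setD0 fzw sedge_irr => /(_ (UT' _) (UT' _)).
    by [].
  have surj a : exists x, f x == a by have [x _ <-] := FF a; exists x.
  exists (fun a => xchoose (surj a)) => [z|a]; last exact/eqP/(xchooseP (surj a)).
  by apply: inj; apply/eqP/(xchooseP (surj (f z))).
have Yn y : x -- y -> y \notin X /\ f y = f x by apply: XY.
have nx : x \notin nbh x by rewrite inE sedge_irr.
apply: (@tminor_contract _ _ x).
  apply/forall_inP=> y; rewrite inE => /Yn[yX fy].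
  apply/forall_inP=> z; rewrite inE => /Yn[zX fz].
  apply/negP=> /YY; rewrite !inE yX zX !UT' fy fz sedge_irr; by move=> /(_ isT isT).
have mn y : merge x y \notin nbh x by rewrite /merge; case: ifP => // ->.
have fm y : f (merge x y) = f y by rewrite /merge inE; case: ifP => // /Yn[].
pose m y : tcontract x := Sub (merge x y) (mn y).
have mid (y : tcontract x) : m (val y) = y.
  by apply: val_inj; rewrite /= /merge (negbTE (valP y)).
have Em y z : y -- z -> m y != m z -> (m y : tcontract x) -- m z.
  move=> yz nyz; rewrite /sedge /= /contr_edge /= nyz /=.
  by apply/existsP; exists y; apply/existsP; exists z; rewrite !eqxx yz.
have mE (y z : tcontract x) : y -- z ->
    exists a b, [/\ merge x a = val y, merge x b = val z & a -- b].
  by case/andP=> _ /existsP[a /existsP[b /and3P[/eqP ? /eqP ? ?]]]; exists a, b.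
have mX a : a \in X -> merge x a = a.
  by move=> aX; rewrite /merge inE; case: ifP => // /Yn[]; rewrite aX.
apply: (IH (tcontract x) setT [set y : tcontract x | (val y \in X) && (val y != x)] (fun y =>
  f (val y))).
  apply: leq_trans (_ : #|G| + #|X| <= n) => //.
  rewrite -addnS; apply: leq_add.
    by rewrite card_sub; apply: max_card.
  rewrite -(card_imset _ (@val_inj _ _ _)) (cardsD1 x X) xX add1n ltnS.
  apply: subset_leq_card; apply/subsetP=> _ /imsetP[y + ->].
  by rewrite !inE andbC.
(* If [a] were in [X], it would represent itself, so [val y] would be in [X] and therefore be [x];
   but then [b], a neighbour of [x], would be merged into [y] as well. *)
have repY (y : tcontract x) a b : merge x a = val y ->
  a -- b -> merge x b != val y -> val y \notin X \/ val y = x -> a \notin X.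
  move=> ay ab nb yX; apply/negP=> aX; move: ay; rewrite (mX _ aX) => ay.
  case: yX; first by rewrite -ay aX.
  move=> yx; have ax : a = x by apply: etrans ay yx.
  have mb : merge x b = x by rewrite /merge inE -{1}ax ab.
  by case/negP: nb; apply/eqP; apply: etrans mb (esym yx).
split.
- exact: subsetT.
- move=> y z; rewrite !inE => /andP[yX yx] _ yz.
  have [a [b [ay bz ab]]] := mE _ _ yz.
  have ey : a = val y.
    move: ay; rewrite /merge; case: ifP => // _ e.
    by case/eqP: yx; exact: esym e.
  rewrite ey in ab; have [bX fb] := XY _ _ yX (UT' b) ab.
  rewrite -bz fm fb; split=> //.
  by rewrite /merge; case: ifP => _; rewrite ?eqxx ?andbF // (negbTE bX).
- move=> y z; rewrite !inE !andbT !negb_and !negbK => hy hz yz.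
  have [a [b [ay bz ab]]] := mE _ _ yz.
  have nyz : val y != val z by case/andP: yz.
  have aX : a \notin X.
    apply: (repY y) ab _ _ => //; first by rewrite bz eq_sym.
    by case/orP: hy => [|/eqP]; [left|right].
  have bX : b \notin X.
    apply: (repY z b a) => //; first by rewrite sedge_sym.
      by rewrite ay.
    by case/orP: hz => [|/eqP]; [left|right].
  by rewrite -ay -bz !fm; apply: YY => //; rewrite !inE ?aX ?bX UT'.
split; [|split].
- move=> a b ab; have [y [z [yU zU yz fy fz]]] := EE _ _ ab.
  have [yX zX] : y \notin X /\ z \notin X by move: yU zU; rewrite !inE !UT' !andbT.
  exists (m y), (m z); rewrite !inE /= !fm; split => //.
  + by rewrite /merge; case: ifP => _; rewrite ?eqxx ?andbF // (negbTE yX).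
  + by rewrite /merge; case: ifP => _; rewrite ?eqxx ?andbF // (negbTE zX).
  apply: Em => //; apply/eqP=> /(congr1 (fun u : tcontract x => f (val u))) /=.
  by rewrite !fm fy fz => e; move: ab; rewrite e sedge_irr.
- by move=> a; have [y _ <-] := FF a; exists (m y); rewrite ?inE //= fm.
move=> y z _ _ fyz; rewrite -[y]mid -[z]mid.
apply: connect_map (CC _ _ (UT' _) (UT' _) fyz) => {y z fyz} y z.
case/and4P=> _ _ yz /eqP fyz; have [->|ne] := eqVneq (m y) (m z); first exact: connect0.
by apply: connect1; rewrite /fibre_rel /= !inE /= !fm fyz eqxx andbT; apply: Em.
Qed.

(** * Induced paths and cycles *)

Section Lists.
Variable G : sgraph.
Implicit Types (x y z : G) (s p q : seq G).

Fixpoint ipath s : bool :=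
  if s is x :: s' then
    [&& x \notin s',
        (if s' is y :: s'' then (x -- y) && all (fun z => ~~ (x -- z)) s''
         else true) & ipath s']
  else true.

Definition icyc s : bool :=
  if s is x :: p then
    [&& ipath p, x \notin p, 1 < size p &
        all (fun z => (x -- z) == ((z == head x p) || (z == last x p))) p]
  else false.

Lemma ipath_uniq s : ipath s -> uniq s.
Proof. by elim: s => //= x s IH /and3P[-> _ /IH]. Qed.

Lemma ipath_path x s : ipath (x :: s) -> path sedge x s.
Proof. by elim: s x => //= y s IH x /and3P[_ /andP[-> _] /IH]. Qed.

Lemma ipath_suffix p q : ipath (p ++ q) -> ipath q.
Proof. by elim: p => //= x p IH /and3P[_ _ /IH]. Qed.

Lemma ipath_prefix p q : ipath (p ++ q) -> ipath p.
Proof.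
elim: p => //= x p IH /and3P[xpq h /IH ->]; rewrite andbT.
move: xpq; rewrite mem_cat negb_or => /andP[-> _] /=.
by case: p h {IH} => //= y p /andP[-> ]; rewrite all_cat => /andP[].
Qed.

Lemma ipath_cat p x q :
  ipath (rcons p x) -> ipath (x :: q) ->
  {in p & q, forall y z, y != z /\ ~~ (y -- z)} -> ipath (rcons p x ++ q).
Proof.
elim: p => [|y p IH] //= /and3P[yp h ip] iq hpq.
have {}IH := IH ip iq (fun u v up => hpq u v (mem_behead (s := y :: p) up)).
rewrite IH andbT mem_cat negb_or yp /=.
have -> /= : y \notin q.
  apply/negP=> yq; have [] := hpq y y _ yq; first exact: mem_head.
  by rewrite eqxx.
have aq : all (fun z => ~~ (y -- z)) q.
  by apply/allP=> z zq; have [] := hpq y z (mem_head _ _) zq.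
by case: p h {IH yp ip hpq} => [|w p] /= /andP[-> h] /=; rewrite ?aq // all_cat h.
Qed.

Lemma ipath_rcons p x : ipath p -> x \notin p ->
  {in p, forall z, (x -- z) = (z == last x p)} -> ipath (rcons p x).
Proof.
case/lastP: p => [|p y] //; move=> ip xp h; rewrite -cats1.
move: (xp); rewrite mem_rcons inE negb_or eq_sym => /andP[yx xp'].
apply: ipath_cat => //=.
  rewrite inE yx /= !andbT sedge_sym h ?last_rcons ?eqxx //.
  by rewrite mem_rcons mem_head.
move=> z w zp; rewrite inE => /eqP->; split.
  by apply: contraNneq xp' => <-.
rewrite sedge_sym h ?last_rcons; last by rewrite mem_rcons inE zp orbT.
have := ipath_uniq ip; rewrite rcons_uniq => /andP[yp _].
by apply: contraNneq yp => <-.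
Qed.

Lemma icycP x p : reflect
  [/\ ipath p, x \notin p, 1 < size p &
     {in p, forall z, (x -- z) = (z == head x p) || (z == last x p)}]
  (icyc (x :: p)).
Proof.
apply: (iffP and4P) => [] [h1 h2 h3 h4]; split=> //.
  by move=> z zp; apply/eqP; apply: (allP h4).
by apply/allP=> z zp; rewrite h4.
Qed.

Lemma icyc_rot1 x p : icyc (x :: p) -> icyc (rcons p x).
Proof.
case/icycP; case: p => [|y [|w p]] // ip xp _ h.
have /= /and3P[yp /andP[yw yh] ip'] := ip.
have nyl z : z \in w :: p -> (z == y) = false.
  by move=> zp; apply: contraNF yp => /eqP <-.
rewrite [rcons _ _]/=; apply/icycP; split.
- rewrite -rcons_cons; apply: ipath_rcons => //.
    by apply: contra xp => xp; rewrite in_cons xp orbT.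
  by move=> z zp; rewrite h ?in_cons ?zp ?orbT //= (nyl _ zp).
- rewrite -rcons_cons mem_rcons inE negb_or yp andbT.
  by apply: contraNneq xp => <-; rewrite mem_head.
- by rewrite /= size_rcons.
move=> z; rewrite -rcons_cons mem_rcons inE last_rcons /= => /predU1P[->|zp].
  rewrite eqxx orbT sedge_sym h ?mem_head //=.
  by rewrite eqxx.
have -> : (z == x) = false.
  by apply: contraNF xp => /eqP<-; rewrite inE zp orbT.
rewrite orbF; move: zp; rewrite inE => /predU1P[->|zp]; first by rewrite yw eqxx.
rewrite (negbTE (allP yh _ zp)); apply/esym.
by have /= /and3P[wp _ _] := ip'; apply: contraNF wp => /eqP<-.
Qed.

Lemma icyc_rot p q : icyc (p ++ q) -> icyc (q ++ p).
Proof.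
elim: p q => [|x p IH] q; first by rewrite cats0.
by move/icyc_rot1; rewrite -cats1 -catA => /IH; rewrite -catA cat1s.
Qed.

Lemma icyc_uniq s : icyc s -> uniq s.
Proof. by case: s => // x p /icycP[/ipath_uniq h1 h2 _ _] /=; rewrite h1 h2. Qed.

Lemma icyc_ipath p q : q != [::] -> icyc (p ++ q) -> ipath p.
Proof.
by case: q => // x q _ /icyc_rot /= /icycP[/ipath_suffix].
Qed.

Lemma ipath_edge x0 s i j : ipath s -> i < j < size s ->
  (nth x0 s i -- nth x0 s j) = (j == i.+1).
Proof.
elim: s i j => [|x s IH] [|i] [|j] //=; rewrite ?andbF //.
  case: s {IH} => [|y s] //= /and3P[_ /andP[xy h] _].
  case: j => [|j] //= js; rewrite eqSS; apply/negbTE.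
  by apply: (allP h); rewrite mem_nth.
by case/and3P=> _ _ ip; rewrite !ltnS !eqSS; apply: IH.
Qed.

Lemma ipath_nth x0 s i : ipath s -> i.+1 < size s -> nth x0 s i -- nth x0 s i.+1.
Proof. by move=> ip h; rewrite (ipath_edge x0 ip) ?eqxx // ltnSn. Qed.

(* Indices run from [0] to [size s], position [size s] being the first vertex
   again. *)
Lemma icyc_nth x p i : icyc (x :: p) -> i <= size p ->
  nth x (x :: rcons p x) i -- nth x (x :: rcons p x) i.+1.
Proof.
case/icycP=> ip xp sp h; case: i => [|i] /=.
  rewrite nth_rcons (ltnW sp) h ?mem_nth ?(ltnW sp) // -nth0 eqxx //.
move=> isp; rewrite !nth_rcons isp.
have [i1|] := ltnP i.+1 (size p); first exact: ipath_nth.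
move=> i1; have ei : i.+1 = size p by apply/eqP; rewrite eqn_leq isp.
rewrite ei eqxx sedge_sym h ?mem_nth //.
by rewrite (last_nth x) -ei /= eqxx orbT.
Qed.

Lemma icyc_edge x p y z : icyc (x :: p) -> y \in x :: p -> z \in x :: p ->
  y -- z -> exists2 i, i <= size p &
  let c := nth x (x :: rcons p x) in
  (y = c i /\ z = c i.+1) \/ (z = c i /\ y = c i.+1).
Proof.
move=> ic; have /icycP[ip xp sp h] := ic.
have key w : w \in p -> x -- w -> exists2 i, i <= size p &
  let c := nth x (x :: rcons p x) in
  (x = c i /\ w = c i.+1) \/ (w = c i /\ x = c i.+1).
  move=> wp; rewrite h // => /orP[] /eqP->.
    exists 0 => //=; left; split=> //; by rewrite nth_rcons (ltnW sp) -nth0.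
  exists (size p) => //=; right; split; last by rewrite nth_rcons ltnn eqxx.
  rewrite (last_nth x) -rcons_cons nth_rcons /= ltnSn //.
rewrite !inE => /predU1P[->|yp] /predU1P[->|zp].
- by rewrite sedge_irr.
- exact: key.
- by rewrite sedge_sym => /(key _ yp)[i si /= hi]; exists i => //=; case: hi; [right|left].
have nthp u : u \in p -> exists2 i, i < size p & u = nth x p i.
  by move=> up; exists (index u p); rewrite ?index_mem ?nth_index.
have [i ip' ->] := nthp _ yp; have [j jp ->] := nthp _ zp.
have lem a b : a < b -> b < size p -> nth x p a -- nth x p b -> b = a.+1.
  by move=> ab bp; rewrite (ipath_edge x ip) ?ab // => /eqP.
have [ij|ji|->] := ltngtP i j; last by rewrite sedge_irr.
  move/(lem _ _ ij jp)=> ej; exists i.+1 => //=; left; rewrite !nth_rcons ip'.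
  by rewrite -ej jp.
rewrite sedge_sym => /(lem _ _ ji ip') ei; exists j.+1 => //=; right.
by rewrite !nth_rcons jp -ei ip'.
Qed.

End Lists.

(** * Odd wheels from cycles touched by a hub *)

Section Scan.
Variables (G : sgraph) (t : pred G) (b : bool) (c : nat -> G).

(* [(scan i).2] numbers the fibre of the vertex at position [i], and
   [(scan i).1] tells whether that vertex is to be contracted: this happens to
   the untouched vertices at odd distance from the last touched one. *)
Fixpoint scan i : bool * nat :=
  if i is j.+1 then
    if t (c i) then (false, (scan j).2 + ~~ (scan j).1)
    else (~~ (scan j).1, (scan j).2)
  else (b, 0).

Lemma scan_touched i : t (c i.+1) -> (scan i.+1).1 = false.
Proof. by rewrite /= => ->. Qed.

Lemma scan_free i : t (c i.+1) = false -> (scan i.+1).1 = ~~ (scan i).1.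
Proof. by rewrite /= => ->. Qed.

(** Each step changes either the flag or, by one, the label, and never both. So at an uncontracted
    vertex the label has the parity of the position, up to [b], whichever vertices are touched. *)
Lemma scan_odd i : odd (scan i).2 (+) (scan i).1 = odd i (+) b.
Proof.
elim: i => //= i IH; case: ifP => _ /=; rewrite ?oddD addNb -IH.
  by case: (scan i).1 => /=; case: (odd _).
by case: (scan i).1 => /=; case: (odd _).
Qed.

Lemma scanS i : (scan i).2 <= (scan i.+1).2 <= (scan i).2.+1.
Proof. by rewrite /=; case: ifP => _ /=; case: (scan i).1 => /=; lia. Qed.

Lemma scan_mono i j : i <= j -> (scan i).2 <= (scan j).2.
Proof.
move=> /subnKC <-; elim: (j - i) => [|m IH]; first by rewrite addn0.
by rewrite addnS (leq_trans IH) //; have /andP[] := scanS (i + m).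
Qed.

(** Labels start at 0 and grow by at most one, only on entering a touched vertex from an
    uncontracted one. The vertex that opens a new fibre is thus touched and can supply its spoke. *)
Lemma scan_incr n a : a < (scan n).2 -> exists j, [/\ j < n, (scan j).2 = a,
  (scan j.+1).2 = a.+1, (scan j).1 = false & t (c j.+1)].
Proof.
elim: n => // n IH h.
have [lt|ge] := ltnP a (scan n).2; first by have [j [? ? ? ? ?]] := IH lt; exists j;
  split=> //; lia.
move: h => /=; case: ifP => /= [tn|_]; last by lia.
case E: (scan n).1 => /= h; first by lia.
exists n; split=> //=; rewrite ?tn ?E /=; lia.
Qed.

(** Two touched vertices at odd distance have labels of different parities, and labels never
    decrease. *)
Lemma scan_odd_lt i j : i < j -> t (c i.+1) -> t (c j) -> odd (j - i.+1) ->
  (scan i.+1).2 < (scan j).2.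
Proof.
case: j => // j ij ti tj od.
have := scan_odd i.+1; have := scan_odd j.+1.
have := @scan_mono i.+1 j.+1 ij.
rewrite leq_eqVlt => /orP[/eqP e|//].
have e1 : (scan i.+1).1 = false by rewrite /= ti.
have e2 : (scan j.+1).1 = false by rewrite /= tj.
rewrite e1 e2 e !addbF => ->; move: od; rewrite oddB //.
by case: (odd i.+1); case: (odd j.+1); case: b.
Qed.

End Scan.

Lemma wheel_succ k (i j : 'I_k) : 1 < k -> j = i.+1 %% k :> nat ->
  (Some i : wheel k) -- Some j.
Proof.
move=> k1 e; have ej : j = ordS i by apply: val_inj.
rewrite /sedge /= ej eqxx andbT -val_eqE /= -e; apply/eqP=> ei.
have := ltn_ord i; rewrite leq_eqVlt => /predU1P[ek|lt].
  by move: e; rewrite ek modnn; lia.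
by move: e; rewrite -ei modn_small //; lia.
Qed.

(* [t] marks the vertices of the cycle that count as touched by [HY].  If [b]
   holds, then [x] itself is contracted: it is not touched, but its neighbours
   on the cycle and the leg [E] join its fibre. *)
Section WheelModel.
Variables (G : sgraph) (x : G) (s p : seq G) (HX HY E : {set G}).
Variables (t : pred G) (b : bool).
Let c := nth x (x :: rcons p x).
Let L := (size p).+1.
Let sc := scan t b c.
Let T z := [exists y in HY, y -- z].
Let k := (sc L).2.

Hypothesis es : s = x :: p.
Hypothesis ic : icyc (x :: p).
Hypothesis HXY : [disjoint HX & HY].
Hypothesis Hs : [disjoint HX :|: HY & s].
Hypothesis HXst : stable HX.
Hypothesis HYst : stable HY.
Hypothesis Hconn : {in HX :|: HY &, forall y z,
  connect [rel u v | [&& u \in HX :|: HY, v \in HX :|: HY & u -- v]] y z}.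
Hypothesis HXs : {in HX & s, forall y z, ~~ (y -- z)}.
Hypothesis tx : t x = ~~ b.
Hypothesis Tt : {in s, forall z, T z -> t z}.
Hypothesis tT : {in p, forall z, t z -> T z \/ b /\ (z = head x p \/ z = last x p)}.
Hypothesis tends : b -> t (head x p) && t (last x p).
Hypothesis ED : [disjoint E & HX :|: HY].
Hypothesis Es : [disjoint E & s].
Hypothesis Est : stable E.
Hypothesis Ex : {in E, forall a, a -- x}.
Hypothesis Ep : {in E & p, forall a z, ~~ (a -- z)}.
Hypothesis EHX : {in E & HX, forall a z, ~~ (a -- z)}.
Hypothesis Eb : b = false -> E = set0.
Hypothesis zero : T x \/ exists2 a, a \in E & T a.
Hypothesis k3 : 3 <= k.
Hypothesis kodd : odd k.

Let Lp : L = (size p).+1. Proof. by []. Qed.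

Let Ls : size s = L. Proof. by rewrite es. Qed.

Let xs : x \in s. Proof. by rewrite es mem_head. Qed.

Let ps z : z \in p -> z \in s. Proof. by rewrite es inE => ->; rewrite orbT. Qed.

Let sxp z : z \in s -> z = x \/ z \in p.
Proof. by rewrite es inE => /predU1P[]; [left|right]. Qed.

Let ix : index x s = 0. Proof. by rewrite es /= eqxx. Qed.

Let us : uniq s. Proof. by rewrite es; apply: icyc_uniq. Qed.

Let c0 : c 0 = x. Proof. by []. Qed.

Let cL : c L = x. Proof. by rewrite /c /= nth_rcons ltnn eqxx. Qed.

Let cE i : i < L -> c i = nth x s i.
Proof. by rewrite es; case: i => //= i; rewrite /L ltnS /c /= => ip; rewrite nth_rcons ip. Qed.

Let cs i : i <= L -> c i \in s.
Proof.
rewrite leq_eqVlt => /predU1P[->|iL]; first by rewrite cL.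
by rewrite cE ?mem_nth ?Ls.
Qed.

Let ci z : z \in s -> index z s < L /\ c (index z s) = z.
Proof.
by move=> zs; rewrite -Ls index_mem zs; split=> //; rewrite cE -?Ls ?index_mem // nth_index.
Qed.

Let ic_c i : i < L -> index (c i) s = i.
Proof. by move=> iL; rewrite cE // index_uniq ?Ls. Qed.

Let off i : bool := (sc i).1.
Let lab i : nat := (sc i).2.

Let offS i : off i.+1 = if t (c i.+1) then false else ~~ off i.
Proof. by rewrite /off /sc /=; case: ifP. Qed.

Let labS i : lab i.+1 = if t (c i.+1) then lab i + ~~ off i else lab i.
Proof. by rewrite /lab /sc /=; case: ifP. Qed.

Let psz : 1 < size p. Proof. by case/icycP: ic. Qed.

Let clast : c (size p) = last x p.
Proof.
rewrite (last_nth x) /c; case E1: (size p) psz => [|m] //= _.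
by rewrite nth_rcons E1 ltnSn.
Qed.

Let off0 : off 0 = b. Proof. by []. Qed.

(** The scan closes up: if [b] holds, the last vertex of [p] counts as touched, so [x] is contracted
    again on the return; otherwise [x] is touched, hence uncontracted both times. *)
Let offL : off L = off 0.
Proof.
rewrite Lp offS -Lp cL tx off0; have [bt|//] := boolP b.
have [_ tl] := andP (tends bt); rewrite /=.
have -> // : off (size p) = false.
by move: psz; case E1: (size p) => [|m] // _; rewrite offS -E1 clast tl.
Qed.

Let labk i : i <= L -> lab i <= k. Proof. by move=> iL; apply: scan_mono. Qed.

Let k0 : 0 < k. Proof. exact: leq_trans k3. Qed.

(** On the return to [x] the label is [k], which must name the fibre of [x] again; hence the
    reduction modulo [k]. *)
Definition wlab (i : nat) : 'I_k := Ordinal (ltn_pmod (lab i) k0).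

Let f z : wheel k :=
  if z \in HX :|: HY then None
  else if z \in s then Some (wlab (index z s)) else Some (wlab 0).

Let U := HX :|: HY :|: [set z in s] :|: E.
Let X := HX :|: [set z in s | off (index z s)].

Let nHs z : z \in s -> (z \in HX :|: HY) = false.
Proof. by move=> zs; apply/negP => /(disjointFr Hs); rewrite zs. Qed.

Let fs z : z \in s -> f z = Some (wlab (index z s)).
Proof. by move=> zs; rewrite /f (nHs zs); case: ifP => // /negP. Qed.

Let fH z : z \in HX :|: HY -> f z = None.
Proof. by rewrite /f => ->. Qed.

Let fE z : z \in E -> f z = Some (wlab 0).
Proof. by move=> zE; rewrite /f (disjointFr ED) // (disjointFr Es). Qed.

Let wlabL : wlab L = wlab 0.
Proof. by apply: val_inj => /=; rewrite modnn /lab /= mod0n. Qed.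

Let fc i : i <= L -> f (c i) = Some (wlab i).
Proof.
rewrite leq_eqVlt => /predU1P[->|iL].
  by rewrite cL fs // ix wlabL.
by rewrite fs ?cs ?(ltnW iL) // ic_c.
Qed.

Let offc i : i <= L -> off (index (c i) s) = off i.
Proof.
rewrite leq_eqVlt => /predU1P[->|iL]; last by rewrite ic_c.
by rewrite cL offL ix.
Qed.

Let sU z : z \in s -> z \in U. Proof. by move=> zs; rewrite !inE zs ?orbT. Qed.

Let cX i : i <= L -> (c i \in X) = off i.
Proof.
move=> iL; rewrite !inE cs // offc //.
by have := nHs (cs iL); rewrite inE => /norP/=[/negbTE-> _].
Qed.

Let cedge i : i < L -> c i -- c i.+1.
Proof. by rewrite Lp ltnS => h; apply: icyc_nth. Qed.

Let sedgeE y z : y \in s -> z \in s -> y -- z -> exists2 i, i < L &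
  (y = c i /\ z = c i.+1) \/ (z = c i /\ y = c i.+1).
Proof. by rewrite es => ys zs yz; have [i iL h] := icyc_edge ic ys zs yz; exists i. Qed.

Let edge_in i : i < L -> off i || off i.+1 ->
  [/\ off i = ~~ off i.+1 & lab i.+1 = lab i].
Proof.
move=> iL; rewrite offS labS; case: ifP => _; case: (off i) => //= _.
by rewrite addn0.
Qed.

Let edge_out i : i < L -> ~~ off i -> ~~ off i.+1 -> lab i.+1 = (lab i).+1.
Proof.
move=> iL; rewrite offS labS; case: ifP => _; case: (off i) => //= _.
by rewrite addn1.
Qed.

Let wheel_out i : lab i.+1 = (lab i).+1 -> (Some (wlab i) : wheel k) -- Some (wlab i.+1).
Proof.
move=> e; apply: wheel_succ; first exact: leq_trans k3.
by rewrite /= e -addn1 -modnDml addn1.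
Qed.

Lemma wheel_model : tmodel U X f.
Proof.
have Hin z : (z \in HX) || (z \in HY) -> z \in HX :|: HY by rewrite inE.
have cases z : z \in U -> [\/ z \in HX, z \in HY, z \in s | z \in E].
  rewrite /U !in_setU in_set -!orbA => /or4P[]; by [constructor 1|constructor 2|constructor
    3|constructor 4].
have Xoff z : z \in s -> (z \in X) = off (index z s).
  by move=> zs; have [iL <-] := ci zs; rewrite cX ?(ltnW iL) // ic_c.
have symfib : connect_sym (fibre_rel U f).
  apply: sym_connect_sym => u v; rewrite /fibre_rel /= andbCA sedge_sym.
  by congr [&& _, _, _ & _]; rewrite eq_sym.
have Xt i : i < L -> off i.+1 -> ~~ t (c i.+1).
  by move=> _; rewrite offS; case: ifP.
have noT z : z \in s -> z \in X -> ~~ t z.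
  move=> zs; have [iL ez] := ci zs; rewrite Xoff //.
  case: (index z s) iL ez => [|i] iL ez.
    by rewrite -ez c0 tx /off /= negbK.
  by rewrite -ez => /Xt->//; apply: ltnW.
have HYX z : z \in HY -> z \notin X.
  move=> zY; rewrite inE negb_or (disjointFl HXY) //=; apply/negP.
  by rewrite inE => /andP[/nHs]; rewrite inE zY orbT.
have Ea0 a : a \in E -> off 0.
  by move=> aE; rewrite /off /=; case: b (Eb) => // /(_ erefl) e; rewrite e inE in aE.
split.
- by apply/subsetP=> z; rewrite !inE => /orP[->|/andP[-> _]]; rewrite ?orbT.
- move=> y z yX zU yz; move: (yX); rewrite in_setU => /orP[yH|].
    have zY : z \in HY.
      case: (cases _ zU) => [zH|//|zs|zE].
      + by have /forall_inP/(_ _ yH)/forall_inP/(_ _ zH) := HXst; rewrite yz.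
      + by have := HXs yH zs; rewrite yz.
      + by have := EHX zE yH; rewrite sedge_sym yz.
    by split; rewrite ?HYX // !fH ?Hin ?yH ?zY ?orbT.
  rewrite in_set => /andP[ys _].
  have nHY : z \notin HY.
    apply/negP=> zY; case/negP: (noT _ ys yX); apply: Tt => //.
    by apply/existsP; exists z; rewrite zY sedge_sym.
  have fl i : i < L -> lab i.+1 = lab i -> f (c i) = f (c i.+1).
    by move=> iL l; rewrite !fc ?(ltnW iL) //; congr Some; apply: val_inj => /=; rewrite l.
  case: (cases _ zU) => [zH|zY|zs|zE].
  + by have := HXs zH ys; rewrite sedge_sym yz.
  + by rewrite zY in nHY.
  + have [i iL [[ey ez]|[ez ey]]] := sedgeE ys zs yz.
      rewrite ey cX ?(ltnW iL) // in yX.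
      have [|o l] := @edge_in i iL; first by rewrite yX.
      split; last by rewrite ey ez (fl i iL l).
      by rewrite ez (cX iL); move: o; rewrite yX; case: (off i.+1).
    rewrite ey cX // in yX.
    have [|o l] := @edge_in i iL; first by rewrite yX orbT.
    split; last by rewrite ey ez (fl i iL l).
    by rewrite ez (cX (ltnW iL)) o yX.
  have ey : y = x.
    by case: (sxp ys) => // yp; have := Ep zE yp; rewrite sedge_sym yz.
  split; last by rewrite fE // ey fs // ix.
  apply/negP; rewrite in_setU in_set => /orP[zH|/andP[zs _]].
    by have := disjointFr ED zE; rewrite in_setU zH.
  by rewrite (disjointFr Es zE) in zs.
- move=> y z /setDP[yU yX] /setDP[zU zX] yz.
  have nHX u : u \notin X -> u \notin HX by apply: contra => uH; rewrite inE uH.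
  have HY_ u v : u \in HY -> v \in U -> v \notin X -> u -- v -> f u -- f v.
    move=> uY vU vX uv; rewrite fH ?inE ?uY ?orbT //.
    case: (cases _ vU) => [vH|vY|vs|vE].
    + by rewrite (negbTE (nHX _ vX)) in vH.
    + by have /forall_inP/(_ _ uY)/forall_inP/(_ _ vY) := HYst; rewrite uv.
    + by rewrite fs.
    + by rewrite fE.
  have [yY|nyY] := boolP (y \in HY); first exact: HY_.
  have [zY|nzY] := boolP (z \in HY); first by rewrite sedge_sym; apply: HY_;
    rewrite // sedge_sym.
  have sE u : u \in U -> u \notin X -> u \notin HY -> u \in s \/ u \in E.
    move=> uU uX uY; case: (cases _ uU) => [h|h|h|h]; [| |by left|by right].
      by rewrite (negbTE (nHX _ uX)) in h.
    by rewrite h in uY.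
  have E_ u v : u \in E -> v \in s -> v \notin X -> u -- v -> False.
    move=> uE vs vX uv; case: (sxp vs) => [ev|vp]; last by have := Ep uE vp; rewrite uv.
    by case/negP: vX; rewrite ev Xoff // ix; apply: Ea0 uE.
  case: (sE _ yU yX nyY) => [ys|yE]; case: (sE _ zU zX nzY) => [zs|zE].
  + rewrite !Xoff // in yX zX.
    have [i iL [[ey ez]|[ey ez]]] := sedgeE ys zs yz.
      rewrite ey ez !offc ?(ltnW iL) // in yX zX.
      by rewrite ey ez !fc ?(ltnW iL) //; apply: wheel_out; apply: edge_out.
    rewrite ey ez !offc ?(ltnW iL) // in yX zX.
    rewrite ey ez !fc ?(ltnW iL) // sedge_sym.
    by apply: wheel_out; apply: edge_out.
  + by case: (E_ z y) => //; rewrite sedge_sym.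
  + by case: (E_ y z).
  + by have /forall_inP/(_ _ yE)/forall_inP/(_ _ zE) := Est; rewrite yz.
have YU z : z \in HY -> z \in U :\: X.
  by move=> zY; rewrite !inE zY ?orbT /=; have := HYX _ zY; rewrite !inE => ->.
have cU i : i <= L -> ~~ off i -> c i \in U :\: X.
  by move=> iL oi; rewrite inE cX // oi sU ?cs.
have incr a : a < k -> exists j, [/\ j < L, lab j = a, lab j.+1 = a.+1, off j = false & t (c
  j.+1)].
  exact: scan_incr.
have hd : c 1 = head x p.
  by rewrite /c /= nth_rcons (ltnW psz) nth0.
have cinj i j : i < L -> j < L -> c i = c j -> i = j.
  by move=> iL jL e; rewrite -(ic_c iL) -(ic_c jL) e.
(* The fibre 0 gets its spoke from [x] or from the leg in [E]. The vertex that opens a later fibre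
   could count as touched merely as a neighbour of the contracted [x]; but then its label is 0 or
   [k], that of [x]. *)
have spoke a : a < k ->
    exists y z, [/\ y \in HY, z \in U :\: X, y -- z & exists2 w : 'I_k, f z = Some w & w = a
      :> nat].
  case: a => [_|a ak].
    case: zero => [Tx|[e eE Te]].
      have ob : ~~ off 0 by rewrite -tx; apply: Tt.
      have [y /andP[yY yx]] := existsP Tx.
      exists y, x; split=> //; first exact: (cU 0).
      by exists (wlab 0); rewrite ?fs ?ix //= mod0n.
    have [y /andP[yY ye]] := existsP Te.
    have eH := disjointFr ED eE; have es' := disjointFr Es eE.
    exists y, e; split=> //; last by exists (wlab 0); rewrite ?fE //= mod0n.
    rewrite in_setD !in_setU in_set eE !orbT andbT es' orbF.
    by move: eH; rewrite in_setU => /norP[].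
  have [j [jL lj lj1 oj tj]] := incr a (ltnW ak).
  have j1L : j.+1 < L.
    rewrite ltn_neqAle jL andbT; apply: contraTneq ak => ej.
    by rewrite -lj1 ej ltnn.
  have cp : c j.+1 \in p.
    case: (sxp (cs (ltnW j1L))) => // e; move: (cinj j.+1 0 j1L isT).
    by rewrite e c0 => /(_ erefl).
  have oj1 : ~~ off j.+1 by rewrite offS tj.
  case: (tT cp tj) => [/existsP[y /andP[yY yc]]|[bt [e|e]]].
  - exists y, (c j.+1); split=> //; first by apply: cU => //; apply: ltnW.
    by exists (wlab j.+1); rewrite ?fc ?(ltnW j1L) //= lj1 modn_small.
  - have := cinj j.+1 1 j1L; rewrite e hd /L ltnS (ltnW psz) => /(_ isT erefl) [ej].
    by move: lj1 tj; rewrite ej labS => + t1; rewrite t1 off0 bt addn0.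
  have := cinj j.+1 (size p) j1L; rewrite e clast /L ltnSn => /(_ isT erefl) ej.
  have : lab L = a.+1 by rewrite Lp labS -Lp cL tx bt -lj1 ej.
  by move=> kL; rewrite /lab -/k in kL; rewrite kL ltnn in ak.
have rim i : (exists y z, [/\ y \in U :\: X, z \in U :\: X, y -- z,
    f y = Some i & f z = Some (ordS i)]).
  have [j [jL lj lj1 oj tj]] := incr i (ltn_ord i).
  have oj1 : ~~ off j.+1 by rewrite offS tj.
  exists (c j), (c j.+1); split.
  - by apply: cU; rewrite ?oj // ltnW.
  - exact: cU.
  - exact: cedge.
  - by rewrite fc ?(ltnW jL) //; congr Some; apply: val_inj; rewrite /= lj modn_small.
  - by rewrite fc //; congr Some; apply: val_inj; rewrite /= lj1.
split; [|split].
- have sw (u v : wheel k) : (exists y z, [/\ y \in U :\: X, z \in U :\: X, y -- z, f y = u &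
  f z = v]) ->
     exists y z, [/\ y \in U :\: X, z \in U :\: X, y -- z, f y = v & f z = u].
    by case=> y [z [? ? yz ? ?]]; exists z, y; split; rewrite // sedge_sym.
  have sp (i : 'I_k) : exists y z, [/\ y \in U :\: X, z \in U :\: X, y -- z,
       f y = None & f z = Some i].
    have [y [z [yY zU yz [w fz /val_inj ew]]]] := spoke i (ltn_ord i).
    by exists y, z; split=> //; [exact: YU | rewrite fH // in_setU yY orbT | rewrite fz ew].
  case=> [i|] [j|] //; [|by move=> _; apply: sw].
  rewrite /sedge /= => /andP[_ /orP[/eqP->|/eqP->]]; first exact: rim.
  exact/sw/rim.
- case=> [i|].
    have [y [z [_ /setDP[zU _] _ [w fz /val_inj ew]]]] := spoke i (ltn_ord i).
    by exists z; rewrite ?fz ?ew.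
  have [y [z [yY _ _ _]]] := spoke 0 k0.
  by exists y; [have /setDP[] := YU _ yY | rewrite fH // inE yY orbT].
have step i : i < L -> lab i = lab i.+1 -> connect (fibre_rel U f) (c i) (c i.+1).
  move=> iL e; apply: connect1; rewrite /fibre_rel /= !sU ?cs ?(ltnW iL) // cedge //=.
  rewrite !fc ?(ltnW iL) //; apply/eqP; congr Some; apply: val_inj => /=.
  by rewrite e.
have walk i j : i <= j -> j <= L -> lab i = lab j -> connect (fibre_rel U f) (c i) (c j).
  move=> /subnKC <-; elim: (j - i) => [|m IH]; first by rewrite addn0.
  rewrite addnS => lL e; have := scan_mono t b c (leq_addr m i).
  rewrite -/sc -/(lab _) -/(lab _) => m1; have /andP[m2 _] := scanS t b c (i + m).
  rewrite -/sc -/(lab _) -/(lab _) in m2.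
  have e1 : lab i = lab (i + m) by apply/eqP; rewrite eqn_leq m1 e m2.
  by apply: connect_trans (IH (ltnW lL) e1) (step _ lL _); rewrite -e1.
(* On the cycle, the fibre of [x] consists of the vertices labelled 0, reached from position 0, and
   of those labelled [k], reached from position [L]. *)
have walk0 z : z \in s -> f z = Some (wlab 0) -> connect (fibre_rel U f) x z.
  move=> zs; have [iL ez] := ci zs; rewrite fs // => /Some_inj/(congr1 val) /=.
  rewrite mod0n => e; set i := index z s in iL ez e.
  have := labk (ltnW iL); rewrite leq_eqVlt => /predU1P[ek|lt]; last first.
    by rewrite -ez -c0; apply: walk => //; [exact: ltnW | rewrite modn_small in e].
  by rewrite symfib -ez -cL; apply: walk => //; exact: ltnW.
have f0 y : y \in E -> connect (fibre_rel U f) x y.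
  move=> yE; rewrite symfib; apply: connect1.
  apply/and4P; split; [by rewrite /U in_setU yE orbT | exact: sU | exact: Ex |].
  by rewrite fE // fs // ix.
have wlk y z : y \in s -> z \in s -> f y = f z -> connect (fibre_rel U f) y z.
  move=> ys zs e; have [e0|n0] := eqVneq (f y) (Some (wlab 0)).
    have c2 := walk0 _ zs (etrans (esym e) e0).
    by apply: connect_trans c2; rewrite symfib; apply: walk0.
  have [iL ey] := ci ys; have [jL ez] := ci zs.
  move: e n0; rewrite !fs //; set i := index y s in iL ey *; set j := index z s in jL ez *.
  move=> /Some_inj/(congr1 val) /= e n0; have lt m : m < L -> val (wlab m) != 0 -> lab m < k.
    move=> mL; rewrite ltn_neqAle labk ?(ltnW mL) // andbT /=.
    by apply: contraNneq => ->; rewrite modnn.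
  have ni : val (wlab i) != 0.
    by apply: contraNneq n0 => h; apply/eqP; congr Some; apply: val_inj; rewrite h /= mod0n.
  have nj : val (wlab j) != 0 by move: ni => /=; rewrite e.
  rewrite !modn_small ?lt // in e.
  rewrite -ey -ez; have [ij|ji] := leqP i j; first by apply: walk => //; apply: ltnW.
  by rewrite symfib; apply: walk => //; apply: ltnW.
have cases' z : z \in U -> [\/ z \in HX :|: HY, z \in s | z \in E].
  by case/cases => h; [constructor 1|constructor 1|constructor 2|constructor 3];
    rewrite // in_setU h ?orbT.
have hubc y z : y \in HX :|: HY -> z \in HX :|: HY -> connect (fibre_rel U f) y z.
  move=> yH zH; apply: connect_map (Hconn yH zH) => u v /= /and3P[uH vH uv].
  apply: connect1; rewrite /fibre_rel /= uv !fH // eqxx !andbT.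
  by rewrite /U !(in_setU _ (HX :|: HY :|: _)) !(in_setU _ (HX :|: HY)) uH vH.
move=> y z yU zU.
case: (cases' _ yU) => [yH|ys|yE]; case: (cases' _ zU) => [zH|zs|zE] e.
- exact: hubc.
- by rewrite (fH yH) (fs zs) in e.
- by rewrite (fH yH) (fE zE) in e.
- by rewrite (fs ys) (fH zH) in e.
- exact: wlk.
- apply: (@connect_trans _ _ x); last exact: f0.
  by rewrite symfib; apply: walk0; rewrite // e fE.
- by rewrite (fE yE) (fH zH) in e.
- apply: (@connect_trans _ _ x); first by rewrite symfib; apply: f0.
  by apply: walk0; rewrite // -e fE.
- by apply: (@connect_trans _ _ x); [rewrite symfib; apply: f0 | apply: f0].
Qed.

End WheelModel.

Section Wheels.
Variable G : sgraph.
Implicit Types (x y z : G) (A B C p : seq G) (HX HY : {set G}).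

Definition restr (A : {set G}) : rel G :=
  [rel u v | [&& u \in A, v \in A & u -- v]].

Definition hub HX HY : Prop :=
  [/\ [disjoint HX & HY], stable HX, stable HY &
      {in HX :|: HY &, forall y z, connect (restr (HX :|: HY)) y z}].

Definition touched HY z : bool := [exists y in HY, y -- z].

(** [A], [B] and [C] omit the ends of the arcs, so each arc joins its ends by an odd number of
    edges. Hence the label increases on each arc, which gives at least three spokes, and the cycle
    is odd, which makes their number odd. *)
Lemma wheel_touching x t2 t3 A B C HX HY :
  let s := x :: A ++ t2 :: B ++ t3 :: C in
  hub HX HY -> icyc s -> [disjoint HX :|: HY & s] ->
  {in HX & s, forall y z, ~~ (y -- z)} ->
  touched HY x -> touched HY t2 -> touched HY t3 ->
  ~~ odd (size A) -> ~~ odd (size B) -> ~~ odd (size C) ->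
  has_odd_wheel_tminor G.
Proof.
move=> s [HXY sX sY co] ic ds Xs Tx T2 T3 oA oB oC.
set p := A ++ t2 :: B ++ t3 :: C in s ic ds Xs.
pose c := nth x (x :: rcons p x); pose t := [pred z | touched HY z].
pose lab i := (scan t false c i).2.
have sp : size p = (size A + size B + size C).+2.
  by rewrite size_cat /= size_cat /= !addnS addnA.
have c2 : c (size A).+1 = t2.
  by rewrite /c /= nth_rcons sp ifT; [rewrite nth_cat ltnn subnn | clear; lia].
have c3 : c (size A + size B).+2 = t3.
  rewrite /c /= nth_rcons sp ifT; last by clear; lia.
  rewrite nth_cat ifF; last by clear; lia.
  have -> : (size A + size B).+1 - size A = (size B).+1 by clear; lia.
  by rewrite /= nth_cat ltnn subnn.
have cL : c (size p).+1 = x by rewrite /c /= nth_rcons ltnn eqxx.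
have l1 : 0 < lab (size A).+1.
  have := scan_odd t false c (size A).+1; rewrite /lab.
  have -> : (scan t false c (size A).+1).1 = false by rewrite /= c2 /= T2.
  by rewrite !addbF ?addbT oddS oA; case: (scan _ _ _ _).2.
have l2 : lab (size A).+1 < lab (size A + size B).+2.
  by apply: scan_odd_lt; rewrite ?c2 ?c3 //=; move: oB; clear; lia.
have l3 : lab (size A + size B).+2 < lab (size p).+1.
  by apply: scan_odd_lt; rewrite ?cL ?c3 ?sp //=; move: oC; clear; lia.
have ok : odd (lab (size p).+1).
  have := scan_odd t false c (size p).+1.
  have -> : (scan t false c (size p).+1).1 = false by rewrite /= cL /= Tx.
  by rewrite /lab !addbF => ->; rewrite sp; move: oA oB oC; clear; lia.
exists (lab (size p).+1); split=> //; first by exact: leq_ltn_trans (leq_ltn_trans l1 l2) l3.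
apply: tmodel_tminor.
apply: (@wheel_model G x s p HX HY set0 t false) => //.
- by move=> z _ /= Tz; left.
- by rewrite -setI_eq0 set0I.
- by apply/pred0P=> z; rewrite /= inE.
- by apply/forall_inP=> z; rewrite inE.
- by move=> z; rewrite inE.
- by move=> z y; rewrite inE.
- by move=> z y; rewrite inE.
- by left.
- exact: leq_ltn_trans (leq_ltn_trans l1 l2) l3.
Qed.

(* The leg [a] is contracted together with [x], whose neighbours on the cycle
   thus become touched: this is why the outer arcs are odd. *)
Lemma wheel_through_leg x a t2 t3 A B C HX HY :
  let s := x :: A ++ t2 :: B ++ t3 :: C in
  hub HX HY -> icyc s -> [disjoint HX :|: HY & s] ->
  {in HX & s, forall y z, ~~ (y -- z)} ->
  a \notin HX :|: HY -> a \notin s -> a -- x ->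
  {in A ++ t2 :: B ++ t3 :: C, forall z, ~~ (a -- z)} ->
  {in HX, forall z, ~~ (a -- z)} ->
  ~~ touched HY x -> touched HY a -> touched HY t2 -> touched HY t3 ->
  odd (size A) -> ~~ odd (size B) -> odd (size C) ->
  has_odd_wheel_tminor G.
Proof.
move=> s [HXY sX sY co] ic ds Xs aH as_ ax ap aX Tx Ta T2 T3 oA oB oC.
set p := A ++ t2 :: B ++ t3 :: C in s ic ds Xs as_ ap.
pose c := nth x (x :: rcons p x).
pose t := [pred z | [|| touched HY z, z == head x p | z == last x p]].
pose lab i := (scan t true c i).2.
have sp : size p = (size A + size B + size C).+2.
  by rewrite size_cat /= size_cat /= !addnS addnA.
have hp : head x p \in p by rewrite -nth0 mem_nth // sp.
have lp : last x p \in p.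
  by rewrite (last_nth x) sp /= mem_nth // sp.
have /icycP[_ xp _ _] := ic.
have tx : t x = false.
  rewrite /= (negbTE Tx) /=; apply/negP=> /orP[] /eqP e; by move: xp; rewrite e ?hp ?lp.
have c2 : c (size A).+1 = t2.
  by rewrite /c /= nth_rcons sp ifT; [rewrite nth_cat ltnn subnn | clear; lia].
have c3 : c (size A + size B).+2 = t3.
  rewrite /c /= nth_rcons sp ifT; last by clear; lia.
  rewrite nth_cat ifF; last by clear; lia.
  have -> : (size A + size B).+1 - size A = (size B).+1 by clear; lia.
  by rewrite /= nth_cat ltnn subnn.
have cl : c (size p) = last x p.
  by rewrite (last_nth x) /c sp /= nth_rcons sp ltnSn.
have cL : c (size p).+1 = x by rewrite /c /= nth_rcons ltnn eqxx.
have l1 : 0 < lab (size A).+1.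
  have := scan_odd t true c (size A).+1; rewrite /lab.
  have -> : (scan t true c (size A).+1).1 = false by rewrite /= c2 /= T2.
  by rewrite !addbF ?addbT oddS oA; case: (scan _ _ _ _).2.
have l2 : lab (size A).+1 < lab (size A + size B).+2.
  by apply: scan_odd_lt; rewrite ?c2 ?c3 /= ?T2 ?T3 //; move: oB; clear; lia.
(* The comparison stops just before [x], at a vertex that counts as touched, because [x] itself is
   contracted. *)
have l3 : lab (size A + size B).+2 < lab (size p).
  by apply: scan_odd_lt; rewrite ?cl ?c3 /= ?T3 ?eqxx ?orbT ?sp //; move: oC; clear; lia.
have l4 : lab (size p) <= lab (size p).+1 by apply: scan_mono.
have ok : odd (lab (size p).+1).
  have := scan_odd t true c (size p).+1.
  have -> : (scan t true c (size p).+1).1 = true.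
    have e : (scan t true c (size p)).1 = false.
      have tl : t (c (size p)) by rewrite cl /= eqxx !orbT.
      by rewrite sp in tl *; apply: scan_touched.
    by rewrite scan_free ?cL // e.
  rewrite /lab => h; move: h; rewrite sp; move: (scan _ _ _ _).2 => n; move: oA oB oC; clear;
    lia.
exists (lab (size p).+1); split=> //; first by exact: leq_trans (leq_ltn_trans (leq_ltn_trans
  l1 l2) l3) l4.
apply: tmodel_tminor.
apply: (@wheel_model G x s p HX HY [set a] t true) => //.
- by move=> z _ Tz; apply/or3P; constructor 1.
- by move=> z _; case/or3P=> [h|/eqP->|/eqP->]; [left|right; split; [|left]|right; split;
  [|right]].
- by rewrite /= !eqxx !orbT.
- by rewrite disjoints1.
- by rewrite (eq_disjoint1 (x := a)) // => z; rewrite inE.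
- apply/forall_inP=> z; rewrite inE => /eqP->.
  by apply/forall_inP=> y; rewrite inE => /eqP->; rewrite sedge_irr.
- by move=> z; rewrite inE => /eqP->.
- by move=> z y; rewrite inE => /eqP->; apply: ap.
- by move=> z y; rewrite inE => /eqP->; apply: aX.
- by right; exists a; rewrite ?inE.
- exact: leq_trans (leq_ltn_trans (leq_ltn_trans l1 l2) l3) l4.
Qed.

End Wheels.

(** * Colourings, connectivity and levellings *)

Section Colouring.
Variable G : sgraph.
Implicit Types (x y z v : G) (A B S : {set G}).

(** The palette ['I_k.+1] leaves a value for the vertices outside [A], even when [k] is 0. *)
Definition col k A : bool :=
  [exists c : {ffun G -> 'I_k.+1}, [forall x in A, (c x < k) &&
     [forall y in A, (x -- y) ==> (c x != c y)]]].

Lemma colP k A : reflect (exists2 c : G -> nat, {in A, forall x, c x < k} &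
  {in A &, forall x y, x -- y -> c x != c y}) (col k A).
Proof.
apply: (iffP existsP) => [[c /forall_inP h]|[c ck cA]].
  exists (fun x => val (c x)) => [x /h/andP[]//|x y /h/andP[_ /forall_inP hx] yA xy].
  by have /implyP/(_ xy) := hx _ yA; rewrite -val_eqE.
exists [ffun x => inord (c x)]; apply/forall_inP=> x xA; rewrite !ffunE.
rewrite inordK ?ck // ?ltnS ?(ltnW (ck _ xA)) //.
apply/forall_inP=> y yA; apply/implyP=> xy; rewrite !ffunE -val_eqE /=.
by rewrite !inordK ?ltnS ?(ltnW (ck _ _)) // cA.
Qed.

Lemma col_sub k A B : B \subset A -> col k A -> col k B.
Proof.
move=> /subsetP BA /colP[c c1 c2]; apply/colP; exists c.
  by move=> x /BA/c1.
by move=> x y /BA xA /BA yA; apply: c2.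
Qed.

Lemma col_le k l A : k <= l -> col k A -> col l A.
Proof.
move=> kl /colP[c c1 c2]; apply/colP; exists c => // x xA.
exact: leq_trans (c1 _ xA) kl.
Qed.

Lemma colU k l A B : col k A -> col l B -> col (k + l) (A :|: B).
Proof.
move=> /colP[c c1 c2] /colP[e e1 e2]; apply/colP.
exists (fun x => if x \in A then c x else k + e x).
  move=> x; rewrite inE; case: ifP => /= [xA _|_ xB]; first by rewrite ltn_addr ?c1.
  by rewrite ltn_add2l e1.
move=> x y; rewrite !inE; case: ifP => xA; case: ifP => yA //= xB yB xy.
- exact: c2.
- by rewrite neq_ltn ltn_addr ?c1.
- by rewrite neq_ltn [c y < _]ltn_addr ?c1 ?orbT.
- by rewrite eqn_add2l e2.
Qed.

Lemma col_stable A : stable A -> col 1 A.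
Proof.
move=> /forall_inP sA; apply/colP; exists (fun=> 0) => // x y xA yA xy.
by have /forall_inP/(_ _ yA) := sA _ xA; rewrite xy.
Qed.

Lemma colD k l A B : ~~ col (k + l) A -> col l B -> ~~ col k (A :\: B).
Proof.
move=> nA cB; apply: contra nA => cA; apply: col_sub (colU cA cB).
by apply/subsetP=> x xA; rewrite !inE xA andbT orNb.
Qed.

Lemma col_pred (T : finType) (f : G -> T) k A :
  (forall i, col k [set x in A | f x == i]) -> col (#|T| * k) A.
Proof.
move=> h; have H i := elimT (colP _ _) (h i).
have H' i : exists c : {ffun G -> 'I_k.+1}, [forall x in [set x in A | f x == i],
    (c x < k) && [forall y in [set x in A | f x == i], (x -- y) ==> (c x != c y)]].
  exact/existsP/h.
pose c i := xchoose (H' i); have cP i := xchooseP (H' i).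
apply/colP; exists (fun x => enum_rank (f x) * k + c (f x) x).
  move=> x xA; have /forall_inP/(_ x) := cP (f x).
  rewrite inE xA eqxx => /(_ isT)/andP[ck _].
  have := ltn_ord (enum_rank (f x)); rewrite -/(c _) in ck.
  move: (enum_rank _ : nat) ck => r; move: (c _ _ : nat) => m; move: #|T| => t mk rt.
  by apply: leq_trans (_ : r.+1 * k <= _); rewrite ?leq_mul2r ?rt ?orbT // mulSn addnC
    ltn_add2r.
move=> x y xA yA xy; apply/negP=> /eqP e.
have /forall_inP/(_ x) := cP (f x); rewrite inE xA eqxx => /(_ isT)/andP[ck /forall_inP/(_ y)].
have /forall_inP/(_ y) := cP (f y); rewrite inE yA eqxx => /(_ isT)/andP[ck' _].
rewrite -/(c _) in ck ck'; have fxy : f x = f y.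
  apply: enum_rank_inj; apply: val_inj => /=.
  have := congr1 (divn^~ k) e; have k0 : 0 < k by apply: leq_ltn_trans ck.
  by rewrite !divnMDl // !divn_small // !addn0.
rewrite inE yA fxy eqxx => /(_ isT); rewrite xy /= => /negP; apply.
by move: e; rewrite fxy => /addnI e; apply/eqP/val_inj.
Qed.

Lemma col_colourable k : col k setT -> colourable k G.
Proof.
case/colP=> c ck cc; exists (fun i => [set x | c x == i :> nat]).
  move=> i; apply/forall_inP=> x; rewrite inE => /eqP xi.
  apply/forall_inP=> y; rewrite inE => /eqP yi; apply/negP=> xy.
  by have := cc x y; rewrite !inE xi yi eqxx => /(_ isT isT xy).
apply/setP=> x; rewrite inE; apply/bigcupP.
by exists (Ordinal (ck x (in_setT _))); rewrite ?inE.
Qed.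

(** Connectedness by cuts. Typically the cut is around a component of what remains after a deletion,
    and the edge obtained leads to a deleted vertex. *)
Definition conn A : Prop :=
  A != set0 /\ forall S, S \proper A -> S != set0 ->
    exists x y, [/\ x \in S, y \in A :\: S & x -- y].

Lemma connW A S y : conn A -> S \subset A -> S != set0 -> y \in A -> y \notin S ->
  exists x y, [/\ x \in S, y \in A :\: S & x -- y].
Proof.
move=> [_ cA] SA S0 yA yS; apply: cA => //.
by apply/properP; split=> //; exists y.
Qed.

Lemma connect_conn A : A != set0 -> {in A &, forall x y, connect (restr A) x y} ->
  conn A.
Proof.
move=> A0 h; split=> // S /properP[/subsetP SA [y yA yS]] /set0Pn[x xS].
have [p] := connectP (h _ _ (SA _ xS) yA).
elim: p x xS => [|z p IH] x xS /=; first by move=> _ e; rewrite e xS in yS.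
case/andP=> /and3P[_ zA xz] pz ly; have [zS|zS] := boolP (z \in S).
  exact: IH pz ly.
by exists x, z; rewrite inE zS.
Qed.

Lemma conn_connect A : conn A -> {in A &, forall x y, connect (restr A) x y}.
Proof.
move=> cA x y xA yA; pose S := [set z in A | connect (restr A) x z].
apply/negPn/negP=> nc; have xS : x \in S by rewrite inE xA connect0.
have [||||a [b [aS /setDP[bA bS] ab]]] := @connW A S y cA => //.
- by apply/subsetP=> z; rewrite inE => /andP[].
- by apply/set0Pn; exists x.
- by rewrite inE yA.
case/negP: bS; rewrite inE bA; move: aS; rewrite inE => /andP[aA].
by move/connect_trans; apply; apply: connect1; rewrite /restr /= aA bA.
Qed.

Lemma restr_sym A : connect_sym (restr A).
Proof.
apply: sym_connect_sym => x y; rewrite /restr /= sedge_sym.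
by rewrite andbCA.
Qed.

Lemma restr_sub A B : A \subset B -> forall x y,
  connect (restr A) x y -> connect (restr B) x y.
Proof.
move=> /subsetP AB; apply: connect_sub => x y /and3P[/AB xB /AB yB xy].
by apply: connect1; rewrite /restr /= xB yB.
Qed.

Lemma conn1 x : conn [set x].
Proof.
apply: connect_conn; first by apply/set0Pn; exists x; rewrite inE.
by move=> y z; rewrite !inE => /eqP-> /eqP->; apply: connect0.
Qed.

Lemma connU A B x y : conn A -> conn B -> x \in A -> y \in B ->
  (x == y) || (x -- y) -> conn (A :|: B).
Proof.
move=> cA cB xA yB xy; have A0 := cA.1.
apply: connect_conn; first by apply/set0Pn; exists x; rewrite inE xA.
have xy' : connect (restr (A :|: B)) x y.
  case/orP: xy => [/eqP->|xy]; first exact: connect0.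
  by apply: connect1; rewrite /restr /= !inE xA yB orbT.
have hx z : z \in A :|: B -> connect (restr (A :|: B)) x z.
  rewrite inE => /orP[zA|zB].
    by apply: restr_sub (conn_connect cA xA zA); apply: subsetUl.
  apply: connect_trans xy' _.
  by apply: restr_sub (conn_connect cB yB zB); apply: subsetUr.
by move=> u v /hx xu /hx xv; apply: connect_trans xv; rewrite restr_sym.
Qed.

Lemma conn_add A x y : conn A -> y \in A -> x -- y -> conn (x |: A).
Proof.
by move=> cA yA xy; apply: (@connU [set x] A x y) => //; rewrite ?inE ?xy ?orbT //;
  apply: conn1.
Qed.

(** Otherwise each component could be coloured separately, the [root] of a vertex naming its
    component. *)
Lemma big_component k A : ~~ col k A -> exists X : {set G}, [/\ X \subset A, conn X,
  ~~ col k X & {in X & A, forall x y, x -- y -> y \in X}].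
Proof.
move=> nA; pose C x := [set y in A | connect (restr A) x y].
have sC x : C x \subset A by apply/subsetP=> y; rewrite inE => /andP[].
suff [x xA nx] : exists2 x, x \in A & ~~ col k (C x).
  exists (C x); split=> //.
    apply: connect_conn; first by apply/set0Pn; exists x; rewrite inE xA connect0.
    suff hx z : z \in C x -> connect (restr (C x)) x z.
      by move=> u v /hx xu /hx xv; apply: connect_trans xv; rewrite restr_sym.
    rewrite inE => /andP[zA /connectP[p]].
    elim/last_ind: p z zA => [|p w IH] z zA /=; first by move=> _ ->; apply: connect0.
    rewrite rcons_path last_rcons => /andP[pp /and3P[lA wA lw]] ->.
    have xl : connect (restr A) x (last x p) by apply/connectP; exists p.
    apply: (connect_trans (IH _ lA pp erefl)); apply: connect1;
      rewrite /restr /= !inE lA wA xl lw /= andbT.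
    by apply: (connect_trans xl); apply: connect1; rewrite /restr /= lA wA.
  move=> y z; rewrite !inE => /andP[yA xy] zA yz; rewrite zA /=.
  by apply: (connect_trans xy); apply: connect1; rewrite /restr /= yA zA.
apply/exists_inP; apply: contraR nA => /exists_inPn h.
have H x : exists c : {ffun G -> 'I_k.+1}, (x \in A) ==> [forall y in C x, (c y < k) &&
     [forall z in C x, (y -- z) ==> (c y != c z)]].
  have [xA|xA] := boolP (x \in A); last by exists [ffun=> ord0].
  by have /negPn/existsP[c hc] := h x xA; exists c.
pose c x := xchoose (H x); have cP x := xchooseP (H x).
have rA x : x \in A -> root (restr A) x \in A.
  move=> xA; have /connectP[p pp ->] := connect_root (restr A) x.
  by case/lastP: p pp => // p z; rewrite rcons_path last_rcons => /andP[_ /and3P[]].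
have rC x : x \in A -> x \in C (root (restr A) x).
  by move=> xA; rewrite inE xA restr_sym connect_root.
apply/colP; exists (fun x => val (c (root (restr A) x) x)).
  move=> x xA; have /implyP/(_ (rA _ xA))/forall_inP/(_ x (rC _ xA)) := cP (root (restr A) x).
  by case/andP.
move=> x y xA yA xy; have exy : root (restr A) x = root (restr A) y.
  by apply/eqP; rewrite root_connect; [apply: connect1;
    rewrite /restr /= xA yA | apply: restr_sym].
have /implyP/(_ (rA _ xA))/forall_inP/(_ x (rC _ xA)) := cP (root (restr A) x).
case/andP=> _ /forall_inP/(_ y); rewrite exy => /(_ (rC _ yA))/implyP/(_ xy).
by rewrite -val_eqE.
Qed.

Definition bfs A v (d : G -> nat) : Prop :=
  [/\ v \in A, d v = 0,
      {in A, forall x, x != v -> exists y, [/\ y \in A, y -- x & (d y).+1 = d x]} &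
      {in A &, forall x y, x -- y -> d x <= (d y).+1}].

Lemma bfs_exists A v : conn A -> v \in A -> exists d, bfs A v d.
Proof.
move=> cA vA; pose F B := B :|: [set x in A | [exists y in B, y -- x]].
pose B n := iter n F [set v].
have BA n : B n \subset A.
  elim: n => [|n IH]; first by rewrite sub1set.
  by rewrite /B iterS -/(B n) subUset IH; apply/subsetP=> x; rewrite inE => /andP[].
have BS n : B n \subset B n.+1 by rewrite {2}/B iterS subsetUl.
have Bm m n : m <= n -> B m \subset B n.
  move=> /subnKC <-; elim: (n - m) => [|i IH]; first by rewrite addn0.
  by rewrite addnS (subset_trans IH).
have vB n : v \in B n by have /subsetP := Bm 0 n isT; apply; rewrite inE.
(* The ball gains a vertex at each step until it is all of [A], so radius [#|A|.-1] is enough. *)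
have szB n : n < #|A| -> n < #|B n|.
  elim: n => [|n IH] nA; first by rewrite cards1.
  have lt := IH (ltnW nA).
  have [eA|neA] := eqVneq (B n) A.
    by apply: leq_trans (subset_leq_card (BS n)); rewrite eA.
  apply: leq_trans (_ : #|B n| < _) => //; apply: proper_card; apply/properP; split=> //.
  have pB : B n \proper A by rewrite properEneq neA BA.
  have B0 : B n != set0 by apply/set0Pn; exists v; apply: vB.
  have [x [y [xB /setDP[yA yB] xy]]] := cA.2 (B n) pB B0.
  by exists y => //; rewrite /B iterS !inE yA; apply/orP; right; apply/existsP; exists x;
    rewrite xB.
have full x : x \in A -> x \in B #|A|.-1.
  have A0 : 0 < #|A| by rewrite card_gt0; case: cA.
  move=> xA; suff -> : B #|A|.-1 = A by [].
  by apply/eqP; rewrite eqEcard BA -[X in X <= _](prednK A0) szB // prednK.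
have ex x : exists n, (x \in A) ==> (x \in B n).
  by exists #|A|.-1; apply/implyP; apply: full.
pose d x := ex_minn (ex x).
have dB x : x \in A -> x \in B (d x).
  by move=> xA; rewrite /d; case: ex_minnP => n /implyP/(_ xA).
have dm x n : x \in B n -> d x <= n.
  by move=> xB; rewrite /d; case: ex_minnP => m _; apply; rewrite xB implybT.
exists d; split=> //.
- by apply/eqP; rewrite -leqn0; apply: dm; rewrite inE.
- move=> x xA xv; have := dB _ xA; case E: (d x) => [|n].
    by rewrite inE (negbTE xv).
  rewrite /B iterS -/(B n) in_setU => /orP[/dm|]; first by rewrite E ltnn.
  rewrite inE => /andP[_ /existsP[y /andP[yB yx]]]; exists y.
  have yA : y \in A by apply: (subsetP (BA n)).
  split=> //; apply/eqP; rewrite eqSS eqn_leq dm //= -ltnS -E; apply: dm.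
  by rewrite /B iterS !inE xA; apply/orP; right; apply/existsP; exists y; rewrite -/(B _) dB.
move=> x y xA yA xy; apply: dm; rewrite /B iterS !inE xA.
by apply/orP; right; apply/existsP; exists y; rewrite -/(B _) dB // sedge_sym.
Qed.

Lemma bfs0 A v d x : bfs A v d -> x \in A -> d x = 0 -> x = v.
Proof.
case=> _ _ h _ xA dx; apply/eqP/negPn/negP=> /(h _ xA)[y [_ _]].
by rewrite dx.
Qed.

(* The list [s] omits the starting vertex [v]. *)
Lemma geodesic A v d x : bfs A v d -> x \in A -> exists s,
  [/\ ipath (v :: s), last v s = x, {subset v :: s <= A}, size s = d x &
      {in v :: s, forall z, z != x -> d z < d x} /\ {in v :: s &, injective d}].
Proof.
move=> bf; have [vA d0 par lip] := bf.
have [n] := ubnP (d x); elim: n x => // n IH x dn xA.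
have [->|xv] := eqVneq x v.
  exists [::]; split=> //.
  - by move=> z; rewrite inE => /eqP->.
  split=> [z|z y]; first by rewrite inE => /eqP->; rewrite eqxx.
  by rewrite !inE => /eqP-> /eqP->.
have [y [yA yx dyx]] := par _ xA xv.
have [|s [ip ls sA sz [lt inj]]] := IH y _ yA; first by rewrite -ltnS dyx.
have le z : z \in v :: s -> d z <= d y.
  by move=> zs; have [->//|/lt/ltnW] := eqVneq z y; apply.
have xs : x \notin v :: s by apply/negP=> /le; rewrite -dyx ltnn.
exists (rcons s x); split.
- rewrite -rcons_cons; apply: ipath_rcons => // z zs /=; rewrite ls.
  have [->|zy] := eqVneq z y; first by rewrite sedge_sym yx.
  apply/negP=> xz; have := lip _ _ xA (sA _ zs) xz.
  by rewrite -dyx ltnS leqNgt lt.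
- by rewrite last_rcons.
- by move=> z; rewrite -rcons_cons mem_rcons inE => /predU1P[->|/sA].
- by rewrite size_rcons sz dyx.
split.
  move=> z; rewrite -rcons_cons mem_rcons inE => /predU1P[->|/le]; first by rewrite eqxx.
  by rewrite -dyx ltnS.
have nx z : z \in v :: s -> d z != d x.
  by move=> /le h; rewrite neq_ltn -dyx ltnS h.
move=> z w; rewrite -!rcons_cons !mem_rcons !(in_cons x) =>
  /predU1P[->|zs] /predU1P[->|ws] // e.
- by have := nx _ ws; rewrite e eqxx.
- by have := nx _ zs; rewrite e eqxx.
exact: inj.
Qed.

Lemma conn_ipath A x y : conn A -> x \in A -> y \in A ->
  exists s, [/\ ipath (x :: s), last x s = y & {subset x :: s <= A}].
Proof.
move=> cA xA yA; have [d bf] := bfs_exists cA xA.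
by have [s [? ? ? _ _]] := geodesic bf yA; exists s.
Qed.

(** Distinct layers of the same parity do not see each other, so their union needs no more colours
    than one layer; two palettes serve for the two parities. *)
Lemma big_layer k A v d : bfs A v d -> ~~ col (k + k) A ->
  exists n, ~~ col k [set x in A | d x == n].
Proof.
move=> [_ _ _ lip] nA; pose b (n : 'I_(\max_x d x).+1) := col k [set x in A | d x == n].
have [n nb|h] := pickP [pred n | ~~ b n]; first by exists (val n).
case/negP: nA; rewrite addnn -mul2n -card_bool.
apply: (col_pred (f := fun x => odd (d x))) => i.
have H (n : 'I_(\max_x d x).+1) : exists c : {ffun G -> 'I_k.+1},
    [forall x in [set x in A | d x == n], (c x < k) &&
     [forall y in [set x in A | d x == n], (x -- y) ==> (c x != c y)]].
  by apply/existsP; have := h n => /= /negbFE.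
pose c n := xchoose (H n); have cP n := xchooseP (H n).
have dO x : d x < (\max_x d x).+1 by rewrite ltnS leq_bigmax.
apply/colP; exists (fun x => val (c (Ordinal (dO x)) x)).
  move=> x; rewrite inE => /andP[xA _].
  by have /forall_inP/(_ x) := cP (Ordinal (dO x)); rewrite inE xA eqxx => /(_ isT)/andP[].
move=> x y; rewrite !inE => /andP[xA /eqP ox] /andP[yA /eqP oy] xy.
have exy : d x = d y.
  have := lip _ _ xA yA xy; have := lip _ _ yA xA; rewrite sedge_sym => /(_ xy).
  move: (d x) (d y) ox oy => a b' oa ob.
  by move: oa ob; case: i; clear; lia.
have e : Ordinal (dO x) = Ordinal (dO y) by apply: val_inj.
have mx : x \in [set x in A | d x == Ordinal (dO y)] by rewrite inE xA /= exy.
have my : y \in [set x in A | d x == Ordinal (dO y)] by rewrite inE yA /=.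
have /forall_inP/(_ x mx)/andP[_ /forall_inP/(_ y my)/implyP/(_ xy)] := cP (Ordinal (dO y)).
by rewrite e -val_eqE.
Qed.

End Colouring.

(** * Odd closed walks, balls of radius four and later components *)

Section OddWalks.
Variable G : sgraph.
Implicit Types (x y z u : G) (s p q : seq G).

Lemma repeated_split s : ~~ uniq s -> exists s1 z b c, s = s1 ++ z :: b ++ z :: c.
Proof.
elim: s => //= x s IH; rewrite negb_and negbK => /orP[/splitPr[b c]|/IH].
  by exists [::], x, b, c.
by case=> s1 [z [b [c ->]]]; exists (x :: s1), z, b, c.
Qed.

(** A repeated vertex splits a closed walk into two shorter ones, one of which is odd; irreflexivity
    rules out length 1. *)
Lemma odd_closed_walk s : cycle sedge s -> odd (size s) ->
  exists2 s' : seq G, odd_cycle s' & size s' <= size s.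
Proof.
have [n] := ubnP (size s); elim: n s => // n IH s sn cs os.
have [us|/repeated_split[s1 [z [b [c es]]]]] := boolP (uniq s).
  exists s => //; rewrite /odd_cycle os /ucycleb cs us !andbT.
  case: s os cs {sn us} => [|x [|y [|z s]]] //=.
  by rewrite sedge_irr.
have {cs} : cycle sedge (z :: b ++ z :: (c ++ s1)).
  have -> : z :: b ++ z :: (c ++ s1) = rot (size s1) s.
    by rewrite es rot_size_cat /= -catA.
  by rewrite rot_cycle.
rewrite /= rcons_cat /= cat_path /= => /and3P[pb bz pc].
have ss : size s = (size b).+1 + (size (c ++ s1)).+1.
  by rewrite es !(size_cat, size_rcons) /= ?size_cat /=; clear; lia.
have c1 : cycle sedge (z :: b) by rewrite /= rcons_path pb bz.
have c2 : cycle sedge (z :: (c ++ s1)) by [].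
move: os sn; rewrite ss oddD => os sn.
have [ob|ob] := boolP (odd (size b).+1).
  have [|s' os' le] := IH _ _ c1 ob; first by move: sn => /=; clear; lia.
  by exists s' => //; apply: leq_trans le _; rewrite leq_addr.
have o2 : odd (size (c ++ s1)).+1 by move: os ob; case: (odd _.+1); case: (odd _.+1).
have [|s' os' le] := IH _ _ c2 o2; first by move: sn => /=; clear; lia.
by exists s' => //; apply: leq_trans le _; rewrite leq_addl.
Qed.

(** As [p] omits [x], this means distance at most 4. Two such walks to [u] from adjacent vertices
    make, with their edge, a closed walk of length at most 9, which cannot be odd: a ball is
    coloured by the parity of such walks. *)
Definition near x u : bool :=
  [exists n : 'I_5, exists p : n.-tuple G, path sedge x p && (last x p == u)].

Lemma nearP x u : reflect
  (exists p, [/\ path sedge x p, last x p = u & size p <= 4]) (near x u).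
Proof.
apply: (iffP existsP) => [[n /existsP[p /andP[pp /eqP lp]]]|[p [pp lp sp]]].
  by exists p; rewrite size_tuple -ltnS ltn_ord.
by exists (Ordinal (sp : size p < 5)); apply/existsP; exists (in_tuple p); rewrite pp lp eqxx.
Qed.

Lemma nearC x u : near x u = near u x.
Proof.
suff h a b : near a b -> near b a by apply/idP/idP; apply: h.
case/nearP=> p [pp lp sp]; apply/nearP; exists (rev (belast a p)).
rewrite size_rev size_belast -lp rev_path (eq_path (e' := sedge)); last first.
  by move=> c d /=; rewrite sedge_sym.
split=> //; case: p {pp lp sp} => //= y p.
by rewrite rev_cons last_rcons.
Qed.

Definition ball u := [set x | near x u].

Hypothesis hg : forall s : seq G, odd_cycle s -> 11 <= size s.

Lemma no_short_odd_walk s : cycle sedge s -> size s < 11 -> ~~ odd (size s).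
Proof.
move=> cs ss; apply/negP=> /(odd_closed_walk cs)[s' /hg le le'].
by move: (leq_trans le le'); rewrite leqNgt ss.
Qed.

Lemma triangle_free x y z : x -- y -> y -- z -> ~~ (x -- z).
Proof.
move=> xy yz; apply/negP=> xz; have := @no_short_odd_walk [:: x; y; z].
by rewrite /= xy yz sedge_sym xz => /(_ isT isT).
Qed.

Lemma stable_nbh x : stable (nbh x).
Proof.
apply/forall_inP=> y; rewrite inE => xy; apply/forall_inP=> z; rewrite inE => xz.
by apply: triangle_free xz; rewrite sedge_sym.
Qed.

Lemma walk_parity x y p q : path sedge x p -> path sedge y q ->
  last x p = last y q -> x -- y -> size p <= 4 -> size q <= 4 ->
  odd (size p) != odd (size q).
Proof.
move=> pp pq l xy sp sq; apply/negP=> /eqP e.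
have := @no_short_odd_walk (x :: p ++ rev (belast y q)).
rewrite /= rcons_cat cat_path pp l -rev_cons.
rewrite -[x :: belast y q]/(belast x (y :: q)) -[last y q]/(last x (y :: q)).
rewrite rev_path (eq_path (e' := sedge)); last by move=> a b /=; rewrite sedge_sym.
rewrite /= xy pq size_cat size_rev size_belast => /(_ isT).
by move: e sp sq; clear; lia.
Qed.

Lemma col_ball u : col 2 (ball u).
Proof.
have H x : exists n : 'I_5, (x \in ball u) ==> [exists p : n.-tuple G, path sedge x p &&
  (last x p == u)].
  have [|_] := boolP (x \in ball u); last by exists ord0.
  by rewrite inE => /existsP[n h]; exists n.
pose r x := xchoose (H x).
apply/colP; exists (fun x => odd (r x) : nat); first by move=> x _; case: (odd _).
move=> x y xu yu xy.
have /implyP/(_ xu)/existsP[p /andP[pp /eqP lp]] := xchooseP (H x).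
have /implyP/(_ yu)/existsP[q /andP[pq /eqP lq]] := xchooseP (H y).
have := @walk_parity x y p q pp pq; rewrite lp lq !size_tuple -/(r x) -/(r y).
move=> /(_ erefl xy); have := ltn_ord (r x); have := ltn_ord (r y).
rewrite !ltnS => h1 h2 /(_ h2 h1).
by case: (odd _); case: (odd _).
Qed.

Definition connb (A : {set G}) : bool :=
  (A != set0) && [forall x in A, forall y in A, connect (restr A) x y].

Lemma connP A : reflect (conn A) (connb A).
Proof.
apply: (iffP andP) => [[A0 /forall_inP h]|cA].
  by apply: connect_conn => // x y xA yA; have /forall_inP := h _ xA; apply.
split; first by case: cA.
by apply/forall_inP=> x xA; apply/forall_inP=> y yA; apply: conn_connect.
Qed.

(* Every vertex outside a set [B] of small chromatic number sees a big
   component of later vertices; an edge of the complement of [B] then has two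
   such ends, and deleting their neighbourhoods separates their roles. *)
Lemma later_component (T : finType) (cls : G -> T) (key : G -> nat) c (E : {set G}) :
  (forall n, col 1 [set x in E | key x == n]) -> ~~ col (#|T| + (c + 3)) E ->
  exists u v (X : {set G}),
    [/\ [/\ u \in E, v \in E, u -- v & cls u = cls v],
        [/\ X \subset E, conn X & ~~ col c X],
        {in X, forall x, key u < key x /\ key v < key x},
        (exists2 y, y \in X & v -- y) & {in X, forall y, ~~ (u -- y)}].
Proof.
move=> c1 nE; pose later v (X : {set G}) := [&& X \subset E, ~~ col (c + 2) X, connb X,
  [forall x in X, key v < key x] & [exists y in X, v -- y]].
pose B := [set v in E | ~~ [exists X : {set G}, later v X]].
(* Of the three extra colours, one pays for the vertices of least key and two for the neighbourhoods
   of [u] and [v] deleted at the end. *)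
have cB : col (c + 3) B.
  apply: contraT => nB; have [K [KB cK nK _]] := big_component nB.
  have [k0 k0K] : exists k0, k0 \in K by apply/set0Pn; case: cK.
  case: (arg_minnP key k0K) => k1 k1K kmin.
  pose W := [set x in E | key x == key k1].
  have KE x : x \in K -> x \in E by move/(subsetP KB); rewrite inE => /andP[].
  have nKW : ~~ col (c + 2) (K :\: W).
    by apply: colD (c1 (key k1)); rewrite -addnA.
  have [X [XK cX nX cl]] := big_component nKW.
  have XinK x : x \in X -> x \in K by move/(subsetP XK)/setDP=> [].
  have k1X : k1 \notin X.
    by apply/negP=> /(subsetP XK); rewrite !inE KE // eqxx.
  (* [X] is a component of [K :\: W], so the edge leaving it inside [K] ends in [W], at a vertex of
     least key. This vertex has [X] as a later component, although it lies in [B]. *)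
  have [|x [w [xX /setDP[wK wX] xw]]] := connW cK _ (proj1 cX) k1K k1X.
    by apply/subsetP.
  have wW : w \in W.
    apply: contraNT wX => wW; apply: cl xX _ xw.
    by rewrite inE wW.
  have : w \in B by apply: (subsetP KB).
  rewrite inE => /andP[_ /existsPn/(_ X)/negP[]].
  have kw : key w = key k1 by move: wW; rewrite inE => /andP[_ /eqP].
  apply/and5P; split=> //.
  - by apply/subsetP=> z /XinK/KE.
  - exact/connP.
  - apply/forall_inP=> z zX; rewrite kw ltn_neqAle; apply/andP; split; last exact/kmin/XinK.
    have /setDP[zK] := subsetP XK _ zX; rewrite inE KE //= eq_sym.
    by [].
  - by apply/existsP; exists x; rewrite xX sedge_sym.
have nA : ~~ col (#|T| * 1) (E :\: B) by rewrite muln1; apply: colD cB.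
have [u [v [uA vA uv cuv kuv]]] : exists u v, [/\ u \in E :\: B, v \in E :\: B,
    u -- v, cls u = cls v & key u <= key v].
  have [i ni] : exists i, ~~ col 1 [set x in E :\: B | cls x == i].
    by apply/existsP; apply: contraR nA => /existsPn h; apply: (col_pred (f := cls)) => i;
      rewrite -[col _ _]negbK.
  have : ~~ stable [set x in E :\: B | cls x == i] by apply: contra ni; apply: col_stable.
  case/forall_inPn=> u; rewrite inE => /andP[uA /eqP ui] /forall_inPn[v].
  rewrite inE => /andP[vA /eqP vi]; rewrite negbK => uv.
  have [le|/ltnW le] := leqP (key u) (key v).
    by exists u, v; rewrite ui vi.
  by exists v, u; rewrite ui vi sedge_sym.
have [uE vE] : u \in E /\ v \in E by move: uA vA => /setDP[? _] /setDP[? _].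
have : [exists X : {set G}, later v X].
  by move: vA; rewrite !inE vE /= andbT negbK.
case/existsP=> X /and5P[XE nX /connP cX /forall_inP kX /existsP[y /andP[yX vy]]].
(* The component [Z] left by the deletion sees neither [u] nor [v]. A vertex [n] of [X] next to [Z]
   is adjacent to one of them, and not to both for want of triangles; this decides their roles for
   [n |: Z]. *)
have nX' : ~~ col c (X :\: (nbh u :|: nbh v)).
  by apply: (colD nX); apply: colU (col_stable (stable_nbh u)) (col_stable (stable_nbh v)).
have [Z [ZX cZ nZ clZ]] := big_component nX'.
have ZinX z : z \in Z -> z \in X by move/(subsetP ZX)/setDP=> [].
have Zn z : z \in Z -> ~~ (u -- z) /\ ~~ (v -- z).
  by move/(subsetP ZX)/setDP=> [_]; rewrite !inE negb_or => /andP[].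
have yZ : y \notin Z by apply: contraL vy => /Zn[].
have [|x [n [xZ /setDP[nX0 nZ0] xn]]] := connW cX _ (proj1 cZ) yX yZ.
  exact/subsetP.
have nuv : (u -- n) || (v -- n).
  apply: contraNT nZ0 => h; apply: clZ xZ _ xn.
  by rewrite !inE (negbTE h).
have cnZ : conn (n |: Z) by apply: (conn_add cZ xZ); rewrite sedge_sym.
have sub : n |: Z \subset E.
  by rewrite subUset sub1set (subsetP XE _ nX0); apply/subsetP=> z /ZinX/(subsetP XE).
have nnZ : ~~ col c (n |: Z) by apply: contra nZ; apply: col_sub; apply: subsetUr.
have keys z : z \in n |: Z -> key u < key z /\ key v < key z.
  move=> zZ; have /kX kz : z \in X.
    by move: zZ; rewrite !inE => /predU1P[->|/ZinX].
  by split=> //; apply: leq_ltn_trans kuv kz.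
have [un|nun] := boolP (u -- n).
  exists v, u, (n |: Z); split=> //.
  - by split=> //; rewrite sedge_sym.
  - by move=> z /keys[].
  - by exists n; rewrite ?setU11.
  - move=> z; rewrite !inE => /predU1P[->|/Zn[]//].
    by apply: triangle_free un; rewrite sedge_sym.
exists u, v, (n |: Z); split=> //.
- by exists n; rewrite ?setU11 //; move: nuv; rewrite (negbTE nun).
- by move=> z; rewrite !inE => /predU1P[->|/Zn[]].
Qed.

End OddWalks.

(** * Ropes *)

Section MinArg.
Variables (T : finType) (x0 : T) (w : T -> nat) (p : pred T).
Definition minarg : T := odflt x0 [pick y | p y && [forall z, p z ==> (w y <= w z)]].

Lemma minargP x : p x -> p minarg /\ (forall z, p z -> w minarg <= w z).
Proof.
move=> px; rewrite /minarg; case: pickP => [y /andP[py /forallP h]|h] /=.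
  by split=> // z pz; have /implyP := h z; apply.
case: (arg_minnP w px) => y py hy; have := h y; rewrite /= py /= => /negP[].
by apply/forallP=> z; apply/implyP/hy.
Qed.
End MinArg.

(** Pairs ordered lexicographically are encoded as numbers, because [later_component] takes its keys
    in [nat]. *)
Lemma lex_le (N a b i j : nat) : i < N -> j < N -> a * N + i <= b * N + j ->
  a <= b /\ (a = b -> i <= j).
Proof.
move=> iN jN h; split; last by move=> e; move: h; rewrite e leq_add2l.
rewrite leqNgt; apply/negP=> ba.
have : b.+1 * N <= a * N by rewrite leq_mul2r ba orbT.
by rewrite mulSn; move: (a * N) (b * N) h => x y; move: iN jN; clear; lia.
Qed.

Lemma lex_lt (N a b i j : nat) : i < N -> j < N -> a * N + i < b * N + j ->
  a <= b /\ (a = b -> i < j).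
Proof.
move=> iN jN h; have [ab _] := lex_le iN jN (ltnW h).
by split=> // e; move: h; rewrite e ltn_add2l.
Qed.

(** * Routes inside a level or through its parents *)

Section Route.
Variable G : sgraph.
Hypothesis hg : forall s : seq G, odd_cycle s -> 11 <= size s.
Variables (F P A : {set G}) (v : G) (d : G -> nat).
Hypothesis FP : [disjoint F & P].
Hypothesis AF : A \subset F.
Hypothesis bf : bfs A v d.

Let N := #|G|.
Let rk (x : G) : nat := enum_rank x.
Let rkN x : rk x < N. Proof. exact: ltn_ord. Qed.

Definition foot q := minarg v d [pred t | (t \in A) && (q -- t)].
Definition depth q := d (foot q).

Lemma footP q t : t \in A -> q -- t ->
  [/\ foot q \in A, q -- foot q & depth q <= d t].
Proof.
move=> tA qt; have [] := @minargP G v d [pred t | (t \in A) && (q -- t)] t.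
  by rewrite /= tA.
by case/andP=> fA qf /(_ t); rewrite /= tA qt => /(_ isT).
Qed.

Definition over x := minarg v (fun q => depth q * N + rk q) [pred q | (q \in P) && (q -- x)].

Lemma overP x q : q \in P -> q -- x ->
  [/\ over x \in P, over x -- x, depth (over x) <= depth q &
      depth (over x) = depth q -> rk (over x) <= rk q].
Proof.
move=> qP qx.
have [] := @minargP G v (fun q => depth q * N + rk q) [pred q | (q \in P) && (q -- x)] q.
  by rewrite /= qP.
case/andP=> oP ox /(_ q); rewrite /= qP qx => /(_ isT) h.
by have [] := lex_le (rkN _) (rkN _) h.
Qed.

Definition prev x := minarg v rk [pred m | [&& m \in A, m -- x & (d m).+1 == d x]].

Lemma prevP x : x \in A -> x != v ->
  [/\ prev x \in A, prev x -- x, (d (prev x)).+1 = d x &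
      forall m, m \in A -> m -- x -> (d m).+1 = d x -> rk (prev x) <= rk m].
Proof.
move=> xA xv; have [_ _ /(_ _ xA xv)[y [yA yx dy]] _] := bf.
have [] := @minargP G v rk [pred m | [&& m \in A, m -- x & (d m).+1 == d x]] y.
  by rewrite /= yA yx dy eqxx.
case/and3P=> pA px /eqP dp h; split=> // m mA mx dm.
by apply: h; rewrite /= mA mx dm eqxx.
Qed.

(* [lo x]: the route from [v] to [x] through a vertex of [P] is at least as
   short as the one inside [A]. *)
Definition lo x := [exists q in P, (q -- x) && (depth q + 2 <= d x)].
Definition par x := if lo x then over x else prev x.
Definition dl x := if lo x then depth (over x) + 2 else d x.
(* Lexicographic order on the length of the route, its kind, and the vertex
   before [x]. *)
Definition key x := (2 * dl x + ~~ lo x) * N + rk (par x).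

Lemma loP x : lo x -> [/\ over x \in P, over x -- x & depth (over x) + 2 <= d x].
Proof.
case/exists_inP=> q qP /andP[qx dq]; have [oP ox le _] := overP qP qx.
by split=> //; apply: leq_trans dq; rewrite leq_add2r.
Qed.

Lemma hiP x q : ~~ lo x -> q \in P -> q -- x -> d x <= (depth q).+1.
Proof.
move=> h qP qx; rewrite leqNgt; apply: contra h => h; apply/exists_inP; exists q => //.
by rewrite qx addn2.
Qed.

Lemma par_adj x : x \in A -> x != v -> par x -- x.
Proof.
move=> xA xv; rewrite /par; case: ifP => [/loP[]//|_].
by have [] := prevP xA xv.
Qed.

(** Equal keys give equal [par], and two vertices with a common neighbour are not adjacent for want
    of triangles. *)
Lemma key_stable n : col 1 [set x in A :\ v | key x == n].
Proof.
apply/col_stable/forall_inP=> x; rewrite !inE => /andP[/andP[xv xA] /eqP ex].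
apply/forall_inP=> y; rewrite !inE => /andP[/andP[yv yA] /eqP ey].
have e : par x = par y.
  apply/enum_rank_inj/val_inj/eqP; rewrite eqn_leq.
  have := leqnn n; rewrite -{1}ex -ey => h1; have := leqnn n; rewrite -{1}ey -ex => h2.
  have [a1 b1] := lex_le (rkN _) (rkN _) h1; have [a2 b2] := lex_le (rkN _) (rkN _) h2.
  by rewrite b1 ?b2 //; apply/eqP; rewrite eqn_leq a1 a2.
apply: triangle_free hg _ _ _ _ (par_adj yA yv).
by rewrite sedge_sym -e par_adj.
Qed.

Lemma dl_le x : dl x <= d x.
Proof. by rewrite /dl; case: ifP => // /loP[]. Qed.

Lemma key_lt e x : key e < key x ->
  [/\ dl e <= dl x, lo e = false -> lo x -> dl e < dl x &
      dl e = dl x -> lo e = lo x -> rk (par e) < rk (par x)].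
Proof.
move=> h; have [a b] := lex_lt (rkN _) (rkN _) h.
split; last by move=> e1 e2; apply: b; rewrite e1 e2.
  by move: a; case: (lo e); case: (lo x) => /=; clear; lia.
by move=> le lx; move: a; rewrite le lx /=; clear; lia.
Qed.

(* Vertices with a larger key come later in the construction: the route to [e]
   must not see them, nor their parents in [P]. *)
Lemma route e : e \in A -> e != v -> exists R,
  [/\ ipath (v :: rcons R e), (size R).+1 = dl e,
      {in v :: R, forall z, z \in A \/ [/\ lo e, z = over e & z \in P]} &
      [/\ forall e', e' \in A -> d e' = d e -> e -- e' ->
          {in v :: R, forall z, z != e' /\ ~~ (z -- e')},
        forall x, x \in A -> key e < key x ->
          {in v :: R, forall z, z != x /\ ~~ (z -- x)} &
        forall x q, x \in A -> key e < key x -> ~~ near x e -> q \in P ->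
          q -- x -> {in v :: R, forall z, [/\ q != z, ~~ (q -- z) &
             z \in P -> forall w, ~~ ((q -- w) && (w -- z))]}]].
Proof.
move=> eA ev; have [vA dv _ lip] := bf.
have nAP z : z \in A -> z \notin P.
  by move=> zA; apply/negP=> zP; have := disjointFr FP (subsetP AF _ zA); rewrite zP.
have far x l : ~~ near x e -> path sedge x l -> last x l = e -> size l <= 4 -> False.
  by move=> /negP h p1 p2 p3; apply: h; apply/nearP; exists l.
have [le|he] := boolP (lo e).
  have [oP oe od] := loP le; set o := over e in oP oe od.
  have [fA of_ _] := footP eA oe.
  have [s [ip ls sA sz [lt inj]]] := geodesic bf fA.
  have dle : dl e = depth o + 2 by rewrite /dl le.
  have fs : foot o \in v :: s by rewrite -ls mem_last.
  have dz z : z \in v :: s -> d z <= depth o.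
    by move=> zs; have [->//|/(lt _ zs)/ltnW] := eqVneq z (foot o).
  have oz z : z \in v :: s -> o -- z -> z = foot o.
    move=> zs oz; apply: inj => //; apply/eqP; rewrite eqn_leq dz //.
    by have [] := footP (sA _ zs) oz.
  have nos z : z \in v :: s -> z != o.
    by move=> zs; apply: contraNneq (nAP _ (sA _ zs)) => ->.
  have cases z : z \in v :: rcons s o -> z \in v :: s \/ z = o.
    by rewrite -rcons_cons mem_rcons inE => /predU1P[]; [right|left].
  have shallow x z : x \in A -> z \in v :: s -> depth o + 2 <= d x -> z != x /\ ~~ (z -- x).
    move=> xA zs dx; split.
      by apply: contraTneq dx => <-; rewrite -ltnNge; have := dz _ zs; clear; lia.
    apply/negP=> zx; have := lip _ _ xA (sA _ zs); rewrite sedge_sym => /(_ zx).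
    by have := dz _ zs; move: dx; clear; lia.
  exists (rcons s o); split.
  - rewrite -rcons_cons -rcons_cons; apply: ipath_rcons.
    + apply: ipath_rcons => //; first by apply/negP=> /nos; rewrite eqxx.
      by move=> z zs /=; rewrite ls; apply/idP/eqP => [/(oz _ zs)|->].
    + rewrite rcons_cons; apply/negP=> /cases[es|ee].
        by have [] := shallow e e eA es od; rewrite eqxx.
      by have := nAP _ eA; rewrite ee oP.
    move=> z /=; rewrite last_rcons => /cases[zs|->].
      have [_ zx] := shallow e z eA zs od.
      by rewrite sedge_sym (negbTE zx) (negbTE (nos _ zs)).
    by rewrite sedge_sym oe eqxx.
  - by rewrite size_rcons sz -/(depth o) dle addn2.
  - by move=> z /cases[/sA|->]; [left|right].
  split.
  - move=> e' e'A de' ee' z /cases[zs|->]; first by apply: shallow => //; rewrite de'.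
    split; first by apply: contraNneq (nAP _ e'A) => <-.
    exact: triangle_free hg _ _ _ oe ee'.
  - move=> x xA /key_lt[k1 k2 k3] z /cases[zs|->].
      by apply: shallow => //; rewrite -dle (leq_trans k1) ?dl_le.
    split; first by apply: contraNneq (nAP _ xA) => <-.
    (* [o] is now a parent of [x] too. So the key of [x] cannot be larger: not by the length of the
       route, and at equal length not by rank either, since [over x] is a parent of least rank among
       those of least depth. *)
    apply/negP=> ox; have [lx|hx] := boolP (lo x); last first.
      have := hiP hx oP ox; move: k1; rewrite dle /dl (negbTE hx).
      by clear; lia.
    have [_ _ le1 le2] := overP oP ox.
    have dlx : dl x = depth (over x) + 2 by rewrite /dl lx.
    have ed : depth (over x) = depth o by move: k1 le1; rewrite dle dlx; clear; lia.
    have := le2 ed; rewrite leqNgt => /negP; apply.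
    have := k3; rewrite dle dlx ed le lx => /(_ erefl erefl).
    by rewrite /par le lx.
  move=> x q xA /key_lt[k1 k2 k3] nr qP qx z /cases[zs|->].
    split; first by apply: contraTneq qP => ->; apply: nAP (sA _ zs).
      (* Through [q], the vertex [x] would have a route that is too short for its key, unless [z] is
         [foot o]; then [x], [q], [foot o], [o], [e] is a walk of length 4. *)
      apply/negP=> qz; have [_ _ dq] := footP (sA _ zs) qz.
      have [lx|hx] := boolP (lo x); last first.
        have := hiP hx qP qx; have := dz _ zs; move: dq k1; rewrite dle /dl (negbTE hx).
        by clear; lia.
      have [_ _ le1 _] := overP qP qx.
      have dlx : dl x = depth (over x) + 2 by rewrite /dl lx.
      have zf : z = foot o.
        apply: inj => //; rewrite -/(depth o); have := dz _ zs; move: dq k1 le1;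
          rewrite dle dlx.
        by clear; lia.
      rewrite zf in qz.
      by apply: (far x [:: q; foot o; o; e]); rewrite //= [x -- q]sedge_sym qx qz oe
        sedge_sym of_.
    by move=> zP; have := nAP _ (sA _ zs); rewrite zP.
  split.
  - apply/eqP=> eq; rewrite eq in qx.
    by apply: (far x [:: o; e]); rewrite //= sedge_sym qx oe.
  - apply/negP=> qo; apply: (far x [:: q; o; e]); rewrite //= sedge_sym qx qo oe //.
  move=> _ w; apply/andP=> [[qw wo]].
  by apply: (far x [:: q; w; o; e]); rewrite //= sedge_sym qx qw wo oe.
have [pA pe dp pm] := prevP eA ev; set m := prev e in pA pe dp pm.
have [s [ip ls sA sz [lt inj]]] := geodesic bf pA.
have dle : dl e = d e by rewrite /dl (negbTE he).
have dz z : z \in v :: s -> d z < d e.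
  by move=> zs; rewrite -dp ltnS; have [->//|/(lt _ zs)/ltnW] := eqVneq z m.
have ms : m \in v :: s by rewrite -ls mem_last.
have zm z : z \in v :: s -> d e <= (d z).+1 -> z = m.
  move=> zs h; apply: inj => //; have := dz _ zs; move: h dp; clear; lia.
exists s; split.
- rewrite -rcons_cons; apply: ipath_rcons => //; first by apply/negP=> /dz; rewrite ltnn.
  move=> z zs /=; rewrite ls; apply/idP/eqP => [ez|->]; last by rewrite sedge_sym.
  by apply: zm => //; apply: lip (sA _ zs) ez.
- by rewrite sz dp.
- by move=> z /sA; left.
have dx x : key e < key x -> d e <= d x.
  by case/key_lt=> k1 _ _; rewrite -dle (leq_trans k1) ?dl_le.
split.
- move=> e' e'A de' ee' z zs; split.
    by apply: contraTneq (dz _ zs) => ->; rewrite de' ltnn.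
  apply/negP=> ze'; have := lip _ _ e'A (sA _ zs); rewrite sedge_sym ze' de' => /(_ isT) h.
  by have := triangle_free hg pe ee'; rewrite -(zm z zs h) ze'.
- move=> x xA kx z zs; have dex := dx _ kx; split.
    by apply: contraTneq (dz _ zs) => ->; rewrite -leqNgt.
  (* By the distances, [z] is [prev e] and [x] is as far from [v] as [e] is. Then [prev x] has at
     most the rank of [prev e], against the order of the keys. *)
  apply/negP=> zx; have := lip _ _ xA (sA _ zs); rewrite sedge_sym zx => /(_ isT) h.
  have zem := zm z zs (leq_trans dex h); rewrite zem in zs zx h.
  have edx : d x = d e by move: h dp dex; clear; lia.
  have [k1 k2 k3] := key_lt kx.
  have hx : lo x = false.
    case lx: (lo x) => //; have := k2 (negbTE he) lx; have := dl_le x; rewrite dle.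
    by move: edx; clear; lia.
  have xv : x != v by apply/eqP=> xv; move: edx dp; rewrite xv dv; clear; lia.
  have [_ _ _ pmx] := prevP xA xv.
  have := pmx _ pA zx; rewrite dp edx => /(_ erefl); rewrite leqNgt => /negP; apply.
  have := k3; rewrite dle {1}/dl hx edx (negbTE he) => /(_ erefl erefl).
  by rewrite /par hx (negbTE he).
move=> x q xA kx nr qP qx z zs; split.
- by apply: contraTneq qP => ->; apply: nAP (sA _ zs).
- apply/negP=> qz; have [_ _ dq] := footP (sA _ zs) qz.
  have zem : z = m.
    apply: zm => //; have [k1 k2 _] := key_lt kx.
    have [lx|hx] := boolP (lo x); last first.
      by have := hiP hx qP qx; have := dx _ kx; move: dq; clear; lia.
    have [_ _ le1 _] := overP qP qx.
    have := k2 (negbTE he) lx; rewrite dle /dl lx.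
    by move: dq le1; clear; lia.
  rewrite zem in qz.
  by apply: (far x [:: q; m; e]); rewrite //= sedge_sym qx qz pe.
by move=> zP; have := nAP _ (sA _ zs); rewrite zP.
Qed.

End Route.

Section Rope.
Variable G : sgraph.
Hypothesis hg : forall s : seq G, odd_cycle s -> 11 <= size s.
Variables (F P : {set G}).
Hypothesis FP : [disjoint F & P].
Implicit Types (x y z u v : G) (X O : {set G}) (L : seq (seq G * seq G)).

(* [X] is the part of [F] where the rope can still grow, [v] is the end of the
   rope, [u] the last but one vertex of one of its last two branches, and [O]
   the set of the other vertices used so far.  The last clause keeps the rope
   away from the vertices of [P] that may serve later. *)
Definition rope_state X u v O : Prop :=
  [/\ [/\ X \subset F, v \in F & conn X],
      v \notin X /\ (exists2 y, y \in X & v -- y),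
      {in O, forall o, o \notin X /\ {in X, forall x, ~~ (o -- x)}} &
      {in X, forall x, ~~ near x u -> ~~ near x v -> {in P, forall q, q -- x ->
        {in v |: O, forall o, [/\ q != o, ~~ (q -- o) &
          o \in P -> forall w, ~~ ((q -- w) && (w -- o))]}}}].

Lemma near_path x p : path sedge x p -> size p <= 4 -> near x (last x p).
Proof. by move=> pp sp; apply/nearP; exists p. Qed.

(** Both branches end at [v']: one is the route to [v'], the other the route to [u'] prolonged by
    the edge from [u'] to [v']. The 11 colours are 4 for the balls around [u] and [v], 4 for the
    classes, and 3 for [later_component]. *)
Lemma link_step c X u v O : rope_state X u v O -> ~~ col (c + 11) X ->
  exists u' v' X' O' (s1 s2 : seq G),
  [/\ rope_state X' u' v' O',
      [/\ ~~ col c X', X' \subset X, O \subset O' & v \in O'],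
      v' \in X /\ {in v' |: X', forall x, ~~ near x u /\ ~~ near x v},
      [/\ ipath (v :: s1), ipath (v :: s2), last v s1 = v', last v s2 = v' &
          odd (size s1) != odd (size s2)] &
      {in s1 ++ s2, forall z, [/\ z \in v' |: O', z \in F :|: P &
        {in O, forall o, [/\ o != z, ~~ (o -- z) &
          z \in P -> o \in P -> forall w, ~~ ((z -- w) && (w -- o))]}]}].
Proof.
case=> [[XF vF cX] [vX [y yX vy]] OX PO] nX.
pose A := v |: X; have vA : v \in A by rewrite setU11.
have cA : conn A by apply: conn_add vy.
have [d bf] := bfs_exists cA vA; have [_ dv _ lip] := bf.
have AF : A \subset F by rewrite subUset sub1set vF.
pose E := X :\: (ball u :|: ball v).
have EX x : x \in E -> [/\ x \in X, ~~ near x u & ~~ near x v].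
  by rewrite !inE negb_or => /andP[/andP[? ?] ?].
have EA x : x \in E -> x \in A /\ x != v.
  by case/EX=> xX _ _; split; [rewrite inE xX orbT | apply: contraNneq vX => <-].
have nAP z : z \in A -> z \notin P.
  by move=> zA; apply/negP=> zP; have := disjointFr FP (subsetP AF _ zA); rewrite zP.
pose ky := key P A v d; pose dll := dl P A v d.
(* Adjacent vertices with [d] of equal parity are at equal distance, so the route to [u'] does not
   see [v']. With [dll] of equal parity, the extra edge makes the two branches differ in parity. *)
pose cls x : bool * bool := (odd (dll x), odd (d x)).
have nE : ~~ col (#|{: bool * bool}| + (c + 3)) E.
  rewrite card_prod card_bool; apply: (@colD _ _ (2 + 2)).
    by rewrite -addnA addnCA -!addnA.
  by apply: colU; apply: col_ball.
have sE n : col 1 [set x in E | ky x == n].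
  apply: col_sub (key_stable hg P bf n); apply/subsetP=> x.
  by rewrite inE => /andP[/EA[xA xv] h]; rewrite inE h andbT !inE xv -in_setU1.
have [u' [v' [X' [[uE vE uv cuv] [X'E cX' nX'] kX' vX' uX']]]] := @later_component _ hg _ cls
  ky c E sE nE.
have [uX nuu nuv] := EX _ uE; have [vX'' nvu nvv] := EX _ vE.
have [uA u'v] := EA _ uE; have [v'A v'v] := EA _ vE.
have [R1 [ip1 sz1 cR1 [sd1 la1 fa1]]] := route hg FP AF bf v'A v'v.
have [R2 [ip2 sz2 cR2 [sd2 la2 fa2]]] := route hg FP AF bf uA u'v.
have duv : d u' = d v'.
  have := lip _ _ uA v'A uv; have := lip _ _ v'A uA; rewrite sedge_sym => /(_ uv).
  by case: cuv => _; clear; lia.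
have X'X x : x \in X' -> [/\ x \in X, ~~ near x u & ~~ near x v].
  by move/(subsetP X'E)/EX.
have X'A x : x \in X' -> x \in A by case/X'X=> xX _ _; rewrite inE xX orbT.
pose s1 := rcons R1 v'; pose s2 := rcons (rcons R2 u') v'.
pose O' := v |: (O :|: ([set z in s1 ++ s2] :\ v')).
have mem_s z : z \in s1 ++ s2 -> [\/ z \in R1, z \in R2, z = u' | z = v'].
  rewrite mem_cat !mem_rcons !inE mem_rcons inE => /orP[/predU1P[->|h]|/or3P[/eqP->|/eqP->|h]].
  - by constructor 4. - by constructor 1. - by constructor 4. - by constructor 3.
  by constructor 2.
have O'E o : o \in O' -> [\/ o \in v |: O, o \in R1, o \in R2 | o = u'].
  rewrite /O' in_setU1 in_setU.
  rewrite in_setD1 in_set => /or3P[/eqP->|h|/andP[ne /mem_s[h|h|h|h]]].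
  - by constructor 1; rewrite setU11.
  - by constructor 1; rewrite in_setU1 h orbT.
  - by constructor 2. - by constructor 3. - by constructor 4.
  by rewrite h eqxx in ne.
have vR1 : v \notin R1.
  by have /= /and3P[] := ip1; rewrite mem_rcons inE negb_or => /andP[].
have vR2 : v \notin R2.
  by have /= /and3P[] := ip2; rewrite mem_rcons inE negb_or => /andP[].
have two x a b : ~~ near x b -> a -- x -> ~~ (a -- b).
  move=> nr ax; apply: contra nr => ab; apply: (@near_path x [:: a; b]) => //=.
  by rewrite sedge_sym ax ab.
exists u', v', X', O', s1, s2; split.
- split.
  + split=> //; last exact: (subsetP XF).
    by apply: subset_trans XF; apply/subsetP=> x /X'X[].
  + by split=> //; apply/negP=> /kX'[_]; rewrite ltnn.
  + move=> o oO'; split.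
      case: (O'E _ oO') => [|h|h|->].
      * rewrite in_setU1 => /predU1P[->|oO]; first by apply: contra vX => /X'X[].
        by have [oX _] := OX _ oO; apply: contra oX => /X'X[].
      * apply/negP=> oX'; have [_ k] := kX' _ oX'.
        by have [] := la1 _ (X'A _ oX') k o (mem_behead (s := v :: R1) h); rewrite eqxx.
      * apply/negP=> oX'; have [k _] := kX' _ oX'.
        by have [] := la2 _ (X'A _ oX') k o (mem_behead (s := v :: R2) h); rewrite eqxx.
      by apply/negP=> /kX'[]; rewrite ltnn.
    move=> x xX'; have [xX nxu nxv] := X'X _ xX'; have [k1 k2] := kX' _ xX'.
    case: (O'E _ oO') => [|h|h|->].
    * rewrite in_setU1 => /predU1P[->|oO]; last by have [_ ->] := OX _ oO.
      apply: contra nxv => vx; apply: (@near_path x [:: v]) => //=.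
      by rewrite sedge_sym vx.
    * by have [] := la1 _ (X'A _ xX') k2 o (mem_behead (s := v :: R1) h).
    * by have [] := la2 _ (X'A _ xX') k1 o (mem_behead (s := v :: R2) h).
    exact: uX'.
  move=> x xX' nxu' nxv' q qP qx o.
  have [xX nxu nxv] := X'X _ xX'; have [k1 k2] := kX' _ xX'.
  rewrite in_setU1 => /predU1P[->|oO'].
    split; first by apply: contraTneq qP => ->; apply: nAP.
      exact: two qx.
    by move=> vP; have := nAP _ v'A; rewrite vP.
  case: (O'E _ oO') => [h|h|h|->].
  + exact: PO qx _ h.
  + exact: (fa1 _ _ (X'A _ xX') k2 nxv' qP qx o (mem_behead (s := v :: R1) h)).
  + exact: (fa2 _ _ (X'A _ xX') k1 nxu' qP qx o (mem_behead (s := v :: R2) h)).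
  split; first by apply: contraTneq qP => ->; apply: nAP.
    exact: two qx.
  by move=> uP; have := nAP _ uA; rewrite uP.
- split=> //; first by apply/subsetP=> x /X'X[].
    by apply/subsetP=> o oO; rewrite !inE oO orbT.
  by rewrite setU11.
- split=> // x; rewrite in_setU1 => /predU1P[->//|/X'X[]//].
- split=> //; rewrite ?last_rcons //.
    rewrite -rcons_cons; apply: ipath_rcons => //.
      rewrite -rcons_cons mem_rcons inE negb_or; apply/andP; split.
        by apply: contraTneq uv => ->; rewrite sedge_irr.
      by apply/negP=> /(sd2 _ v'A (esym duv) uv)[]; rewrite eqxx.
    move=> z; rewrite /= last_rcons -rcons_cons mem_rcons inE => /predU1P[->|zR].
      by rewrite eqxx sedge_sym.
    have [_ zv'] := sd2 _ v'A (esym duv) uv z zR.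
    rewrite sedge_sym (negbTE zv'); apply/esym/negP=> /eqP ez.
    have := ipath_uniq ip2; rewrite -rcons_cons rcons_uniq => /andP[].
    by rewrite -ez zR.
  rewrite !size_rcons sz1 sz2 /=; case: cuv; rewrite /dll => -> _.
  by case: (odd _).
move=> z zs; split.
- rewrite !in_setU1 in_setU in_setD1 in_set zs.
  by case: (z == v'); rewrite ?orbT.
- have AFP w : w \in A -> w \in F :|: P by move=> wA; rewrite inE (subsetP AF).
  case: (mem_s _ zs) => [h|h|->|->]; [| |exact: AFP|exact: AFP].
    have [|[_ _ zP]] := cR1 z (mem_behead (s := v :: R1) h); first exact: AFP.
    by rewrite inE zP orbT.
  have [|[_ _ zP]] := cR2 z (mem_behead (s := v :: R2) h); first exact: AFP.
  by rewrite inE zP orbT.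
have inX z' o : z' \in X -> o \in O -> [/\ o != z', ~~ (o -- z') &
    z' \in P -> o \in P -> forall w, ~~ ((z' -- w) && (w -- o))].
  move=> zX oO; have [oX oX'] := OX _ oO; split; last first.
  - by move=> zP; have := disjointFr FP (subsetP XF _ zX); rewrite zP.
  - exact: oX'.
  by apply: contraNneq oX => ->.
(* An inner vertex of a route is in [X], which no vertex of [O] sees, or is a parent of [e]; in the
   latter case the clause of the state about parents applies, since [e] is far from [u] and [v]. *)
have inR e (R : seq G) : e \in E -> z \in R -> v \notin R ->
    (z \in A \/ [/\ lo P A v d e, z = over P A v d e & z \in P]) ->
    {in O, forall o, [/\ o != z, ~~ (o -- z) &
      z \in P -> o \in P -> forall w, ~~ ((z -- w) && (w -- o))]}.
  move=> eE zR vR [zA|[lz ez zP]] o oO.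
    apply: inX => //; move: zA; rewrite in_setU1 => /predU1P[zv|//].
    by rewrite -zv zR in vR.
  have [oP oe _] := loP lz; have [eX nu nv] := EX _ eE.
  have oO1 : o \in v |: O by rewrite in_setU1 oO orbT.
  have [h1 h2 h3] := PO _ eX nu nv _ oP oe _ oO1.
  by rewrite ez eq_sym sedge_sym; split=> // _; apply: h3.
case: (mem_s _ zs) => [h|h|->|->] o oO.
- exact: (inR v' R1 vE h vR1 (cR1 z (mem_behead (s := v :: R1) h)) o oO).
- exact: (inR u' R2 uE h vR2 (cR2 z (mem_behead (s := v :: R2) h)) o oO).
- exact: inX.
exact: inX.
Qed.

End Rope.

(** * Links and the parities of their options *)

Section Links.
Variable G : sgraph.
Implicit Types (x y z : G) (s : seq G).

(* [(s1, s2, w)] stands for a choice between two paths, with the same end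
   [w]. *)
Definition link : Type := seq G * seq G * G.
Implicit Types (l : link) (L : seq link).

Definition flex l := odd (size l.1.1) != odd (size l.1.2).
Definition verts L : seq G := flatten [seq l.2 :: l.1.1 ++ l.1.2 | l : link <- L].
Definition ends L : seq G := [seq l.2 | l : link <- L].

Fixpoint opt L s : Prop :=
  if L is l :: L' then exists s1 s2,
    [/\ s1 = l.1.1 \/ s1 = l.1.2, opt L' s2 & s = rcons s1 l.2 ++ s2]
  else s = [::].

Lemma verts_cons l L z :
  z \in verts (l :: L) = [|| z == l.2, z \in l.1.1, z \in l.1.2 | z \in verts L].
Proof. by rewrite /verts /= inE !mem_cat -!orbA. Qed.

Lemma verts_cat L1 L2 : verts (L1 ++ L2) = verts L1 ++ verts L2.
Proof. by rewrite /verts map_cat flatten_cat. Qed.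

Lemma opt_cat L1 L2 s : opt (L1 ++ L2) s <->
  exists s1 s2, [/\ opt L1 s1, opt L2 s2 & s = s1 ++ s2].
Proof.
elim: L1 s => [|l L1 IH] s /=.
  split=> [h|[_ [s2 [-> h ->]]]] //; by exists [::], s.
split=> [[s1 [s2 [h1 /IH[a [b [ha hb ->]]] ->]]]|[_ [b [[s1 [a [h1 ha ->]]] hb ->]]]].
  exists (rcons s1 l.2 ++ a), b; rewrite -catA; split=> //; by exists s1, a.
exists s1, (a ++ b); rewrite catA; split=> //; by apply/IH; exists a, b.
Qed.

Lemma opt_sub L s : opt L s -> {subset s <= verts L}.
Proof.
elim: L s => [|l L IH] s /=; first by move=> ->.
case=> s1 [s2 [h /IH hs ->]] z; rewrite verts_cons mem_cat mem_rcons inE.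
case/orP=> [/predU1P[->|]|/hs->]; rewrite ?eqxx ?orbT //.
by case: h => -> ->; rewrite ?orbT.
Qed.

Lemma opt_ex L : exists s, opt L s.
Proof.
by elim: L => [|l L [s h]]; [exists [::] | exists (rcons l.1.1 l.2 ++ s), l.1.1, s; split=> //;
  left].
Qed.

Lemma opt_parity b L : has flex L -> exists2 s, opt L s & odd (size s) = b.
Proof.
elim: L b => //= l L IH b /orP[fl|/(IH (~~ odd (size l.1.1) (+) b))[s hs os]].
  have [s hs] := opt_ex L.
  have [e|e] := eqVneq (odd (size l.1.1)) (~~ odd (size s) (+) b).
    exists (rcons l.1.1 l.2 ++ s); first by exists l.1.1, s; split=> //; left.
    by rewrite size_cat size_rcons oddD /= e; case: (odd _); case: b {IH e}.
  exists (rcons l.1.2 l.2 ++ s); first by exists l.1.2, s; split=> //; right.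
  move: fl e; rewrite /flex size_cat size_rcons oddD /=.
  by do 3 case: (odd _); case: b {IH}.
exists (rcons l.1.1 l.2 ++ s); first by exists l.1.1, s; split=> //; left.
by rewrite size_cat size_rcons oddD /= os; case: (odd _); case: b {IH os}.
Qed.

Lemma opt_through L z : z \in verts L -> exists2 s, opt L s & z \in s.
Proof.
elim: L => //= l L IH; rewrite verts_cons.
have [s hs] := opt_ex L; case/or4P=> [/eqP->|h|h|/IH[s' hs' h]].
- exists (rcons l.1.1 l.2 ++ s); first by exists l.1.1, s; split=> //; left.
  by rewrite mem_cat mem_rcons mem_head.
- exists (rcons l.1.1 l.2 ++ s); first by exists l.1.1, s; split=> //; left.
  by rewrite mem_cat mem_rcons inE h orbT.
- exists (rcons l.1.2 l.2 ++ s); first by exists l.1.2, s; split=> //; right.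
  by rewrite mem_cat mem_rcons inE h orbT.
exists (rcons l.1.1 l.2 ++ s'); first by exists l.1.1, s'; split=> //; left.
by rewrite mem_cat h orbT.
Qed.

Lemma opt_last x L s : opt L s -> last x s = last x (ends L).
Proof.
elim: L x s => [|l L IH] x s /=; first by move=> ->.
by case=> s1 [s2 [_ h ->]]; rewrite last_cat last_rcons (IH _ _ h).
Qed.

Definition necklace L := forall s, opt L s -> icyc s.

Lemma necklace_rot L1 L2 : necklace (L1 ++ L2) -> necklace (L2 ++ L1).
Proof.
move=> h _ /opt_cat[s2 [s1 [h2 h1 ->]]]; apply/icyc_rot/h/opt_cat.
by exists s1, s2.
Qed.

Hypothesis hg : forall s : seq G, odd_cycle s -> 11 <= size s.
Variables (F P : {set G}).
Hypothesis FP : [disjoint F & P].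

(** The last clause allows an initial part [b] inside [O] for the sake of the induction, where [b]
    collects the links already crossed. *)
Lemma rope n c (X : {set G}) u v O : rope_state F P X u v O -> ~~ col (c + n * 11) X ->
  exists L X' u' v' O',
  [/\ [/\ size L = n, all flex L, {subset ends L <= X} &
          pairwise (fun a b => ~~ near b a) (v :: ends L)],
      [/\ rope_state F P X' u' v' O', ~~ col c X', O \subset O', v \in v' |: O' &
          v' = last v (ends L)],
      {in verts L, forall z, [/\ z \in v' |: O', z \in F :|: P &
        {in O, forall o, [/\ o != z, ~~ (o -- z) &
          z \in P -> o \in P -> forall w, ~~ ((z -- w) && (w -- o))]}]} &
      forall b s, ipath (rcons b v) -> {subset b <= O} -> opt L s ->
        ipath (rcons b v ++ s)].
Proof.
elim: n c X u v O => [|n IH] c X u v O st nX.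
  exists [::], X, u, v, O; rewrite addn0 in nX; split=> //.
    by split=> //; rewrite in_setU1 eqxx.
  by move=> b s h _ /= ->; rewrite cats0.
rewrite mulSn addnCA addnC in nX.
have [u1 [v1 [X1 [O1 [s1 [s2 [st1 [nX1 X1X OO1 vO1] [v1X far1] [ip1 ip2 l1 l2 par] hs]]]]]]] :=
  link_step hg FP st nX.
have [L [X' [u' [v' [O' [[sL fL eL pL] [st' nX' OO' v1O' ev'] hL ipL]]]]]] := IH _ _ _ _ _
  st1 nX1.
have vX : v \notin X by have [_ []] := st.
have [r1 e1] : exists r1, s1 = rcons r1 v1.
  case/lastP: s1 l1 {ip1 par hs} => [|r1 y] /= l1; first by rewrite l1 v1X in vX.
  by exists r1; rewrite last_rcons in l1; rewrite l1.
have [r2 e2] : exists r2, s2 = rcons r2 v1.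
  case/lastP: s2 l2 {ip2 par hs} => [|r2 y] /= l2; first by rewrite l2 v1X in vX.
  by exists r2; rewrite last_rcons in l2; rewrite l2.
have sub1 : {subset v1 |: O1 <= v' |: O'}.
  move=> z; rewrite !in_setU1 => /predU1P[->|zO]; first by rewrite -in_setU1.
  by rewrite (subsetP OO') ?orbT.
exists ((r1, r2, v1) :: L), X', u', v', O'; split.
- split.
  + by rewrite /= sL.
  + rewrite /= fL andbT; move: par; rewrite e1 e2 !size_rcons /flex /=.
    by do 2 case: (odd _).
  + by move=> z; rewrite inE => /predU1P[->//|/eL]; apply: (subsetP X1X).
  rewrite /= in pL *; case/andP: (pL) => h1 ->; rewrite h1 !andbT.
  apply/andP; split; first by have [] := far1 v1 (setU11 _ _).
  apply/allP=> z /eL zX1.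
  by have [] := far1 z; rewrite // in_setU1 zX1 orbT.
- split=> //; first by apply: subset_trans OO1 OO'.
  by rewrite in_setU1 (subsetP OO') ?orbT.
- move=> z; rewrite verts_cons.
  have [zs|zs] := boolP (z \in s1 ++ s2).
    by move=> _; have [a b c0] := hs _ zs; split=> //; apply: sub1.
  have [n1 n2 n3] : [/\ z != v1, z \notin r1 & z \notin r2].
    move: zs; rewrite mem_cat e1 e2 !mem_rcons !inE !negb_or.
    by case/andP=> /andP[-> ->] /andP[_ ->].
  rewrite /= (negbTE n1) (negbTE n2) (negbTE n3) /= => /hL[a b h].
  by split=> // o oO; apply: h; apply: (subsetP OO1).
move=> b s ib bO /= [t [t' [ht ot ->]]].
have [ipt lt subt] : [/\ ipath (v :: rcons t v1), True & {subset rcons t v1 <= s1 ++ s2}].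
  case: ht => ->; split=> //; rewrite -?e1 -?e2 //.
    by move=> z zs; rewrite mem_cat zs.
  by move=> z zs; rewrite mem_cat zs orbT.
rewrite catA -rcons_cat; apply: ipL => //.
  rewrite rcons_cat; apply: ipath_cat => // y z yb /subt /hs[_ _ /(_ y (bO _ yb))[]] //.
move=> z; rewrite mem_cat mem_rcons inE => /orP[/predU1P[->//|/bO/(subsetP OO1)//]|zt].
have zr : z \in rcons t v1 by rewrite mem_rcons inE zt orbT.
have [] := hs _ (subt _ zr); rewrite in_setU1 => /predU1P[zv|//] _ _.
have := ipath_uniq ipt; rewrite /= rcons_uniq -zv zt andbF //.
Qed.

End Links.

(** * Necklaces *)

Section Floors.
Variable G : sgraph.
Hypothesis hg : forall s : seq G, odd_cycle s -> 11 <= size s.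
Implicit Types (x y z : G) (A F P Q B : {set G}).

(* Four consecutive parts of a levelling, from the last one to the first, the
   first levels being gathered in [B]. *)
Definition levelled F P Q B : Prop :=
  [/\ conn B,
      [/\ {in F, forall x, exists2 y, y \in P & y -- x},
          {in P, forall x, exists2 y, y \in Q & y -- x} &
          {in Q, forall x, exists2 y, y \in B & y -- x}],
      [disjoint F & P] /\ [disjoint P & Q],
      {in F & Q :|: B, forall x y, x != y /\ ~~ (x -- y)} &
      {in P & B, forall x y, x != y /\ ~~ (x -- y)}].

Lemma levelled_exists k A : 2 <= k -> conn A -> ~~ col (k + k) A ->
  exists F P Q B, [/\ levelled F P Q B, F :|: P :|: Q :|: B \subset A, conn F & ~~ col k F].
Proof.
move=> k2 cA nA; have /set0Pn[v vA] := cA.1.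
have [d bf] := bfs_exists cA vA; have [n nn] := big_layer bf nA.
have [_ dv up lip] := bf.
(* A layer at distance at most 4 from [v] lies in a ball, which is 2-colourable; so there is room
   for the three parts before the big layer. *)
have n5 : 4 < n.
  rewrite ltnNge; apply: contra nn => n4; apply: col_le k2 _.
  apply: col_sub (col_ball hg v); apply/subsetP=> x; rewrite !inE => /andP[xA /eqP dx].
  have [s [ip ls _ sz _]] := geodesic bf xA; rewrite nearC; apply/nearP.
  by exists s; rewrite sz dx ipath_path.
have [F [FL cF nF _]] := big_component nn.
have dF x : x \in F -> x \in A /\ d x = n.
  by move/(subsetP FL); rewrite inE => /andP[-> /eqP].
pose P := [set x in A | d x == n.-1]; pose Q := [set x in A | d x == n.-2].
pose B := [set x in A | d x <= n - 3].
have inL m x : (x \in [set x in A | d x == m]) = (x \in A) && (d x == m) by rewrite inE.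
have inB x : (x \in B) = (x \in A) && (d x <= n - 3) by rewrite inE.
have par x : x \in A -> 0 < d x -> exists y, [/\ y \in A, y -- x & (d y).+1 = d x].
  by move=> xA dx; apply: up => //; apply: contraTneq dx => ->; rewrite dv.
have far x y : x \in A -> y \in A -> (d y).+1 < d x -> x != y /\ ~~ (x -- y).
  move=> xA yA dxy; split; first by apply: contraTneq dxy => ->; rewrite -leqNgt.
  by apply/negP=> /(lip _ _ xA yA); rewrite leqNgt dxy.
exists F, P, Q, B; split=> //; last first.
  rewrite !subUset -!andbA; apply/and4P; split; apply/subsetP=> x; rewrite ?inE;
    try by case/andP.
  by case/dF.
split.
- apply: connect_conn.
    by apply/set0Pn; exists v; rewrite inB vA dv.
  have toB x : x \in B -> connect (restr B) v x.
    have [m] := ubnP (d x); elim: m x => // m IH x dm; rewrite inB => /andP[xA dx].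
    have [d0|d0] := posnP (d x); first by rewrite (bfs0 bf xA d0) connect0.
    have [y [yA yx dy]] := par x xA d0.
    have yB : y \in B by rewrite inB yA; move: dx dy; clear; lia.
    apply: connect_trans (IH y _ yB) _; first by move: dm dy; clear; lia.
    by apply: connect1; rewrite /restr /= yB yx inB xA dx.
  move=> x y xB yB; apply: connect_trans (toB _ yB).
  by rewrite restr_sym; apply: toB.
- split=> x.
  + case/dF=> xA dx; have [|y [yA yx dy]] := par x xA; first by move: dx n5; clear; lia.
    by exists y; rewrite // inL yA; move: dx dy; clear; lia.
  + rewrite inL => /andP[xA /eqP dx].
    have [|y [yA yx dy]] := par x xA; first by move: dx n5; clear; lia.
    by exists y; rewrite // inL yA; move: dx dy; clear; lia.
  + rewrite inL => /andP[xA /eqP dx].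
    have [|y [yA yx dy]] := par x xA; first by move: dx n5; clear; lia.
    by exists y; rewrite // inB yA; move: dx dy; clear; lia.
- split; rewrite disjoint_subset; apply/subsetP=> x.
    case/dF=> xA dx; rewrite inE inL negb_and; apply/orP; right; move: dx n5; clear; lia.
  rewrite inL => /andP[_ /eqP dx]; rewrite inE inL negb_and; apply/orP; right.
  by move: dx n5; clear; lia.
- move=> x y /dF[xA dx] /setUP[]; rewrite ?inL ?inB => /andP[yA dy]; apply: far => //.
    by move: dx dy n5; clear; lia.
  by move: dx dy n5; clear; lia.
move=> x y; rewrite inL inB => /andP[xA dx] /andP[yA dy]; apply: far => //.
by move: dx dy n5; clear; lia.
Qed.

Lemma ipath_last (p : seq G) x : ipath (rcons p x) ->
  {in p, forall z, (x -- z) = (z == last x p)}.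
Proof.
elim: p => //= y p IH /and3P[yp h ip] z; rewrite inE => /predU1P[->|zp].
  case: p yp h {IH ip} => [|w p] /= yp; first by rewrite eqxx andbT sedge_sym.
  case/andP=> _ /allP/(_ x); rewrite mem_rcons mem_head => /(_ isT).
  rewrite sedge_sym => /negbTE->; apply/esym/negP=> /eqP e.
  by move: yp; rewrite -rcons_cons mem_rcons in_cons e mem_last orbT.
rewrite (IH ip z zp); case: p zp {IH yp h ip} => [|w p] //.
Qed.

(** The rope starts at a neighbour [v0] of [p0]. It is prolonged inside [X] by [Y] up to the first
    neighbour of [r], then closed by [r], a path [W] in the earlier levels, and [p0]. Of the 5 extra
    colours, one removes the neighbours of [p0] from the place where the rope grows, and four put
    [x], the child of [r], far from [u] and [v]. *)
Lemma necklace_exists n F P Q B : levelled F P Q B -> conn F -> ~~ col (5 + n * 11) F ->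
  exists L Z,
  [/\ size L = n, all (@flex G) L, pairwise (fun a b => ~~ near b a) (ends L),
      necklace (rcons L Z) &
      {in verts (rcons L Z), forall z, z \in F :|: P :|: Q :|: B} /\
      {in ends L, forall z, z \in F}].
Proof.
case=> cB [FPx PQx QBx] [FP PQ] FQB PB cF nF.
have /set0Pn[x0 x0F] := cF.1; have [p0 p0P px0] := FPx _ x0F.
have nFP z : z \in F -> z \notin P by move=> zF; rewrite (disjointFr FP zF).
have nF' : ~~ col (4 + n * 11) (F :\: nbh p0).
  by apply: colD (col_stable (stable_nbh hg p0)); rewrite addnAC.
have [X0 [X0F cX0 nX0 clX0]] := big_component nF'.
have X0' x : x \in X0 -> x \in F /\ ~~ (p0 -- x).
  by move/(subsetP X0F); rewrite !inE => /andP[].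
have [||||y0 [v0 [y0X /setDP[v0F v0X] yv0]]] := @connW _ F X0 x0 cF; rewrite ?cX0.1 //.
- by apply/subsetP=> x /X0'[].
- by apply/negP=> /X0'[_]; rewrite px0.
have pv0 : p0 -- v0.
  by apply: contraNT v0X => npv; apply: clX0 yv0; rewrite // !inE npv.
have st0 : rope_state F P X0 v0 v0 [set p0].
  split.
  - by split=> //; apply/subsetP=> x /X0'[].
  - by split=> //; exists y0; rewrite // sedge_sym.
  - move=> o; rewrite inE => /eqP->; split; last by move=> x /X0'[].
    by apply/negP=> /X0'[/nFP]; rewrite p0P.
  move=> x xX nr _ q qP qx o.
  have far l : path sedge x l -> last x l = v0 -> size l <= 4 -> False.
    by move=> p1 p2 p3; move/negP: nr; apply; apply/nearP; exists l.
  rewrite !inE => /orP[]/eqP->; split.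
  - by apply: contraTneq qP => ->; apply: nFP.
  - by apply/negP=> qv; apply: (far [:: q; v0]); rewrite //= sedge_sym qx qv.
  - by move=> v0P; have := nFP _ v0F; rewrite v0P.
  - apply/eqP=> qp; have [_] := X0' _ xX; by rewrite -qp qx.
  - by apply/negP=> qp; apply: (far [:: q; p0; v0]); rewrite //= sedge_sym qx qp pv0.
  move=> _ w; apply/andP=> -[qw wp].
  by apply: (far [:: q; w; p0; v0]); rewrite //= sedge_sym qx qw wp pv0.
have [L [X [u [v [O [[sL fL eL pL] [st nX O0 v0O ev] hL ipL]]]]]] := rope hg FP st0 nX0.
have [[XF vF cX] [vX [y yX vy]] OX PO] := st.
have p0O : p0 \in O by rewrite (subsetP O0) ?inE.
have /set0Pn[x xE] : X :\: (ball u :|: ball v) != set0.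
  have : ~~ col 0 (X :\: (ball u :|: ball v)).
    by apply: (@colD _ 0 4) => //; apply: (@colU _ 2 2); apply: col_ball.
  by apply: contra => /eqP->; apply/colP; exists (fun=> 0) => z; rewrite inE.
have [xX nxu nxv] : [/\ x \in X, ~~ near x u & ~~ near x v].
  by move: xE; rewrite !inE negb_or => /andP[/andP[-> ->] ->].
have [r rP rx] := FPx _ (subsetP XF _ xX).
have rO := PO x xX nxu nxv r rP rx.
have [rp0 nrp0 _] : [/\ r != p0, ~~ (r -- p0) & True].
  by have [] := rO p0; rewrite ?in_setU1 ?p0O ?orbT.
have cvX : conn (v |: X) by apply: conn_add vy.
have [Y0 [ipY0 lY0 sY0]] := conn_ipath cvX (setU11 v X) (setU1r v xX).
have hasY : has (fun z => r -- z) Y0.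
  apply/hasP; exists x => //; have := mem_last v Y0; rewrite lY0 inE => /predU1P[xv|//].
  by rewrite -xv xX in vX.
case/split_find: hasY ipY0 sY0 {lY0} => y1 Y1 Y2 ry1 nY1 ipY0 sY0.
pose Y := rcons Y1 y1.
have ipY : ipath (v :: Y) by move: ipY0; rewrite -cat_cons => /ipath_prefix.
have YX z : z \in Y -> z \in X.
  move=> zY; have := sY0 z; rewrite inE mem_cat zY orbT => /(_ isT).
  rewrite in_setU1 => /predU1P[zv|//].
  by have := ipath_uniq ipY; rewrite /= -zv zY.
have rY z : z \in Y -> (r -- z) = (z == y1).
  rewrite mem_rcons inE => /predU1P[->|zY1]; first by rewrite ry1 eqxx.
  have /hasPn/(_ _ zY1)/negbTE-> := nY1; apply/esym/negP=> /eqP e.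
  by have := ipath_uniq ipY; rewrite /= rcons_uniq -e zY1 andbF.
have [wr wrQ wrr] := PQx _ rP; have [w0 w0Q w0p] := PQx _ p0P.
have [b1 b1B bw1] := QBx _ wrQ; have [b0 b0B bw0] := QBx _ w0Q.
pose B2 := wr |: (w0 |: B).
have cB2 : conn (r |: (p0 |: B2)).
  rewrite sedge_sym in bw1; rewrite sedge_sym in bw0; rewrite sedge_sym in wrr;
    rewrite sedge_sym in w0p.
  apply: conn_add wrr; last by rewrite !inE eqxx orbT.
  apply: conn_add w0p; last by rewrite !inE eqxx orbT.
  apply: conn_add bw1; last by rewrite inE b1B orbT.
  by apply: conn_add bw0.
have [W0 [ipW lW sW]] := conn_ipath cB2 (setU11 r _) (setU1r r (setU11 p0 _)).
have [W eW] : exists W, W0 = rcons W p0.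
  case/lastP: W0 lW {ipW sW} => [|W z] /=; first by move=> e; rewrite e eqxx in rp0.
  by rewrite last_rcons => ->; exists W.
rewrite {}eW {lW} in ipW sW.
have WB z : z \in W -> z \in B2.
  move=> zW; have := sW z; rewrite inE mem_rcons inE zW !orbT => /(_ isT).
  have /= := ipath_uniq ipW; rewrite mem_rcons inE rcons_uniq negb_or =>
    /andP[/andP[_ rW] /andP[pW _]].
  rewrite in_setU1 => /predU1P[e|]; first by rewrite -e zW in rW.
  by rewrite in_setU1 => /predU1P[e|//]; rewrite -e zW in pW.
have lWp z : z \in r :: W -> (p0 -- z) = (z == last r W).
  by rewrite -rcons_cons in ipW => zW; rewrite (ipath_last ipW zW).
(* The closing path has no alternative, so the two branches of [Z] coincide. *)
pose Z : link G := (Y ++ r :: rcons W p0, Y ++ r :: rcons W p0, v0).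
have inF z : z \in v0 :: Y -> z \in F.
  by rewrite inE => /predU1P[->//|/YX/(subsetP XF)].
exists L, Z; split=> //; first by case/andP: pL.
  move=> _ /[!(=^~ cats1)]/opt_cat[s [_ [os [s1 [_ [h -> ->]]]] ->]].
  have {s1 h}-> : s1 = Y ++ r :: rcons W p0 by case: h.
  rewrite cats0 !rcons_cat /= -!cats1 -!catA /=.
  rewrite catA -[r :: W ++ _]/((r :: W) ++ [:: p0; v0]) catA.
  apply: icyc_rot; rewrite cat_cons; apply/icycP.
  have sL' := opt_sub os.
  have inO z : z \in v0 :: s -> z \in v |: O.
    by rewrite inE => /predU1P[->//|/sL'/hL[]].
  have inFP z : z \in v0 :: s -> z \in F \/ z \in verts L /\ z \in P.
    rewrite inE => /predU1P[->|/sL' zL]; first by left.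
    by have [_ /setUP[]] := hL _ zL; [left|right].
  have ip1 : ipath (v0 :: s) by apply: (ipL [::]).
  have ls : last v0 s = v by rewrite ev (opt_last _ os).
  have ip2 : ipath (v0 :: s ++ Y).
    rewrite -cat_cons lastI ls; apply: ipath_cat => //; first by rewrite -ls -lastI.
    move=> a b ha /YX bX; have aO : a \in O.
      have := inO a; rewrite lastI ls mem_rcons inE ha orbT => /(_ isT).
      rewrite in_setU1 => /predU1P[av|//].
      by have := ipath_uniq ip1; rewrite lastI ls rcons_uniq -av ha.
    have [aX h] := OX _ aO; split; last exact: h.
    by apply: contraNneq aX => ->.
  have cases2 z : z \in v0 :: s ++ Y -> z \in v0 :: s \/ z \in Y.
    by rewrite -cat_cons mem_cat => /orP.
  have ip3 : ipath (rcons (v0 :: s ++ Y) r).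
    apply: ipath_rcons => //.
      apply/negP=> /cases2[/inO/rO[]|/YX/(subsetP XF)/nFP]; rewrite ?eqxx ?rP //.
    move=> z; rewrite /= last_cat last_rcons => /cases2[zs|/rY//].
    have [rz nrz _] := rO _ (inO _ zs); rewrite (negbTE nrz); apply/esym/negP=> /eqP e.
    by move: nrz; rewrite e ry1.
  have ip4 : ipath ((v0 :: s ++ Y) ++ r :: W).
    rewrite -cat_rcons; apply: ipath_cat => //.
      by move: ipW; rewrite -rcons_cons -cats1 => /ipath_prefix.
    move=> a b ha /WB bB.
    have FB2 c : c \in F -> c != b /\ ~~ (c -- b).
      move=> cF'; apply: FQB => //; move: bB; rewrite !in_setU1 in_setU.
      by case/or3P=> [/eqP->|/eqP->|->]; rewrite ?wrQ ?w0Q ?orbT.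
    case: (cases2 _ ha) => [as_|/YX/(subsetP XF)/FB2//].
    case: (inFP _ as_) => [/FB2//|[aL aP]].
    (* A rope vertex [a] in [P] might see [wr] or [w0]. It would then share a neighbour with [r] or
       [p0]: this is why the rope excludes common neighbours between vertices of [P]. *)
    have nPQ c : c \in Q -> a != c.
      by move=> cQ; apply: contraTneq cQ => <-; rewrite (disjointFr PQ aP).
    move: bB; rewrite !in_setU1 => /or3P[/eqP->|/eqP->|]; last exact: PB.
      split; first exact: nPQ.
      apply/negP=> aw; have [_ _ /(_ aP wr)] := rO _ (inO _ as_).
      by rewrite sedge_sym wrr sedge_sym aw.
    split; first exact: nPQ.
    have [_ _ /(_ p0 (set11 _))[_ _ /(_ aP p0P w0)]] := hL _ aL.
    by rewrite negb_and w0p orbF.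
  have pcase z : z \in (s ++ Y) -> p0 != z /\ ~~ (p0 -- z).
    rewrite mem_cat => /orP[/sL'/hL[_ _ /(_ p0 (set11 _))[]//]|/YX zX].
    have [pX h] := OX _ p0O; split; last exact: h.
    by apply: contraNneq pX => ->.
  split.
  - by move: ip4; rewrite /= -catA.
  - rewrite inE -!catA; apply/negP=> /predU1P[e|].
      by move: pv0; rewrite e sedge_irr.
    rewrite catA mem_cat => /orP[/pcase[]|]; first by rewrite eqxx.
    rewrite inE => /predU1P[e|pW]; first by rewrite e eqxx in rp0.
    by have /= := ipath_uniq ipW; rewrite rcons_uniq pW andbF.
  - by rewrite /= !size_cat /=; clear; lia.
  move=> z zz; have -> : last p0 (v0 :: (s ++ Y) ++ r :: W) = last r W by rewrite /= last_cat.
  apply/idP/orP=> [pz|[/eqP->//|/eqP->]]; last by rewrite (lWp _ (mem_last r W)) eqxx.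
  move: zz; rewrite inE => /predU1P[->|]; first by left.
  rewrite -catA catA mem_cat => /orP[/pcase[_]|zW]; first by rewrite pz.
  by right; rewrite -lWp.
split; last by move=> z /eL /X0'[].
move=> z; rewrite -cats1 verts_cat mem_cat => /orP[/hL[_ h _]|].
  by rewrite in_setU in_setU h.
have zYW : z \in Y ++ r :: rcons W p0 -> z \in F :|: P :|: Q :|: B.
  rewrite mem_cat in_cons (mem_rcons W) in_cons !in_setU.
  case/or4P=> [/YX/(subsetP XF)->//|/eqP->|/eqP->|/WB].
  - by rewrite rP orbT.
  - by rewrite p0P orbT.
  rewrite !in_setU1 => /or3P[/eqP->|/eqP->|->]; rewrite ?wrQ ?w0Q ?orbT //.
rewrite verts_cons orbF => /or3P[/eqP->|/zYW//|/zYW//].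
by rewrite !in_setU v0F.
Qed.

End Floors.

(** * Hubs with three legs *)

Section Tripod.
Variable G : sgraph.
Hypothesis hg : forall s : seq G, odd_cycle s -> 11 <= size s.
Implicit Types (x y z : G) (A S : {set G}).

Lemma conn_path x (p : seq G) : path sedge x p -> conn [set z in x :: p].
Proof.
elim: p x => [|y p IH] x /=; first by rewrite -[[set z in _]]/[set:: [:: x]] set_seq1;
  move=> _; apply: conn1.
case/andP=> xy /IH c; rewrite set_cons; apply: conn_add c _ xy.
by rewrite inE mem_head.
Qed.

Lemma bfs_walk A v d x (p : seq G) : bfs A v d -> path sedge x p ->
  {subset x :: p <= A} -> d (last x p) <= d x + size p.
Proof.
case=> _ _ _ lip; elim: p x => [|y p IH] x /=; first by rewrite addn0.
case/andP=> xy yp sub; have yA : y \in A by apply: sub; rewrite !inE eqxx orbT.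
have xA : x \in A by apply: sub; rewrite mem_head.
apply: leq_trans (IH y yp _) _; first by move=> z zp; apply: sub; rewrite inE zp orbT.
by rewrite addnS -addSn leq_add2r; apply: lip; rewrite // sedge_sym.
Qed.

(* A smallest connected set containing the three vertices is the union of two
   geodesics from one of them, and an edge between vertices at the same
   distance would be part of a triangle. *)
Lemma tripod A w1 w2 w3 : conn A -> w1 \in A -> w2 \in A -> w3 \in A ->
  exists S (e : G -> bool), [/\ S \subset A, conn S, [/\ w1 \in S, w2 \in S & w3 \in S] &
    {in S &, forall x y, x -- y -> e x != e y}].
Proof.
move=> cA w1A w2A w3A.
pose ok (S : {set G}) := [&& S \subset A, connb S, w1 \in S, w2 \in S & w3 \in S].
have okA : ok A by rewrite /ok subxx w1A w2A w3A !andbT; apply/connP.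
case: (arg_minnP (fun S : {set G} => #|S|) okA) => S /and5P[SA /connP cS w1S w2S w3S] mS.
have [d bf] := bfs_exists cS w3S.
have [g1 [ip1 l1 s1 z1 [_ inj1]]] := geodesic bf w1S.
have [g2 [ip2 l2 s2 z2 [_ inj2]]] := geodesic bf w2S.
have [_ d0 _ lip] := bf.
have dep g (w : G) (m y : seq G) z : ipath (w3 :: g) -> last w3 g = w -> {subset w3 :: g <=
  S} ->
    size g = d w -> g = m ++ z :: y -> d z = (size m).+1 /\ d (last w3 m) = size m.
  move=> ip lg sg zg eg; have := ipath_path ip; rewrite eg cat_path /= => /and3P[pm mz pz].
  have zS : {subset z :: y <= S}.
    by move=> t ty; apply: sg; rewrite eg inE mem_cat ty !orbT.
  have mS' : {subset w3 :: m <= S}.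
    by move=> t; rewrite inE => tm; apply: sg; rewrite eg inE mem_cat orbA tm.
  have h1 := bfs_walk bf pz zS; have h2 := bfs_walk bf pm mS'.
  have zz : z \in S by apply: zS; rewrite mem_head.
  have mm : last w3 m \in S by apply: mS'; rewrite mem_last.
  rewrite sedge_sym in mz; have h3 := lip _ _ zz mm mz.
  move: lg zg h1 h2 h3; rewrite eg last_cat /= size_cat /= d0 => -> <-.
  by clear; lia.
have level x y : x \in w3 :: g1 -> y \in w3 :: g2 -> x -- y -> d x != d y.
  move=> xg yg xy; apply/negP=> /eqP dxy.
  have d0' t : t \in S -> d t = 0 -> t = w3 by move=> tS; apply: bfs0 bf tS.
  have xy' : x != y by apply: contraTneq xy => ->; rewrite sedge_irr.
  have yg2 : y \in g2.
    move: yg; rewrite inE => /predU1P[yw|//]; case/eqP: xy'; rewrite yw.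
    by apply: d0'; rewrite ?s1 // dxy yw d0.
  have xg1 : x \in g1.
    move: xg; rewrite inE => /predU1P[xw|//]; case/eqP: xy'; rewrite xw.
    by apply/esym/d0'; rewrite ?s2 // -dxy xw d0.
  case/splitPr: {-1}_ / xg1 (erefl g1) => p1 q1 e1.
  case/splitPr: {-1}_ / yg2 (erefl g2) => p2 q2 e2.
  have [dx dm1] := dep _ _ _ _ _ ip1 l1 s1 z1 e1.
  have [dy dm2] := dep _ _ _ _ _ ip2 l2 s2 z2 e2.
  have := ipath_path ip1; rewrite e1 cat_path /= => /and3P[pp1 mx _].
  have := ipath_path ip2; rewrite e2 cat_path /= => /and3P[pp2 my pq2].
  pose S' := [set z in w3 :: g1] :|: [set z in y :: q2].
  have S'S : S' \subset S.
    apply/subsetP=> z; rewrite in_setU in_set in_set => /orP[/s1//|zy].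
    by apply: s2; rewrite e2 inE mem_cat zy !orbT.
  have : last w3 p2 \in S'.
    have -> : S' = S.
      apply/eqP; rewrite eqEcard S'S mS // /ok (subset_trans S'S SA) /=.
      rewrite !in_setU !in_set -l1 mem_last -l2 e2 last_cat /= mem_last orbT mem_head /= andbT.
      apply/connP; apply: (@connU _ _ _ x y).
      - exact: conn_path (ipath_path ip1).
      - exact: conn_path pq2.
      - by rewrite in_set e1 inE mem_cat mem_head !orbT.
      - by rewrite in_set mem_head.
      by rewrite xy orbT.
    by apply: s2; rewrite e2 -cat_cons mem_cat mem_last.
  rewrite /S' in_setU !in_set => /orP[m2g|m2q]; last first.
    have := ipath_uniq ip2; rewrite e2 -cat_cons cat_uniq => /and3P[_ /hasPn/(_ _ m2q)].
    by rewrite mem_last.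
  have m12 : last w3 p1 = last w3 p2.
    apply: inj1 => //; last by rewrite dm1 dm2; move: dxy; rewrite dx dy => -[].
    by rewrite e1 -cat_cons mem_cat mem_last.
  have := triangle_free hg xy; move: mx; rewrite m12 sedge_sym => mx.
  by rewrite sedge_sym in my; move/(_ _ my); rewrite mx.
have cover x : x \in S -> x \in w3 :: g1 \/ x \in w3 :: g2.
  move=> xS; apply/orP.
  pose S' := [set z in w3 :: g1] :|: [set z in w3 :: g2].
  have S'S : S' \subset S.
    by apply/subsetP=> z; rewrite in_setU in_set in_set => /orP[/s1|/s2].
  suff -> : (x \in w3 :: g1) || (x \in w3 :: g2) = (x \in S') by rewrite (_ : S' = S) //;
    apply/eqP; rewrite eqEcard S'S mS // /ok (subset_trans S'S SA) /=;
    rewrite !in_setU !in_set -l1 mem_last -l2 mem_last orbT mem_head /= andbT;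
    apply/connP; apply: (@connU _ _ _ w3 w3); rewrite ?in_set ?mem_head ?eqxx //;
    apply: conn_path; exact: ipath_path.
  by rewrite /S' in_setU !in_set.
exists S, (fun x => odd (d x)); split=> // x y xS yS xy.
have dne : d x != d y.
  have xy' : x != y by apply: contraTneq xy => ->; rewrite sedge_irr.
  case: (cover x xS) (cover y yS) => xg [] yg.
  - by apply: contraNneq xy' => /(inj1 _ _ xg yg)->.
  - exact: level.
  - by rewrite eq_sym; apply: level; rewrite // sedge_sym.
  by apply: contraNneq xy' => /(inj2 _ _ xg yg)->.
have := lip _ _ xS yS xy; rewrite sedge_sym in xy; have := lip _ _ yS xS xy.
by move: dne; clear; lia.
Qed.

End Tripod.

(** * Wheels from a hub and a necklace *)

Section Endgame.
Variable G : sgraph.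
Hypothesis hg : forall s : seq G, odd_cycle s -> 11 <= size s.
Implicit Types (x y z a w t : G) (S HX HY : {set G}) (L X Y : seq (link G)).

Definition touch a (l : link G) := has (fun z => a -- z) (l.2 :: l.1.1 ++ l.1.2).

Lemma touchP a L : has (touch a) L -> exists2 z, z \in verts L & a -- z.
Proof.
elim: L => //= l L IH /orP[/hasP[z zl az]|/IH[z zL az]].
  by exists z; rewrite // /verts /= -cat_cons mem_cat zl.
by exists z; rewrite // verts_cons zL !orbT.
Qed.

Lemma touchN a L : ~~ has (touch a) L -> {in verts L, forall z, ~~ (a -- z)}.
Proof.
elim: L => //= l L IH; rewrite negb_or => /andP[/hasPn h /IH h'] z.
by rewrite /verts /= -cat_cons mem_cat => /orP[/h|/h'].
Qed.

Lemma has_last (p : pred G) (s : seq G) : has p s ->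
  exists s1 x s2, [/\ s = s1 ++ x :: s2, p x & ~~ has p s2].
Proof.
elim: s => //= x s IH; have [/IH[s1 [y [s2 [-> py h]]]] _|ns] := boolP (has p s).
  by exists (x :: s1), y, s2.
by rewrite orbF => px; exists [::], x, s.
Qed.

Definition safe HX HY z := z \notin HX :|: HY /\ {in HX, forall x, ~~ (x -- z)}.

Lemma wheel3 HX HY s1 t1 s2 t2 s3 t3 : hub HX HY ->
  icyc (rcons s1 t1 ++ rcons s2 t2 ++ rcons s3 t3) ->
  {in rcons s1 t1 ++ rcons s2 t2 ++ rcons s3 t3, forall z, safe HX HY z} ->
  touched HY t1 -> touched HY t2 -> touched HY t3 ->
  ~~ odd (size s1) -> ~~ odd (size s2) -> ~~ odd (size s3) ->
  has_odd_wheel_tminor G.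
Proof.
move=> hH ic sf T1 T2 T3 o1 o2 o3.
have e : perm_eq (rcons s1 t1 ++ rcons s2 t2 ++ rcons s3 t3) (t3 :: s1 ++ t1 :: s2 ++ t2 :: s3).
  rewrite -[s3 in X in perm_eq _ X]cats0 -(cat_rcons t1) -(cat_rcons t2) cats0.
  rewrite -[rcons s3 t3]cats1 !catA perm_catC /= -!catA perm_refl //.
apply: (@wheel_touching _ t3 t1 t2 s1 s2 s3 HX HY) => //.
- move: ic; rewrite -(cats1 s3) !catA => /icyc_rot.
  by rewrite /= -!catA !cat_rcons.
- rewrite disjoint_sym disjoint_subset; apply/subsetP=> z; rewrite -(perm_mem e).
  by case/sf=> h _; rewrite inE.
by move=> y z yX; rewrite -(perm_mem e) => /sf[_]; apply.
Qed.

Lemma flex_rcons t b L : has (@flex G) L -> last t (ends L) = t ->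
  exists2 s, opt L (rcons s t) & odd (size s) = b.
Proof.
move=> fL lt; have [s hs os] := opt_parity (~~ b) fL.
have := opt_last t hs; rewrite lt; case/lastP: s hs os => [|s y] hs os e.
  by case: L fL hs {lt} => // l L _ /= [s1 [s2 [_ _]]]; case: s1.
rewrite last_rcons in e; rewrite -e; exists s => //.
by apply: negb_inj; rewrite -os size_rcons.
Qed.

Lemma verts_sub L L' : {subset L <= L'} -> {subset verts L <= verts L'}.
Proof.
by move=> sub z /flatten_mapP[l /sub lL zl]; apply/flatten_mapP; exists l.
Qed.

Lemma wheel_three HX HY E1 E2 E3 t1 t2 t3 : hub HX HY ->
  necklace (E1 ++ E2 ++ E3) -> {in verts (E1 ++ E2 ++ E3), forall z, safe HX HY z} ->
  has (@flex G) E1 -> has (@flex G) E2 -> has (@flex G) E3 ->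
  last t1 (ends E1) = t1 -> last t2 (ends E2) = t2 -> last t3 (ends E3) = t3 ->
  touched HY t1 -> touched HY t2 -> touched HY t3 ->
  has_odd_wheel_tminor G.
Proof.
move=> hH nk sf f1 f2 f3 l1 l2 l3 T1 T2 T3.
have [s1 h1 o1] := flex_rcons false f1 l1.
have [s2 h2 o2] := flex_rcons false f2 l2.
have [s3 h3 o3] := flex_rcons false f3 l3.
have op : opt (E1 ++ E2 ++ E3) (rcons s1 t1 ++ rcons s2 t2 ++ rcons s3 t3).
  apply/opt_cat; exists (rcons s1 t1), (rcons s2 t2 ++ rcons s3 t3); split=> //.
  by apply/opt_cat; exists (rcons s2 t2), (rcons s3 t3).
apply: (wheel3 hH (nk _ op) _ T1 T2 T3); rewrite ?o1 ?o2 ?o3 // => z zs.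
exact/sf/(opt_sub op).
Qed.

(** The third touched vertex [z] may lie inside a link, so an option of [Y2] through [z] is fixed
    first. The links [l2] and [r1], one on each side of it, then correct the two arcs ending at [z],
    and [l1] the arc between the two ends. *)
Lemma wheel_two HX HY r1 l1 Y1 r2 l2 Y2 z : hub HX HY ->
  let L := [:: r1, l1 & Y1] ++ [:: r2, l2 & Y2] in
  necklace L -> {in verts L, forall z, safe HX HY z} ->
  flex r1 -> flex l1 -> flex l2 ->
  touched HY r1.2 -> touched HY r2.2 -> touched HY z -> z \in verts Y2 ->
  has_odd_wheel_tminor G.
Proof.
move=> hH L nk sf fr1 fl1 fl2 T1 T2 Tz zY.
have [sy hy zs] := opt_through zY; move: hy; case/splitPr: zs => c1 c2 hy.
have nk' : necklace ((l1 :: Y1 ++ [:: r2]) ++ (l2 :: Y2 ++ [:: r1])).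
  have -> : (l1 :: Y1 ++ [:: r2]) ++ (l2 :: Y2 ++ [:: r1]) = (l1 :: Y1 ++ [:: r2, l2 & Y2])
    ++ [:: r1].
    by rewrite /= -!catA.
  exact: necklace_rot.
have [||q hq oq] := @flex_rcons r2.2 false (l1 :: Y1 ++ [:: r2]).
  by rewrite /= fl1.
  by rewrite /ends /= map_cat last_cat.
have [u hu ou] := @opt_parity G (odd (size c1)) [:: l2] (introT orP (or_introl fl2)).
have [|//|v hv ov] := @flex_rcons r1.2 (odd (size c2)) [:: r1]; first by rewrite /= fr1.
have op : opt ((l1 :: Y1 ++ [:: r2]) ++ (l2 :: Y2 ++ [:: r1]))
    (rcons q r2.2 ++ rcons (u ++ c1) z ++ rcons (c2 ++ v) r1.2).
  apply/opt_cat; exists (rcons q r2.2), (u ++ (c1 ++ z :: c2) ++ rcons v r1.2); split=> //.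
  - apply/(opt_cat [:: l2]); exists u, ((c1 ++ z :: c2) ++ rcons v r1.2); split=> //.
    by apply/opt_cat; exists (c1 ++ z :: c2), (rcons v r1.2).
  by rewrite rcons_cat -catA -!cats1 -!catA.
apply: (wheel3 hH (nk' _ op) _ T2 Tz T1).
- move=> y /(opt_sub op) yv; apply: sf; apply: verts_sub yv => k.
  rewrite /L !(mem_cat, in_cons) => h.
  by move: h; rewrite !in_nil !orbF; do 4 case: (k == _); do 2 case: (k \in _).

- by rewrite oq.
- by rewrite size_cat oddD ou addbb.
by rewrite size_cat oddD ov addbb.
Qed.

(** The leg [a] is touched by the hub and sees only its own links [r] and [l]. On an option [m] of
    these through [r.2], either [r.2] is its only neighbour and [a] is contracted with it, or [a]
    replaces the part of [m] between its first and last neighbours. The arcs are corrected inside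
    [E1], [E2] and [E3]. *)
Lemma wheel_leg HX HY a r l E1 E2 E3 t1 t2 : hub HX HY ->
  let L := [:: r; l] ++ E1 ++ E2 ++ E3 in
  necklace L -> {in verts L, forall z, safe HX HY z} ->
  has (@flex G) E1 -> has (@flex G) E2 -> has (@flex G) E3 ->
  last t1 (ends E1) = t1 -> last t2 (ends E2) = t2 ->
  touched HY t1 -> touched HY t2 -> touched HY a -> ~~ touched HY r.2 ->
  a -- r.2 -> safe HX HY a -> a \notin verts L ->
  {in verts (E1 ++ E2 ++ E3), forall z, ~~ (a -- z)} ->
  has_odd_wheel_tminor G.
Proof.
move=> hH L nk sf f1 f2 f3 l1 l2 T1 T2 Ta nT ar [aH aX] aL aE.
have [m hm rm] : exists2 m, opt [:: r; l] m & r.2 \in m.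
  by apply: opt_through; rewrite verts_cons eqxx.
have glue (y1 y2 y3 : seq G) : opt E1 y1 -> opt E2 y2 -> opt E3 y3 -> opt (E1 ++ E2 ++ E3)
  (y1 ++ y2 ++ y3).
  move=> h1 h2 h3; apply/opt_cat; exists y1, (y2 ++ y3); split=> //.
  by apply/opt_cat; exists y2, y3.
have glueL (s : seq G) : opt (E1 ++ E2 ++ E3) s -> opt L (m ++ s).
  by move=> h; apply/opt_cat; exists m, s.
have [q2 h2 o2] := flex_rcons false f2 l2.
have hm1 : has (fun z => a -- z) m by apply/hasP; exists r.2.
case/split_find: hm1 hm rm glueL => zf M1 M2 azf /hasPn nM1 hm rm glueL.
have [hM2|/hasPn nM2] := boolP (has (fun z => a -- z) M2); last first.
  have ezf : zf = r.2.
    move: rm; rewrite mem_cat mem_rcons inE => /orP[/predU1P[->//|rM]|rM].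
      by have := nM1 _ rM; rewrite ar.
    by have := nM2 _ rM; rewrite ar.
  have [q1 h1 o1] := flex_rcons (~~ odd (size M2)) f1 l1.
  have [y3 h3 o3] := opt_parity (~~ odd (size M1)) f3.
  have opE := glue _ _ _ h1 h2 h3; have opL := glueL _ opE.
  have e : perm_eq ((rcons M1 zf ++ M2) ++ rcons q1 t1 ++ rcons q2 t2 ++ y3)
      (zf :: (M2 ++ q1) ++ t1 :: q2 ++ t2 :: (y3 ++ M1)).
    by rewrite -cats1 -!catA perm_catC /= -!catA !cat_rcons.
  have ssf z : z \in zf :: (M2 ++ q1) ++ t1 :: q2 ++ t2 :: (y3 ++ M1) -> z \in verts L.
    by rewrite -(perm_mem e); apply: opt_sub.
  rewrite -ezf in nT ar.
  apply: (@wheel_through_leg _ zf a t1 t2 (M2 ++ q1) q2 (y3 ++ M1) HX HY) => //.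
  - have := nk _ opL; rewrite -cats1 -!catA => /icyc_rot.
    by rewrite /= -!catA !cat_rcons.
  - rewrite disjoint_sym disjoint_subset; apply/subsetP=> z /ssf/sf[h _].
    by rewrite inE.
  - by move=> y z yX /ssf/sf[_]; apply.
  - by apply: contra aL => /ssf.
  - move=> z zz; have : z \in M2 ++ M1 ++ rcons q1 t1 ++ rcons q2 t2 ++ y3.
      move: zz; rewrite !(mem_cat, mem_rcons, in_cons).
      by do 2 case: (z == _); do 5 case: (z \in _).
    rewrite !mem_cat => /or3P[/nM2//|/nM1//|]; rewrite -!mem_cat => /(opt_sub opE).
    exact: aE.
  - by move=> x xX; rewrite sedge_sym; apply: aX.
  - by rewrite size_cat oddD o1 addbN addbb.
  - by rewrite o2.
  by rewrite size_cat oddD o3 addNb addbb.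
have [M3 [zl [M4 [eM azl /hasPn nM4]]]] := has_last hM2; subst M2.
have [q1 h1 o1] := flex_rcons (~~ odd (size M4)) f1 l1.
have [y3 h3 o3] := opt_parity (~~ odd (size M1)) f3.
have opE := glue _ _ _ h1 h2 h3; have opL := glueL _ opE.
pose s := (zl :: M4 ++ q1) ++ t1 :: q2 ++ t2 :: (y3 ++ rcons M1 zf).
have e : perm_eq ((rcons M1 zf ++ M3 ++ zl :: M4) ++ rcons q1 t1 ++ rcons q2 t2 ++ y3) (s ++
  M3).
  by apply/permP=> k; rewrite /s -!cats1; do 12 rewrite ?count_cat /=; clear; lia.
have ic : icyc (M3 ++ s).
  have := nk _ opL; rewrite -!catA => /icyc_rot.
  suff -> : M3 ++ s = (M3 ++ (zl :: M4) ++ rcons q1 t1 ++ rcons q2 t2 ++ y3) ++ rcons M1 zf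
    by [].
  by rewrite /s -!cats1; do 8 rewrite -?catA /=.
have ssf z : z \in s -> z \in verts L.
  by move=> zs; apply: (opt_sub opL); rewrite (perm_mem e) mem_cat zs.
have as_ : a \notin s by apply: contra aL => /ssf.
have ls x : last x s = zf by rewrite /s /= !last_cat /= !last_cat /= last_cat last_rcons.
have ips : ipath s.
  (* If [M3] were empty, [zl] and [zf] would be adjacent and form a triangle with [a]. *)
  case: M3 {hm hM2 rm e opL glueL} ic => [|m3 M3] ic; last exact: icyc_ipath (icyc_rot ic).
  have [p es] : exists p, s = zl :: p by eexists.
  have {}ic : icyc (zl :: p) by rewrite -es.
  have lp : last zl p = zf by rewrite -(ls zl) es.
  case/icycP: ic => _ _ sp h.
  have zp : zf \in p by rewrite -lp; case: p sp {es lp h} => // y p _; exact: (mem_last y p).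
  have zz : zl -- zf by rewrite (h _ zp) lp eqxx orbT.
  by have := triangle_free hg azl zz; rewrite azf.
have ica : icyc (a :: s).
  apply/icycP; split=> //; first by rewrite /s /= !size_cat /=; clear; lia.
  move=> z zs; rewrite ls /=; apply/idP/orP=> [az|[/eqP->|/eqP->]] //.
  have : [|| z == zl, z == zf, z \in M4, z \in M1 | z \in rcons q1 t1 ++ rcons q2 t2 ++ y3].
    move: zs; rewrite /s !(mem_cat, mem_rcons, in_cons).
    by do 4 case: (z == _); do 5 case: (z \in _).
  case/or4P=> [->|->|/nM4|/orP[/nM1|/(opt_sub opE)/aE]]; rewrite ?az //; by [left|right].
apply: (@wheel_touching _ a t1 t2 (zl :: M4 ++ q1) q2 (y3 ++ rcons M1 zf) HX HY) => //.
- rewrite disjoint_sym disjoint_subset; apply/subsetP=> z; rewrite !inE.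
  move=> /predU1P[->|zs]; first by rewrite -in_setU.
  have : z \in s by rewrite /s.
  by move=> /ssf/sf[h _]; rewrite -in_setU.
- move=> y z yX; rewrite in_cons => /predU1P[->|zs]; first exact: aX.
  by have [_] := sf _ (ssf _ zs); apply.
- by rewrite /= size_cat oddD o1 addbN addbb.
- by rewrite o2.
by rewrite size_cat size_rcons oddD o3 addNb /= addbN addbb.
Qed.

End Endgame.

(** * Hubs made of a connected bipartite set and its legs *)

Section Triple.
Variable G : sgraph.
Hypothesis hg : forall s : seq G, odd_cycle s -> 11 <= size s.
Variables (S V : {set G}) (e : G -> bool).
Hypothesis cS : conn S.
Hypothesis eS : {in S &, forall x y, x -- y -> e x != e y}.
Hypothesis SV : {in S & V, forall x y, x != y /\ ~~ (x -- y)}.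
Implicit Types (x y z a w t : G) (A : {set G}) (r l : link G) (X Y L : seq (link G)).

(** Legs attached at vertices of the side [c] belong to the other side, the one that is not
    contracted. The hub thus sees the cycle only through its legs. *)
Lemma hub_legs c A : stable A -> [disjoint A & S] ->
  {in A, forall a, (exists2 x, x \in S & x -- a) /\ {in S, forall x, x -- a -> e x = c}} ->
  hub [set x in S | e x == c] ([set x in S | e x != c] :|: A).
Proof.
move=> sA AS hA; have dA x : x \in S -> x \notin A by move=> xS; rewrite (disjointFl AS xS).
have U : [set x in S | e x == c] :|: ([set x in S | e x != c] :|: A) = S :|: A.
  by apply/setP=> x; rewrite !inE; case: (x \in S); case: (e x == c); rewrite ?orbT.
split.
- rewrite disjoint_subset; apply/subsetP=> x; rewrite !inE => /andP[xS ->].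
  by rewrite xS /= (dA _ xS).
- apply/forall_inP=> x; rewrite inE => /andP[xS /eqP ex].
  apply/forall_inP=> y; rewrite inE => /andP[yS /eqP ey].
  by apply/negP=> /(eS xS yS); rewrite ex ey eqxx.
- apply/forall_inP=> x xH; apply/forall_inP=> y; move: xH; rewrite !in_setU !in_set.
  case/orP=> [/andP[xS ex]|xA] /orP[/andP[yS ey]|yA].
  + by apply/negP=> /(eS xS yS); move: ex ey; case: (e x); case: (e y); case: c {hA U}.
  + have [_ h] := hA _ yA; apply/negP=> /(h _ xS)/eqP; by rewrite (negbTE ex).
  + have [_ h] := hA _ xA; apply/negP; rewrite sedge_sym => /(h _ yS)/eqP;
    by rewrite (negbTE ey).
  by have /forall_inP/(_ _ xA)/forall_inP/(_ _ yA) := sA.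
rewrite U; have /set0Pn[s sS] := cS.1.
have co x : x \in S :|: A -> connect (restr (S :|: A)) s x.
  have coS y : y \in S -> connect (restr (S :|: A)) s y.
    by move=> yS; apply: restr_sub (conn_connect cS sS yS); apply: subsetUl.
  case/setUP=> [/coS//|xA]; have [[y yS yx] _] := hA _ xA.
  apply: connect_trans (coS _ yS) _; apply: connect1.
  by rewrite /restr /= !in_setU yS xA orbT.
move=> x y xU yU; apply: connect_trans (co _ yU).
by rewrite restr_sym; apply: co.
Qed.

(* [r] and [l] are the links before and after the end of a leg [a], which is
   attached to [S] at [w]. *)
Definition leg r l a w : Prop :=
  [/\ flex r, flex l, a -- r.2 & (a \notin S) /\ (a \notin V)] /\
  [/\ w \in S, w -- a & {in S, forall x, x -- a -> x = w}].
Definition apart r a r' a' := [/\ ~~ (a -- a'), ~~ (a -- r'.2) & ~~ (a' -- r.2)].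

Lemma hub_two r1 l1 a1 w1 r2 l2 a2 w2 : leg r1 l1 a1 w1 -> leg r2 l2 a2 w2 ->
  ~~ (a1 -- a2) -> e w1 = e w2 ->
  hub [set x in S | e x == e w1] ([set x in S | e x != e w1] :|: [set a1; a2]).
Proof.
move=> [[_ _ _ [a1S _]] [w1S wa1 u1]] [[_ _ _ [a2S _]] [w2S wa2 u2]] n12 ew.
apply: hub_legs.
- apply/forall_inP=> x; rewrite !inE => /orP[]/eqP->; apply/forall_inP=> y; rewrite !inE =>
  /orP[]/eqP->;
    rewrite ?sedge_irr // sedge_sym //.
- by rewrite disjoint_subset; apply/subsetP=> x; rewrite !inE => /orP[]/eqP->.
move=> a; rewrite !inE => /orP[]/eqP->; split; try by [exists w1 | exists w2].
  by move=> x xS /(u1 _ xS)->.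
by move=> x xS /(u2 _ xS)->.
Qed.

(** The third leg is on the wrong side: it stays out of the hub, but [w3] touches it. If [a3] sees
    no links but [r3] and [l3], [wheel_leg] applies. Otherwise [a1] or [a2] sees a link away from
    the ends of both, and the vertex seen there replaces the end of the third leg. *)
Lemma pair_wheel r1 l1 a1 w1 X1 r2 l2 a2 w2 X2 r3 l3 a3 w3 X3 :
  let L := [:: r1, l1 & X1] ++ [:: r2, l2 & X2] ++ [:: r3, l3 & X3] in
  necklace L -> {subset verts L <= V} ->
  leg r1 l1 a1 w1 -> leg r2 l2 a2 w2 -> leg r3 l3 a3 w3 ->
  apart r1 a1 r2 a2 -> apart r2 a2 r3 a3 -> apart r3 a3 r1 a1 ->
  e w1 = e w2 -> e w3 != e w1 ->
  [|| ~~ has (touch a3) ([:: r1, l1 & X1] ++ [:: r2, l2 & X2] ++ X3),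
      has (touch a1) (X1 ++ X2 ++ [:: r3, l3 & X3]) |
      has (touch a2) (X1 ++ X2 ++ [:: r3, l3 & X3])] ->
  has_odd_wheel_tminor G.
Proof.
move=> L nk LV g1 g2 g3 [n12 n12' n21'] [n23 n23' n32'] [n31 n31' n13'] e12 e3 C.
have hH := hub_two g1 g2 n12 e12.
case: g1 => [[fr1 fl1 a1r [a1S a1V]] [w1S wa1 u1]].
case: g2 => [[fr2 fl2 a2r [a2S a2V]] [w2S wa2 u2]].
case: g3 => [[fr3 fl3 a3r [a3S a3V]] [w3S wa3 u3]].
set HX := [set x in S | e x == e w1] in hH.
set HY := _ :|: [set a1; a2] in hH.
have HXS x : x \in HX -> x \in S by rewrite inE => /andP[].
have inH z : z \in HX :|: HY -> [\/ z \in S, z = a1 | z = a2].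
  rewrite !inE => /or4P[/andP[h _]|/andP[h _]|/eqP h|/eqP h];
    by [constructor 1|constructor 2|constructor 3].
have sf : {in verts L, forall z, safe HX HY z}.
  move=> z /LV zV; split; last by move=> x /HXS xS; have [] := SV xS zV.
  apply/negP=> /inH[zS|za|za]; first by have [] := SV zS zV; rewrite eqxx.
    by move: a1V; rewrite -za zV.
  by move: a2V; rewrite -za zV.
have t1 z : a1 -- z -> touched HY z by move=> az; apply/exists_inP; exists a1;
  rewrite // !inE eqxx !orbT.
have t2 z : a2 -- z -> touched HY z by move=> az; apply/exists_inP; exists a2;
  rewrite // !inE eqxx !orbT.
have rot1 : necklace ([:: r2, l2 & X2 ++ [:: r3, l3 & X3]] ++ [:: r1, l1 & X1]).
  by apply: necklace_rot nk.
have memL L' : {subset L' <= L} -> {in verts L', forall z, safe HX HY z}.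
  by move=> sub z /(verts_sub sub)/sf.
have [nT|/negbTE kT] := boolP (~~ has (touch a3) ([:: r1, l1 & X1] ++ [:: r2, l2 & X2] ++ X3)).
  have n3 := touchN nT.
  apply: (@wheel_leg G hg HX HY a3 r3 l3 (X3 ++ [:: r1]) (l1 :: X1 ++ [:: r2]) (l2 :: X2)
    r1.2 r2.2) => //.
  - have -> : [:: r3; l3] ++ (X3 ++ [:: r1]) ++ (l1 :: X1 ++ [:: r2]) ++ (l2 :: X2)
      = [:: r3, l3 & X3] ++ ([:: r1, l1 & X1] ++ [:: r2, l2 & X2]) by do 6 rewrite -?catA /=.
    by apply: necklace_rot; rewrite -catA.
  - apply: memL => k; rewrite /L !(mem_cat, in_cons, in_nil, orbF).
    by do 6 case: (k == _); do 3 case: (k \in _).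
  - by rewrite has_cat /= fr1 orbT.
  - by rewrite /= fl1.
  - by rewrite /= fl2.
  - by rewrite /ends map_cat last_cat.
  - by rewrite /ends /= map_cat last_cat.
  - exact: t1.
  - exact: t2.
  - by apply/exists_inP; exists w3; rewrite // !inE w3S e3.
  - apply/negP=> /exists_inP[y yH yr]; have yH' : y \in HX :|: HY by rewrite inE yH orbT.
    have rV : r3.2 \in V.
      apply/LV/(@verts_sub G [:: r3]); last by rewrite verts_cons eqxx.
      by move=> k; rewrite inE => /eqP->; rewrite /L !(mem_cat, in_cons) eqxx !orbT.
    case: (inH _ yH') => [yS|ey|ey]; first by have [_] := SV yS rV; rewrite yr.
      by move: n13'; rewrite -ey yr.
    by move: n23'; rewrite -ey yr.
  - split.
      apply/negP=> /inH[aS|ea|ea]; first by rewrite aS in a3S.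
        by move: n31'; rewrite ea a1r.
      by move: n32'; rewrite ea a2r.
    move=> x; rewrite inE => /andP[xS ex]; apply: contra e3 => /(u3 _ xS)<-.
    by [].
  - apply: contra a3V => h; apply: LV; apply: verts_sub h => k.
    rewrite /L !(mem_cat, in_cons, in_nil, orbF).
    by do 6 case: (k == _); do 3 case: (k \in _).
  move=> z h; apply: n3; apply: verts_sub h => k; rewrite !(mem_cat, in_cons, in_nil, orbF).
  by do 4 case: (k == _); do 3 case: (k \in _).
have [z zX tz] : exists2 z, z \in verts (X1 ++ X2 ++ [:: r3, l3 & X3]) & touched HY z.
  by move: C; rewrite kT orFb => /orP[]/touchP[z zL az]; exists z => //; [apply: t1|apply: t2].
(* [wheel_two] expects [z] after the second end; a rotation achieves this when [z] is in [X1]. *)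
move: zX; rewrite verts_cat mem_cat => /orP[zX|zX].
  apply: (wheel_two hH rot1 _ fr2 fl2 fl1 (t2 _ a2r) (t1 _ a1r) tz zX).
  apply: memL => k; rewrite /L !(mem_cat, in_cons, in_nil, orbF).
  by do 6 case: (k == _); do 3 case: (k \in _).
exact: (wheel_two hH nk sf fr1 fl1 fl2 (t1 _ a1r) (t2 _ a2r) tz zX).
Qed.

(* Three legs wait for a wheel: two of them are attached to [S] on the same
   side. *)
Lemma triple_wheel r1 l1 a1 w1 X1 r2 l2 a2 w2 X2 r3 l3 a3 w3 X3 :
  let L := [:: r1, l1 & X1] ++ [:: r2, l2 & X2] ++ [:: r3, l3 & X3] in
  necklace L -> {subset verts L <= V} ->
  leg r1 l1 a1 w1 -> leg r2 l2 a2 w2 -> leg r3 l3 a3 w3 ->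
  apart r1 a1 r2 a2 -> apart r2 a2 r3 a3 -> apart r3 a3 r1 a1 ->
  [|| ~~ has (touch a3) ([:: r1, l1 & X1] ++ [:: r2, l2 & X2] ++ X3),
      has (touch a1) (X1 ++ X2 ++ [:: r3, l3 & X3]) |
      has (touch a2) (X1 ++ X2 ++ [:: r3, l3 & X3])] ->
  [|| ~~ has (touch a1) ([:: r2, l2 & X2] ++ [:: r3, l3 & X3] ++ X1),
      has (touch a2) (X2 ++ X3 ++ [:: r1, l1 & X1]) |
      has (touch a3) (X2 ++ X3 ++ [:: r1, l1 & X1])] ->
  [|| ~~ has (touch a2) ([:: r3, l3 & X3] ++ [:: r1, l1 & X1] ++ X2),
      has (touch a3) (X3 ++ X1 ++ [:: r2, l2 & X2]) |
      has (touch a1) (X3 ++ X1 ++ [:: r2, l2 & X2])] ->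
  has_odd_wheel_tminor G.
Proof.
move=> L nk LV g1 g2 g3 p12 p23 p31 C3 C1 C2.
have nk1 : necklace ([:: r2, l2 & X2] ++ [:: r3, l3 & X3] ++ [:: r1, l1 & X1]).
  by rewrite catA; apply: necklace_rot.
have nk2 : necklace ([:: r3, l3 & X3] ++ [:: r1, l1 & X1] ++ [:: r2, l2 & X2]).
  by apply: necklace_rot; rewrite -catA.
have sub1 : {subset verts ([:: r2, l2 & X2] ++ [:: r3, l3 & X3] ++ [:: r1, l1 & X1]) <= V}.
  by move=> z h; apply: LV; apply: verts_sub h => k; rewrite catA mem_cat orbC -mem_cat.
have sub2 : {subset verts ([:: r3, l3 & X3] ++ [:: r1, l1 & X1] ++ [:: r2, l2 & X2]) <= V}.
  by move=> z h; apply: LV; apply: verts_sub h => k; rewrite mem_cat orbC -mem_cat -catA.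
have [e12|n12] := eqVneq (e w1) (e w2); last first.
  have [e23|n23] := eqVneq (e w2) (e w3).
    by apply: (pair_wheel nk1 sub1 g2 g3 g1 p23 p31 p12 e23 n12 C1).
  have e31 : e w3 = e w1 by move: n12 n23; do 3 case: (e _).
  by apply: (pair_wheel nk2 sub2 g3 g1 g2 p31 p12 p23 e31 _ C2); rewrite eq_sym e31 // eq_sym.
have [e31|n31] := eqVneq (e w3) (e w1); last exact: pair_wheel nk LV g1 g2 g3 p12 p23 p31 e12
  n31 C3.
case: g1 => [[fr1 fl1 a1r [a1S a1V]] [w1S wa1 u1]].
case: g2 => [[fr2 fl2 a2r [a2S a2V]] [w2S wa2 u2]].
case: g3 => [[fr3 fl3 a3r [a3S a3V]] [w3S wa3 u3]].
case: p12 p23 p31 => [n12 _ _] [n23 _ _] [n31 _ _].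
have hH : hub [set x in S | e x == e w1] ([set x in S | e x != e w1] :|: [set a1; a2; a3]).
  apply: hub_legs.
  - apply/forall_inP=> x; rewrite !inE -orbA => /or3P[]/eqP->; apply/forall_inP=> y;
    rewrite !inE -orbA => /or3P[]/eqP->; rewrite ?sedge_irr // sedge_sym //.
  - by rewrite disjoint_subset; apply/subsetP=> x; rewrite !inE -orbA => /or3P[]/eqP->.
  move=> a; rewrite !inE -orbA => /or3P[]/eqP->; split;
    try by [exists w1 | exists w2 | exists w3].
  - by move=> x xS /(u1 _ xS)->.
  - by move=> x xS /(u2 _ xS)->.
  by move=> x xS /(u3 _ xS)->.
set HX := [set x in S | e x == e w1] in hH.
set HY := _ :|: [set a1; a2; a3] in hH.
have tA a z : a \in [set a1; a2; a3] -> a -- z -> touched HY z.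
  by move=> aA ar; apply/exists_inP; exists a; rewrite // in_setU aA orbT.
apply: (@wheel_three G HX HY (l1 :: X1 ++ [:: r2]) (l2 :: X2 ++ [:: r3]) (l3 :: X3 ++ [::
  r1]) r2.2 r3.2 r1.2 hH).
- have -> : (l1 :: X1 ++ [:: r2]) ++ (l2 :: X2 ++ [:: r3]) ++ (l3 :: X3 ++ [:: r1]) =
    (l1 :: X1 ++ [:: r2, l2 & X2] ++ [:: r3, l3 & X3]) ++ [:: r1] by do 6 rewrite -?catA /=.
  exact: necklace_rot.
- move=> z h; have zV : z \in V.
    apply: LV; apply: verts_sub h => k; rewrite /L !(mem_cat, in_cons, in_nil, orbF).
    by do 6 case: (k == _); do 3 case: (k \in _).
  have nS : z \notin S by apply/negP=> zS; have [] := SV zS zV; rewrite eqxx.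
  split; last by move=> x; rewrite inE => /andP[xS _]; have [] := SV xS zV.
  rewrite !inE (negbTE nS) /= -!orbA !negb_or.
  by apply/and3P; split; apply: contraTneq zV => ->.
- by rewrite /= fl1.
- by rewrite /= fl2.
- by rewrite /= fl3.
- by rewrite /ends /= map_cat last_cat.
- by rewrite /ends /= map_cat last_cat.
- by rewrite /ends /= map_cat last_cat.
- by apply: tA a2r; rewrite !inE eqxx orbT.
- by apply: tA a3r; rewrite !inE eqxx !orbT.
by apply: tA a1r; rewrite !inE eqxx.
Qed.

End Triple.

(** [f j] stands for a block other than [j] seen by the leg [j], or for [j] if there is none;
    [C x y z] is what [pair_wheel] needs when [z] is on the wrong side. Three fixed points are
    enough. Otherwise five points are not fixed, and among these [C x y z] can fail only if [f]
    exchanges [x] and [y]. Exchanged pairs are disjoint, so some three of the five points contain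
    none. *)
Lemma three_of_seven (f : nat -> nat) : exists p q s, p < q < s /\ s < 7 /\
  let C x y z := f z = z \/ (f x != x /\ f x != y) \/ (f y != y /\ f y != x) in
  [/\ C p q s, C q s p & C s p q].
Proof.
pose s0 := [seq j <- iota 0 7 | f j == j]; pose s1 := [seq j <- iota 0 7 | f j != j].
have sz : size s0 + size s1 = 7.
  by rewrite !size_filter -[RHS](size_iota 0 7) -(count_predC (fun j => f j == j)).
have srt (a : pred nat) : sorted ltn [seq j <- iota 0 7 | a j].
  by apply: sorted_filter (iota_ltn_sorted 0 7) => x y z; apply: ltn_trans.
have [h|h] := leqP 3 (size s0).
  have m0 j : j \in s0 -> f j = j /\ j < 7.
    by rewrite mem_filter mem_iota => /andP[/eqP-> ].
  have := srt (fun j => f j == j); rewrite -/s0; move: m0 h.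
  case: s0 {sz srt} => [|p [|q [|s s0]]] //= m0 _ /and3P[pq qs _].
  have [fp _] : f p = p /\ p < 7 by apply: m0; rewrite !inE eqxx ?orbT.
  have [fq _] : f q = q /\ q < 7 by apply: m0; rewrite !inE eqxx ?orbT.
  have [fs s7] : f s = s /\ s < 7 by apply: m0; rewrite !inE eqxx ?orbT.
  by exists p, q, s; rewrite pq qs; do !split=> //; left; tauto.
have m1 j : j \in s1 -> f j != j /\ j < 7.
  by rewrite mem_filter mem_iota => /andP[-> ].
have {}h : 5 <= size s1 by move: sz h; clear; lia.
have := srt (fun j => f j != j); rewrite -/s1; move: m1 h {sz srt}.
case: s1 => [|a [|b [|c [|d [|e s1]]]]] //= m1 _ /and5P[ab bc cd de _].
have [fa _] : f a != a /\ a < 7 by apply: m1; rewrite !inE eqxx ?orbT.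
have [fb _] : f b != b /\ b < 7 by apply: m1; rewrite !inE eqxx ?orbT.
have [fc c7] : f c != c /\ c < 7 by apply: m1; rewrite !inE eqxx ?orbT.
have [fd d7] : f d != d /\ d < 7 by apply: m1; rewrite !inE eqxx ?orbT.
have [fe e7] : f e != e /\ e < 7 by apply: m1; rewrite !inE eqxx ?orbT.
pose m x y := (f x == y) && (f y == x).
have H x y z : x < y < z -> z < 7 -> f x != x -> f y != y -> f z != z ->
  ~~ [|| m x y, m y z | m x z] -> exists p q s, p < q < s /\ s < 7 /\
  let C x y z := f z = z \/ (f x != x /\ f x != y) \/ (f y != y /\ f y != x) in
  [/\ C p q s, C q s p & C s p q].
  move=> xyz z7 fx fy fz; rewrite !negb_or !negb_and => /and3P[h1 h2 h3].
  exists x, y, z; do !split=> //; right.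
  - by case/orP: h1; [left|right].
  - by case/orP: h2; [left|right].
  by case/orP: h3; [right|left].
have [mab|nab] := boolP (m a b).
  have [mcd|ncd] := boolP (m c d).
    apply: (H a c e) => //; first by move: ab bc cd de; clear; lia.
    by move: mab mcd ab bc cd de; rewrite /m; clear; lia.
  apply: (H a c d) => //; first by move: ab bc cd de; clear; lia.
  by move: mab ncd ab bc cd de; rewrite /m; clear; lia.
have [mac|nac] := boolP (m a c).
  have [mbd|nbd] := boolP (m b d).
    apply: (H a b e) => //; first by move: ab bc cd de; clear; lia.
    by move: mac mbd ab bc cd de; rewrite /m; clear; lia.
  apply: (H a b d) => //; first by move: ab bc cd de; clear; lia.
  by move: mac nbd ab bc cd de; rewrite /m; clear; lia.
have [mbc|nbc] := boolP (m b c).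
  have [mad|nad] := boolP (m a d).
    apply: (H a b e) => //; first by move: ab bc cd de; clear; lia.
    by move: mbc mad ab bc cd de; rewrite /m; clear; lia.
  apply: (H a b d) => //; first by move: ab bc cd de; clear; lia.
  by move: mbc nad ab bc cd de; rewrite /m; clear; lia.
apply: (H a b c) => //; first by rewrite ab bc.
by rewrite (negbTE nab) (negbTE nbc) (negbTE nac).
Qed.

(** * Choosing the legs and assembling the wheel *)

Section Main.
Variable G : sgraph.
Hypothesis hg : forall s : seq G, odd_cycle s -> 11 <= size s.

Lemma wheel_of_col : ~~ col 636 [set: G] -> has_odd_wheel_tminor G.
Proof.
move=> n0; have [A [_ cA nA _]] := big_component n0.
have [F1 [P1 [Q1 [B1 [lev1 _ cF1 nF1]]]]] := @levelled_exists G hg 318 A isT cA nA.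
have [F [P [Q [B [lev sub cF nF]]]]] := @levelled_exists G hg 159 F1 isT cF1 nF1.
have [L [Z [sL fL pL nk [vL eL]]]] := @necklace_exists G hg 14 F P Q B lev cF nF.
have FF z : z \in F -> z \in F1.
  by move=> zF; apply: (subsetP sub); rewrite !in_setU zF.
case: lev1 => cB [FP1 PQ1 QB1] [dFP dPQ] FQB PB.
have /fin_all_exists [fa fap] x : exists a, x \in F1 -> a \in P1 /\ a -- x.
  have [/FP1[a aP ax]|n] := boolP (x \in F1); first by exists a.
  by exists x.
have /fin_all_exists [fw fwp] x : exists w, x \in P1 -> w \in Q1 /\ w -- x.
  have [/PQ1[a aP ax]|n] := boolP (x \in P1); first by exists a.
  by exists x.
(* Block [i < 7] consists of the links before and after the end of the leg [i], and block 7 of the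
   closing link. *)
pose r i := nth Z L i.*2; pose l i := nth Z L i.*2.+1.
pose blk i := if i < 7 then [:: r i; l i] else [:: Z].
pose fl s := flatten [seq blk i | i <- s].
have eN : rcons L Z = fl (iota 0 8).
  rewrite /fl /blk /r /l; move: sL; clear.
  by do 14 case: L => [|? L] //; case: L.
have fl_cat s1 s2 : fl (s1 ++ s2) = fl s1 ++ fl s2 by rewrite /fl map_cat flatten_cat.
have hfl a s : has (touch a) (fl s) = has (fun m => has (touch a) (blk m)) s.
  by elim: s => //= i s IH; rewrite /fl /= has_cat -/(fl s) IH.
pose t i := (r i).2; pose a i := fa (t i); pose w i := fw (a i).
have rL i : i < 7 -> r i \in L by move=> i7; apply: mem_nth; rewrite sL; move: i7; clear; lia.
have lL i : i < 7 -> l i \in L by move=> i7; apply: mem_nth; rewrite sL; move: i7; clear; lia.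
have tF i : i < 7 -> t i \in F by move=> /rL ri; apply: eL; apply: map_f.
have aP i : i < 7 -> a i \in P1 /\ a i -- t i by move=> /tF/FF/fap.
have wQ i : i < 7 -> w i \in Q1 /\ w i -- a i by move=> /aP[/fwp].
have far i j s : i < 7 -> j < 7 -> i != j -> path sedge (t i) s -> last (t i) s = t j ->
    size s <= 4 -> False.
  have lem i' j' : i' < j' -> j' < 7 -> ~~ near (t j') (t i').
    move=> ij j7; have h : ~~ near (nth Z.2 (ends L) j'.*2) (nth Z.2 (ends L) i'.*2).
      apply: (elimT (pairwiseP Z.2) pL i'.*2 j'.*2); rewrite ?inE ?size_map ?sL;
        by move: ij j7; clear; lia.
    by move: h; rewrite !(nth_map Z) // sL; move: ij j7; clear; lia.
  move=> i7 j7 ij ps ls sz; have nij : near (t i) (t j) by apply/nearP; exists s.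
  have [h|h|h] := ltngtP i j; last by rewrite h eqxx in ij.
    by have := lem _ _ h j7; rewrite nearC nij.
  by have := lem _ _ h i7; rewrite nij.
have ap i j : i < 7 -> j < 7 -> i != j -> apart (r i) (a i) (r j) (a j).
  move=> i7 j7 ij; have [_ ai] := aP i i7; have [_ aj] := aP j j7; split; apply/negP=> h.
  - by apply: (far i j [:: a i; a j; t j]); rewrite //= sedge_sym ai h aj.
  - by apply: (far i j [:: a i; t j]); rewrite //= sedge_sym ai h.
  by apply: (far i j [:: a j; t j]); rewrite //= sedge_sym h aj.
pose T j := [seq m <- iota 0 8 | (m != j) && has (touch (a j)) (blk m)].
(* The default [j] of [head] encodes that the leg sees no block but its own. *)
pose f j := head j (T j).
have fN j : f j = j -> forall m, m < 8 -> m != j -> ~~ has (touch (a j)) (blk m).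
  move=> fj m m8 mj; apply/negP=> h.
  have : m \in T j by rewrite mem_filter mem_iota mj h m8.
  move: fj; rewrite /f; case E: (T j) => [|x s] //= ej _.
  have : x \in T j by rewrite E mem_head.
  by rewrite mem_filter ej eqxx.
have fY j : f j != j -> f j < 8 /\ has (touch (a j)) (blk (f j)).
  rewrite /f; case E: (T j) => [|x s] /=; first by rewrite eqxx.
  have : x \in T j by rewrite E mem_head.
  by rewrite mem_filter mem_iota => /andP[/andP[_ h] x8]; split.
have [p [q [s [pqs [s7 [C1 C2 C3]]]]]] := three_of_seven f.
have [pq qs] : p < q /\ q < s by apply/andP.
have p7 : p < 7 by move: pq qs s7; clear; lia.
have q7 : q < 7 by move: pq qs s7; clear; lia.
have [bw bwQ] : exists2 b, b \in B1 & b -- w p by have [/QB1[b ? ?] _] := wQ p p7; exists b.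
have [bq bqB bqw] : exists2 b, b \in B1 & b -- w q by have [/QB1[b ? ?] _] := wQ q q7; exists b.
have [bs bsB bsw] : exists2 b, b \in B1 & b -- w s by have [/QB1[b ? ?] _] := wQ s s7; exists b.
rewrite sedge_sym => bpw; rewrite sedge_sym in bqw; rewrite sedge_sym in bsw.
pose W := w p |: (w q |: (w s |: B1)).
have cW : conn W.
  apply: conn_add bpw; last by rewrite !in_setU1 bwQ !orbT.
  apply: conn_add bqw; last by rewrite !in_setU1 bqB !orbT.
  exact: conn_add bsw.
have inW x : (x \in W) = [|| x == w p, x == w q, x == w s | x \in B1] by rewrite !in_setU1.
have [|||S [e [SW cS [pS qS sS] eS]]] := @tripod G hg W (w p) (w q) (w s) cW.
- by rewrite inW eqxx.
- by rewrite inW eqxx !orbT.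
- by rewrite inW eqxx !orbT.
have SQB x : x \in S -> x \in Q1 :|: B1.
  move/(subsetP SW); rewrite inW in_setU; case/or4P=> [/eqP->|/eqP->|/eqP->|->];
    rewrite ?orbT //.
  - by have [-> _] := wQ p p7.
  - by have [-> _] := wQ q q7.
  by have [-> _] := wQ s s7.
have SV : {in S & F1, forall x y, x != y /\ ~~ (x -- y)}.
  by move=> x y /SQB xS yF; rewrite eq_sym sedge_sym; apply: FQB.
have legs i : i < 7 -> w i \in S -> leg S F1 (r i) (l i) (a i) (w i).
  move=> i7 wS; have [aP1 at_] := aP i i7; have [wQ1 wa] := wQ i i7.
  split; split=> //.
  - by apply: (allP fL); apply: rL.
  - by apply: (allP fL); apply: lL.
  - split; last by rewrite (disjointFl dFP aP1).
    apply/negP=> /SQB /setUP[aQ|aB]; first by have := disjointFr dPQ aP1; rewrite aQ.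
    by have [] := PB _ _ aP1 aB; rewrite eqxx.
  move=> x /(subsetP SW) xW xa.
  (* If [a i] saw another [w j], then [t i], [a i], [w j], [a j], [t j] would be a walk of length 4
     between two ends of the rope. *)
  have wj j : j < 7 -> x = w j -> x = w i.
    move=> j7 xj; have [->//|ij] := eqVneq i j.
    have [_ aj] := aP j j7; have [_ waj] := wQ j j7; case: (far i j [:: a i; w j; a j; t j]) =>
      //=.
    by rewrite sedge_sym at_ sedge_sym -xj xa xj waj aj.
  move: xW; rewrite inW => /or4P[/eqP|/eqP|/eqP|xB]; try exact: wj.
  by have [_] := PB _ _ aP1 xB; rewrite sedge_sym xa.
pose J1 := iota p.+1 (q - p.+1); pose J2 := iota q.+1 (s - q.+1).
(* The third gap wraps around: it contains the closing link and the blocks before [p]. *)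
pose J3 := iota s.+1 (8 - s.+1) ++ iota 0 p.
have eI : iota 0 8 = iota 0 p ++ (p :: J1) ++ (q :: J2) ++ (s :: iota s.+1 (8 - s.+1)).
  have e1 : q = p + (q - p.+1).+1 by move: pq; clear; lia.
  have e2 : s = q + (s - q.+1).+1 by move: qs; clear; lia.
  have [k ek] : exists k, k = 8 - s.+1 by eexists.
  rewrite -ek; have -> : 8 = p + ((q - p.+1).+1 + ((s - q.+1).+1 + k.+1)).
    by move: pq qs s7 ek; clear; lia.
  by rewrite !iotaD add0n -e1 -e2.
have inJ m : (m \in iota 0 8) = [|| m == p, m == q, m == s, m \in J1, m \in J2 | m \in J3].
  rewrite eI /J3 !(mem_cat, in_cons).
  by do 3 case: (m == _); rewrite ?orbT //; do 4 case: (m \in _); rewrite ?orbT.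
have no x js : f x = x -> x < 7 -> {in js, forall m, m < 8 /\ m != x} -> ~~ has (touch (a x))
  (fl js).
  move=> fx x7 h; rewrite hfl; apply/hasPn=> m mj; have [m8 mx] := h _ mj.
  exact: fN.
have yes x js : f x != x -> f x \in js -> has (touch (a x)) (fl js).
  by move=> fx fj; rewrite hfl; apply/hasP; exists (f x) => //; have [] := fY _ fx.
have f8 x : f x != x -> f x \in iota 0 8 by move=> fx; rewrite mem_iota; have [] := fY _ fx.
have blkE x : x < 7 -> blk x = [:: r x; l x] by rewrite /blk => ->.
have ep js : [:: r p, l p & fl js] = fl (p :: js) by rewrite /fl /= blkE.
have eq' js : [:: r q, l q & fl js] = fl (q :: js) by rewrite /fl /= blkE.
have es js : [:: r s, l s & fl js] = fl (s :: js) by rewrite /fl /= blkE.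
have cond x y z X1 X2 X3 : x < 7 -> y < 7 -> z < 7 ->
    f z = z \/ (f x != x /\ f x != y) \/ (f y != y /\ f y != x) ->
    {in X1, forall m, m < 8 /\ m != z} ->
    {subset [seq m <- iota 0 8 | (m != x) && (m != y)] <= X2} ->
    {subset [seq m <- iota 0 8 | (m != x) && (m != y)] <= X3} ->
    [|| ~~ has (touch (a z)) (fl X1), has (touch (a x)) (fl X2) | has (touch (a y)) (fl X3)].
  move=> x7 y7 z7 [fz|[[f1 f2]|[f1 f2]]] h1 h2 h3; apply/or3P.
  - by constructor 1; apply: no.
  - by constructor 2; apply: yes => //; apply: h2; rewrite mem_filter f1 f2 f8.
  by constructor 3; apply: yes => //; apply: h3; rewrite mem_filter f1 f2 f8.
have vF1 : {subset verts (fl (iota 0 8)) <= F1}.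
  by move=> z; rewrite -eN => /vL zv; apply: (subsetP sub).
have nk' : necklace (fl (p :: J1) ++ fl (q :: J2) ++ fl (s :: J3)).
  rewrite eN eI !fl_cat in nk; move/necklace_rot: nk.
  have -> : fl (s :: J3) = fl (s :: iota s.+1 (8 - s.+1)) ++ fl (iota 0 p) by rewrite -fl_cat.
  by rewrite -!catA.
have [pnq pns qns] : [/\ p != q, p != s & q != s].
  by split; move: pq qs; clear; lia.
rewrite -ep -eq' -es in nk'.
apply: (@triple_wheel G hg S F1 e cS eS SV (r p) (l p) (a p) (w p) (fl J1) (r q) (l q) (a q)
  (w q) (fl J2)
  (r s) (l s) (a s) (w s) (fl J3) nk').
- move=> z zv; apply: vF1; apply: verts_sub zv => k.
  rewrite ep eq' es -!fl_cat => /flatten_mapP[m mJ km]; apply/flatten_mapP; exists m => //.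
  by move: mJ; rewrite inJ !(mem_cat, in_cons); do 3 case: (m == _); rewrite ?orbT.
- exact: legs.
- exact: legs.
- exact: legs.
- exact: ap.
- exact: ap.
- by apply: ap; rewrite // eq_sym.
- rewrite ep eq' es -!fl_cat; apply: cond => // m;
    rewrite ?mem_filter /J1 /J2 /J3 !(mem_cat, in_cons, mem_iota); move: pq qs s7; clear; lia.
- rewrite ep eq' es -!fl_cat; apply: cond => // m;
    rewrite ?mem_filter /J1 /J2 /J3 !(mem_cat, in_cons, mem_iota); move: pq qs s7; clear; lia.
rewrite ep eq' es -!fl_cat; apply: cond => // m;
  rewrite ?mem_filter /J1 /J2 /J3 !(mem_cat, in_cons, mem_iota); move: pq qs s7; clear; lia.
Qed.

End Main.

Theorem theorem3p1 (G : sgraph)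
  (hgirth : geq_ext (odd_girth G) 11)
  (hwheel : ~ has_odd_wheel_tminor G) :
  colourable 199049 G.
Proof.
apply/col_colourable/(@col_le _ 636) => //.
apply: contraT => /wheel_of_col h.
by case: hwheel; apply: h; apply/odd_girth_geqP.
Qed.
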